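(* Let $n\ge 2$ and assume that $2\le p,q<\infty$ and $0<s<1$ are such that $sp<n$ and $p<q\le np/(n-sp)$, and write $b=n\left(\frac1q-\frac1p\right)+s$. Then there is a constant $\sigma=\sigma(n,p,q,s)>0$, depending only on $n,p,q,s$, such that $$\iint_{\mathbb{R}^n_+\times\mathbb{R}^n_+}\frac{|u(x)-u(y)|^p}{|x-y|^{n+sp}}\,dy\,dx-\mathcal{D}\int_{\mathbb{R}^n_+}|u(x)|^p x_n^{-sp}\,dx\ \ge\ \sigma\left(\int_{\mathbb{R}^n_+}|u(x)|^q x_n^{-bq}\,dx\right)^{p/q}$$ for all $u\in\mathcal{W}^{s,p}_0(\mathbb{R}^n_+)$, where $$\mathcal{D}=\mathcal{D}(n,p,s)=2\pi^{\frac{n-1}{2}}\,\frac{\Gamma\left(\frac{1+sp}{2}\right)}{\Gamma\left(\frac{n+sp}{2}\right)}\int_0^1\left|1-r^{(sp-1)/p}\right|^p\frac{dr}{(1-r)^{1+sp}}.$$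
   Context: $\mathbb{R}^n_+=\mathbb{R}^{n-1}\times(0,\infty)$, $x_n$ denotes the last coordinate of $x\in\mathbb{R}^n_+$, and $\Gamma$ is the gamma function. $C_0^\infty(\mathbb{R}^n_+)$ is the space of smooth functions whose support is a compact set in $\mathbb{R}^n_+$. For a measurable function $u:\mathbb{R}^n_+\to\mathbb{R}$, $$|u|_{W^{s,p}(\mathbb{R}^n_+)}=\left(\iint_{\mathbb{R}^n_+\times\mathbb{R}^n_+}\frac{|u(x)-u(y)|^p}{|x-y|^{n+sp}}\,dy\,dx\right)^{1/p}.$$ The space $\mathcal{W}^{s,p}_0(\mathbb{R}^n_+)$ is the completion of $C_0^\infty(\mathbb{R}^n_+)$ with respect to the seminorm $|\cdot|_{W^{s,p}(\mathbb{R}^n_+)}$. For $sp<n$ it is identified with a subspace of $L^{np/(n-sp)}(\mathbb{R}^n_+)$ as follows: every sequence $(u_j)\subset C_0^\infty(\mathbb{R}^n_+)$ that is Cauchy with respect to $|\cdot|_{W^{s,p}(\mathbb{R}^n_+)}$ converges in $L^{np/(n-sp)}(\mathbb{R}^n_+)$ to some function $u$, and the elements of $\mathcal{W}^{s,p}_0(\mathbb{R}^n_+)$ are exactly the functions $u$ arising as such limits. When $sp=1$ one has $\mathcal{D}=0$, and the term $\mathcal{D}\int_{\mathbb{R}^n_+}|u(x)|^p x_n^{-sp}\,dx$ is then understood to be $0$ (convention $0\cdot\infty=0$). *)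

(* Defs.v *)
From HB Require Import structures.
From mathcomp Require Import all_boot all_order all_algebra.
From mathcomp Require Import all_classical all_reals all_analysis.

Set Implicit Arguments.
Unset Strict Implicit.
Unset Printing Implicit Defensive.

Import Order.TTheory GRing.Theory Num.Theory.
Import numFieldTopology.Exports numFieldNormedType.Exports.

Local Open Scope classical_set_scope.
Local Open Scope ring_scope.

Definition rV_display : measure_display -> measure_display.
Proof. exact. Qed.

(* The product sigma-algebra on row vectors, i.e. the one generated by the
   coordinate maps (for real entries: the Borel sets of R^n); it mirrors the
   library's instance for n.-tuple T. *)
Section measurable_rV.
Context {d} {T : measurableType d}.
Variable n : nat.

Let coors : 'I_n -> 'rV[T]_n -> T := fun i x => x ord0 i.

Let rV_set0 : g_sigma_preimage coors set0.
Proof. exact: sigma_algebra0. Qed.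

Let rV_setC A : g_sigma_preimage coors A -> g_sigma_preimage coors (~` A).
Proof. exact: sigma_algebraC. Qed.

Let rV_bigcup (F : _^nat) : (forall i, g_sigma_preimage coors (F i)) ->
  g_sigma_preimage coors (\bigcup_i (F i)).
Proof. exact: sigma_algebra_bigcup. Qed.

HB.instance Definition _ := @isMeasurable.Build (rV_display d)
  'rV[T]_n (g_sigma_preimage coors) rV_set0 rV_setC rV_bigcup.

End measurable_rV.

Lemma measurable_coord d (T : measurableType d) n (i : 'I_n) :
  measurable_fun [set: 'rV[T]_n] (fun x => x ord0 i).
Proof.
move=> _ Y mY; rewrite setTI; apply: sub_sigma_algebra => /=.
rewrite -bigcup_seq/=; exists i => /=; first by rewrite mem_index_enum.
by exists Y => //; rewrite setTI.
Qed.

Lemma measurable_fun_coordP d1 d2 (T1 : measurableType d1)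
    (T2 : measurableType d2) n (f : T1 -> 'rV[T2]_n) :
  measurable_fun [set: T1] f <->
  forall i, measurable_fun [set: T1] (fun x => f x ord0 i).
Proof.
split=> [mf i|mf].
  exact: (measurableT_comp (@measurable_coord _ _ _ i)).
have sub : g_sigma_preimage (fun i (x : T1) => f x ord0 i) `<=` measurable.
  apply: smallest_sub; first exact: sigma_algebra_measurable.
  rewrite -bigcup_seq/=; apply: bigcup_sub => i _ A [B mB <-].
  exact: mf.
move=> _ A mA; apply: sub.
rewrite (_ : (fun i x => _) = fun i => (fun x : 'rV[T2]_n => x ord0 i) \o f)//.
by rewrite g_sigma_preimage_comp; exists A.
Qed.

Section lebesgue_rV.
Context {R : realType}.

Definition rcons_rV n (z : 'rV[R]_n * measurableTypeR R) : 'rV[R]_n.+1 :=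
  \row_i (if unlift ord_max i is Some j then z.1 ord0 j else z.2).

Lemma measurable_rcons_rV n :
  measurable_fun [set: 'rV[R]_n * measurableTypeR R] (@rcons_rV n).
Proof.
apply/measurable_fun_coordP => i; rewrite /rcons_rV.
under eq_fun do rewrite mxE.
case: (unlift ord_max i) => [j|]; last exact: measurable_snd.
exact: (measurableT_comp (@measurable_coord _ _ _ j) measurable_fst).
Qed.


Section rcons_measure.
Variables (n : nat) (m : {measure set 'rV[R]_n -> \bar R}).

Definition rcons_measure : set 'rV[R]_n.+1 -> \bar R :=
  pushforward (m \x @lebesgue_measure R)%E (@rcons_rV n).

Let rcons_measure0 : rcons_measure set0 = 0%E.
Proof. by rewrite /rcons_measure /pushforward preimage_set0 measure0. Qed.

Let rcons_measure_ge0 A : (0 <= rcons_measure A)%E.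
Proof. exact: (measure_ge0 (m \x @lebesgue_measure R)%E). Qed.

Let rcons_measure_sigma_additive : semi_sigma_additive rcons_measure.
Proof.
pose mf := @measurable_rcons_rV n.
move=> F mF tF mUF; rewrite /rcons_measure /pushforward preimage_bigcup.
apply: (@measure_semi_sigma_additive _ _ _ (m \x @lebesgue_measure R)%E).
- by move=> k; rewrite -[X in measurable X]setTI; exact: mf.
- apply/trivIsetP => /= i j _ _ ij; rewrite -preimage_setI.
  by move/trivIsetP : tF => /(_ _ _ _ _ ij) ->//; rewrite preimage_set0.
- by rewrite -preimage_bigcup -[X in measurable X]setTI; exact: mf.
Qed.

HB.instance Definition _ := isMeasure.Build _ _ _ rcons_measure
  rcons_measure0 rcons_measure_ge0 rcons_measure_sigma_additive.

End rcons_measure.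

Fixpoint lebesgue_rV_rec n : {measure set 'rV[R]_n -> \bar R} :=
  if n is m.+1 then rcons_measure (lebesgue_rV_rec m) else dirac (0 : 'rV[R]_0).

Definition lebesgue_rV n : set 'rV[R]_n -> \bar R := lebesgue_rV_rec n.
Arguments lebesgue_rV n A : clear implicits.

HB.instance Definition _ n := Measure.on (lebesgue_rV n).


Let box n (A : 'I_n -> set R) : set 'rV[R]_n :=
  [set x : 'rV[R]_n | forall i, A i (x ord0 i)].

Let measurable_box n (A : 'I_n -> set R) :
  (forall i, measurable (A i)) -> measurable (box A).
Proof.
move=> mA; rewrite (_ : box A = \bigcap_i ((fun x => x ord0 i) @^-1` A i)).
  apply: fin_bigcap_measurable => // i _.
  by rewrite -[X in measurable X]setTI; exact: measurable_coord.
by apply/seteqP; split=> x /= xA i *; exact: xA.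
Qed.

Lemma lebesgue_rV_box n (A : 'I_n -> set R) :
  (forall i, measurable (A i)) ->
  lebesgue_rV n [set x : 'rV[R]_n | forall i, A i (x ord0 i)] =
  (\prod_(i < n) @lebesgue_measure R (A i))%E.
Proof.
elim: n A => [|n IH] A mA.
  by rewrite big_ord0 /lebesgue_rV/= diracE mem_set//= => -[].
pose B (i : 'I_n) := A (lift ord_max i).
have mB i : measurable (B i) by exact: mA.
rewrite big_ord_recr/= [LHS]/lebesgue_rV/= /rcons_measure /pushforward.
rewrite (_ : _ @^-1` _ = box B `*` A ord_max); last first.
  apply/seteqP; split=> -[x y] /=.
    move=> xy; split=> [i|].
      by have := xy (lift ord_max i); rewrite mxE liftK.
    by have := xy ord_max; rewrite mxE unlift_none.
  move=> [xB yA] i; rewrite mxE; case: unliftP => [j|] -> //=; exact: xB.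
rewrite [LHS]product_measure1E; [|exact: measurable_box mB|exact: mA].
congr (_ * _)%E; rewrite [LHS]IH//; apply: eq_bigr => i _.
by rewrite /B; congr (lebesgue_measure (A _)); apply/val_inj; rewrite /= /bump leqNgt ltn_ord.
Qed.

Let lebesgue_rV_sigma_finite n : sigma_finite setT (lebesgue_rV n).
Proof.
pose A k (_ : 'I_n) : set R := `[- k%:R, k%:R]%classic.
have mA k i : measurable (A k i) by exact: measurable_itv.
exists (fun k => box (A k)).
  apply/seteqP; split=> // x _.
  exists (Num.truncn (\sum_i `|x ord0 i|)).+1 => //= i.
  rewrite /A /= in_itv/= -ler_norml ltW// (le_lt_trans _ (truncnS_gt _))//.
  by rewrite (bigD1 i)//= lerDl sumr_ge0.
move=> k; split; first exact: measurable_box.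
rewrite lebesgue_rV_box// (eq_bigr (fun=> (k%:R + k%:R)%:E)).
  by rewrite prodEFin ltry.
move=> i _; rewrite /A lebesgue_measure_itv/= lte_fin opprK.
by case: ltP => // kk; case: k kk => [|k]; rewrite ?addr0// leNgt gtrN ?ltr0n.
Qed.

HB.instance Definition _ n := Measure_isSigmaFinite.Build _ _ _ (lebesgue_rV n)
  (@lebesgue_rV_sigma_finite n).

End lebesgue_rV.
Arguments lebesgue_rV {R} n A.

Section half_space.
Context {R : realType} {n : nat}.
Implicit Types (x y : 'rV[R]_n) (u f : 'rV[R]_n -> R) (s p q : R).

(* The library norm `|x| on 'rV[R]_n is the sup norm. *)
Definition enorm x : R := Num.sqrt (\sum_(i < n) x ord0 i ^+ 2).

Definition last_coord : 'rV[R]_n -> R :=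
  match n as k return 'rV[R]_k -> R with
  | 0 => fun=> 0
  | m.+1 => fun x : 'rV[R]_m.+1 => x ord0 ord_max
  end.

Definition half_space : set 'rV[R]_n := [set x | 0 < last_coord x].

Definition iter_partial (l : seq 'I_n) f : 'rV[R]_n -> R :=
  foldr (fun i g x => 'D_(delta_mx ord0 i) g x) f l.

Definition smooth f := forall l : seq 'I_n,
  continuous (iter_partial l f) /\
  forall (i : 'I_n) x, derivable (iter_partial l f) x (delta_mx ord0 i).

Definition fun_support f : set 'rV[R]_n := closure [set x | f x != 0].

(* C_0^oo(R^n_+), its elements being extended by 0 to all of R^n. *)
Definition test_function f :=
  [/\ smooth f, compact (fun_support f) & fun_support f `<=` half_space].

(* The p-th power of the seminorm; the integrand is 0 on the (null) diagonal. *)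
Definition gagliardo s p u : \bar R :=
  (\int[lebesgue_rV n \x lebesgue_rV n]_(z in half_space `*` half_space)
     (`|u z.1 - u z.2| `^ p / enorm (z.1 - z.2) `^ (n%:R + s * p))%:E)%E.

Definition sobolev_seminorm s p u : \bar R := (gagliardo s p u `^ p^-1)%E.

Definition seminorm_cauchy s p (v : nat -> 'rV[R]_n -> R) :=
  forall e : R, 0 < e -> exists N, forall j k, (N <= j)%N -> (N <= k)%N ->
    (sobolev_seminorm s p (v j \- v k)%R < e%:E)%E.

Definition Lnorm_half q f : \bar R :=
  'N[lebesgue_rV n]_(q%:E)[EFin \o (f \_ half_space)]%E.

(* Only the values of u on the half-space matter; those outside of it are
   arbitrary. *)
Definition sobolev0 s p u :=
  measurable_fun half_space u /\
  exists v : nat -> 'rV[R]_n -> R,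
    [/\ forall j, test_function (v j), seminorm_cauchy s p v &
        Lnorm_half (n%:R * p / (n%:R - s * p)) (v j \- u) @[j --> \oo] --> 0%E].

Definition hardy_integral s p u : \bar R :=
  (\int[lebesgue_rV n]_(x in half_space)
     (`|u x| `^ p * last_coord x `^ (- (s * p)))%:E)%E.

Definition weighted_integral q (b : R) u : \bar R :=
  (\int[lebesgue_rV n]_(x in half_space)
     (`|u x| `^ q * last_coord x `^ (- (b * q)))%:E)%E.

End half_space.

Definition Gamma {R : realType} (z : R) : R :=
  \int[lebesgue_measure]_(t in `]0, +oo[) (t `^ (z - 1) * expR (- t)).

Definition hardy_const {R : realType} (n : nat) (s p : R) : R :=
  2 * pi `^ ((n%:R - 1) / 2)
  * (Gamma ((1 + s * p) / 2) / Gamma ((n%:R + s * p) / 2))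
  * \int[lebesgue_measure]_(r in `]0, 1[)
      (`|1 - r `^ ((s * p - 1) / p)| `^ p / (1 - r) `^ (1 + s * p)).

(* Main.v *)
(** Let [t] be the last coordinate, [alpha := (s p - 1) / p] and
    [v := u / t^alpha].  For [p >= 2] and pairs with [x] below [y], a convexity
    inequality bounds [|u x - u y|^p] from below by a difference of multiples of
    [|u x|^p] and [|u y|^p], plus a multiple of [t^(s p - 1) |v x - v y|^p].
    Integrated against the kernel, the first two terms become one-dimensional
    integrals times the Hardy integral, and their difference is [D / 2] times
    it; both diverge at ratio [1], hence the cut-off [rho < 1] of the ratio of
    heights and the limit [rho -> 1].

    The remainder controls the weighted [L^q] norm [I] of [v].  Compare [v x]
    with its average over a box.  Where [|v x|^q] is small relative to [I], take
    a box at height about [lam t], [lam] being so large that these averages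
    contribute at most [I / 2] and are absorbed; where it is large, take a cube
    at [x] of side below [t], yet large enough for the average to be a small
    fraction of [|v x|^q].

    This settles bounded functions supported in a compact subset of the
    half-space.  A sequence of test functions defining [u] has an a.e.
    convergent subsequence; it is Cauchy for the energy, hence also for the
    Hardy term, so both pass to the limit, and Fatou handles the norm. *)
Require Import Defs.
From HB Require Import structures.
From mathcomp Require Import all_boot all_order all_algebra.
From mathcomp Require Import all_classical all_reals all_analysis.
From mathcomp Require Import measurable_realfun ring lra.

Set Implicit Arguments.
Unset Strict Implicit.
Unset Printing Implicit Defensive.

Import Order.TTheory GRing.Theory Num.Theory.
Import numFieldTopology.Exports numFieldNormedType.Exports.

Local Open Scope classical_set_scope.
Local Open Scope ring_scope.

(** * Measurability and integration *)

(** The power [t^alpha] makes the main terms scale: integrated over the points at a given ratio of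
    heights, they give one power of the height, which is why each becomes a multiple of the Hardy
    integral. In terms of [v] the weight of the [L^q] norm is [t^gam] with [gam = (n-1) q/p - n].
    Averaging over boxes at height about [lam t] and integrating in [x] costs a factor of order
    [lam^-(1 + gam)]. Since [1 + gam = (n-1)(q-p)/p] is positive for [n >= 2] and [p < q], a large
    [lam] makes it small. This [lam] is fixed before the Hardy remainder is formed, because the
    remainder keeps only pairs whose heights have ratio at most [2 lam] and its constant depends on
    [lam]. The difference terms carry a factor [I^(1 - p/q)]; dividing by it leaves the power [p/q]
    of the statement. Absorbing half of [I] requires [I] finite, hence the restriction to functions
    supported away from the boundary and the final limit. The upper bound on [q] is used as
    [n (1 - p/q) <= s p]: a cube of side [r <= t] contributes [r^(s p - n (1 - p/q))], which may
    then be replaced by the same power of [t]. *)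

Lemma measurable_compr d1 d2 d3 (T1 : measurableType d1) (T2 : measurableType d2)
    (T3 : measurableType d3) (h : T2 -> T3) (f : T1 -> T2) :
  measurable_fun setT h -> measurable_fun setT f ->
  measurable_fun setT (fun x => h (f x)).
Proof. by move=> mh mf; exact: (measurableT_comp mh mf). Qed.

Section measurability.
Context d (T : measurableType d) (R : realType).
Implicit Types f g : T -> R.

Lemma measurable_add f g : measurable_fun setT f -> measurable_fun setT g ->
  measurable_fun setT (fun x => f x + g x).
Proof. exact: measurable_funD. Qed.

Lemma measurable_opp f : measurable_fun setT f ->
  measurable_fun setT (fun x => - f x).
Proof. exact: measurable_funN. Qed.

Lemma measurable_mul f g : measurable_fun setT f -> measurable_fun setT g ->
  measurable_fun setT (fun x => f x * g x).
Proof. exact: measurable_funM. Qed.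

Lemma measurable_pow f p : measurable_fun setT f ->
  measurable_fun setT (fun x => f x `^ p).
Proof. by move=> mf; exact: (measurableT_comp (measurable_powR p) mf). Qed.

(** Reduces the inverse to a real power through [x^-1 = x (x^2)^-1], which holds at 0 as well by the
    convention [0^-1 = 0]. *)
Lemma measurable_inv f : measurable_fun setT f ->
  measurable_fun setT (fun x => (f x)^-1).
Proof.
move=> mf; rewrite (_ : (fun x => _) = fun x => f x * (f x ^+ 2) `^ (-1)).
  by apply: measurable_mul => //; apply/measurable_pow/measurable_funX.
apply/funext => x; rewrite powR_inv1 ?sqr_ge0// expr2 invfM mulrA.
by have [->|fx0] := eqVneq (f x) 0; rewrite ?invr0 ?mulr0// divff// mul1r.
Qed.

Lemma measurable_abs f : measurable_fun setT f ->
  measurable_fun setT (fun x => `|f x|).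
Proof. by move=> mf; exact: (measurableT_comp (@normr_measurable R setT)). Qed.

Lemma measurable_exp f : measurable_fun setT f ->
  measurable_fun setT (fun x => expR (f x)).
Proof. by move=> mf; exact: (measurableT_comp (@measurable_expR R)). Qed.

Lemma measurable_natb (b : T -> bool) : measurable_fun setT b ->
  measurable_fun setT (fun x => (b x)%:R : R).
Proof.
move=> mb; rewrite (_ : (fun x => _) = fun x => if b x then 1 else 0).
  exact: measurable_fun_ifT.
by apply/funext => x; case: (b x).
Qed.

Lemma measurable_coor n (f : T -> 'rV[R]_n) (i : 'I_n) :
  measurable_fun setT f -> measurable_fun setT (fun x => f x ord0 i).
Proof. by move=> mf; exact: (measurableT_comp (measurable_coord i) mf). Qed.

Lemma measurable_subrV n (f g : T -> 'rV[R]_n) :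
  measurable_fun setT f -> measurable_fun setT g ->
  measurable_fun setT (fun x => f x - g x).
Proof.
move=> mf mg; apply/measurable_fun_coordP => i.
rewrite (_ : (fun x => _) = fun x => f x ord0 i + - g x ord0 i).
  by apply: measurable_add; [|apply: measurable_opp]; exact: measurable_coor.
by apply/funext => x; rewrite !mxE.
Qed.

Lemma measurable_enorm n (f : T -> 'rV[R]_n) :
  measurable_fun setT f -> measurable_fun setT (fun x => enorm (f x)).
Proof.
move=> mf; rewrite (_ : (fun x => _) =
    fun x => (\sum_(i < n) f x ord0 i ^+ 2) `^ 2^-1).
  apply/measurable_pow/measurable_sum => i; apply: measurable_funX.
  exact: measurable_coor.
by apply/funext => x; rewrite powR12_sqrt// sumr_ge0// => i _; exact: sqr_ge0.
Qed.

End measurability.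

(* Hypotheses are matched syntactically: unification would unfold the
   integrands and diverge in practice. *)
Ltac measurability_step := match goal with
  | H : measurable_fun _ ?f |- measurable_fun _ ?g => constr_eq f g; exact: H
  | H : forall k, measurable_fun _ (?f k) |- measurable_fun _ (?g ?k) =>
      constr_eq f g; exact: (H k)
  | |- measurable_fun _ (fun x => x) => exact: measurable_id
  | |- measurable_fun _ (fun _ => ?c) => exact: measurable_cst
  | |- measurable_fun _ (fun x => x.1) => exact: measurable_fst
  | |- measurable_fun _ (fun x => x.2) => exact: measurable_snd
  | |- measurable_fun _ (fun x => (@?f x)%:E) => apply/measurable_EFinP
  | |- measurable_fun _ (EFin \o _) => apply/measurable_EFinP
  | |- measurable_fun _ (fun x => (nat_of_bool _)%:R) => apply: measurable_natb
  | |- measurable_fun _ (fun x => _ + _) => apply: measurable_add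
  | |- measurable_fun _ (fun x => _ * _) => apply: measurable_mul
  | |- measurable_fun _ (fun x => - _) => apply: measurable_opp
  | |- measurable_fun _ (fun x => _ ^-1) => apply: measurable_inv
  | |- measurable_fun _ (fun x => _ ^+ _) => apply: measurable_funX
  | |- measurable_fun _ (fun x => _ `^ _) => apply: measurable_pow
  | |- measurable_fun _ (fun x => `|_|) => apply: measurable_abs
  | |- measurable_fun _ (fun x => expR _) => apply: measurable_exp
  | |- measurable_fun _ (fun x => enorm (_ - _)) =>
      apply: measurable_enorm; apply: measurable_subrV
  | |- measurable_fun _ (fun x => _ && _) => apply: measurable_and
  | |- measurable_fun _ (fun x => (_, _)) => apply: measurable_fun_pair
  | |- measurable_fun _ (fun x => (_ < _)%R) => apply: measurable_fun_ltr
  | |- measurable_fun _ (fun x => (_ <= _)%R) => apply: measurable_fun_ler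
  | |- measurable_fun _ (fun x => fun_of_matrix _ _ _) =>
      apply: measurable_coor
  | |- measurable_fun _ (fun x => \sum_(i < _) _) =>
      apply: measurable_sum; intro
  | H : measurable_fun _ ?h |- measurable_fun _ (fun x => ?g _) =>
      constr_eq h g; apply: (measurable_compr H)
  | H : forall k, measurable_fun _ (?h k) |- measurable_fun _ (fun x => ?g ?k _) =>
      constr_eq h g; apply: (measurable_compr (H k))
  | |- measurable_fun ?D (?h ?a) => change (measurable_fun D (fun x => h a x))
  | H : measurable_fun _ _ |- _ => exact: H
  end.
Ltac measurability := repeat measurability_step.
#[local] Hint Extern 0 (measurable_fun _ _) => solve [measurability] : core.

Section integral.
Context d (T : measurableType d) (R : realType) (mu : {measure set T -> \bar R}).
Local Open Scope ereal_scope.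

Lemma le_integralT (f g : T -> \bar R) : (forall x, 0 <= f x) ->
  measurable_fun setT f -> measurable_fun setT g -> (forall x, f x <= g x) ->
  \int[mu]_x f x <= \int[mu]_x g x.
Proof. by move=> f0 mf mg fg; exact: ge0_le_integral. Qed.

(** Domains of integration are encoded as boolean factors, so that integrals are over the whole
    space and measurability is only a matter of [setT]. *)
Lemma integral_natb (b : T -> bool) (f : T -> R) :
  \int[mu]_(x in [set x | b x]) (f x)%:E = \int[mu]_x ((b x)%:R * f x)%:E.
Proof.
rewrite integral_mkcond; apply: eq_integral => x _; rewrite patchE.
have -> : (x \in [set x | b x]) = b x.
  by apply/idP/idP => [/set_mem//|bx]; apply/mem_set.
by case: (b x); rewrite ?mul1r// mul0r.
Qed.

Lemma integral_rZl (k : R) (f : T -> R) : (0 <= k)%R ->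
  measurable_fun setT f -> (forall x, (0 <= f x)%R) ->
  \int[mu]_x (k * f x)%:E = k%:E * \int[mu]_x (f x)%:E.
Proof.
move=> k0 mf f0; rewrite -ge0_integralZl_EFin//;
  first [exact/measurable_EFinP | by move=> x *; rewrite lee_fin].
Qed.

Lemma integral_rD (f g : T -> R) :
  measurable_fun setT f -> (forall x, (0 <= f x)%R) ->
  measurable_fun setT g -> (forall x, (0 <= g x)%R) ->
  \int[mu]_x (f x + g x)%:E = \int[mu]_x (f x)%:E + \int[mu]_x (g x)%:E.
Proof.
move=> mf f0 mg g0; rewrite -ge0_integralD//;
  first [exact/measurable_EFinP | by move=> x *; rewrite lee_fin].
Qed.

Lemma le_integral_r (f g : T -> R) : (forall x, (0 <= f x)%R) ->
  measurable_fun setT f -> measurable_fun setT g ->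
  (forall x, (f x <= g x)%R) ->
  \int[mu]_x (f x)%:E <= \int[mu]_x (g x)%:E.
Proof.
move=> f0 mf mg fg; apply: le_integralT => //;
  first [exact/measurable_EFinP | by move=> x *; rewrite lee_fin].
Qed.

Lemma integral_le_of_ae_cvg (f : nat -> T -> R) (g : T -> R) (M : \bar R) :
  (forall k, measurable_fun setT (f k)) -> (forall k x, (0 <= f k x)%R) ->
  measurable_fun setT g -> (forall x, (0 <= g x)%R) ->
  {ae mu, forall x, f k x @[k --> \oo] --> g x} ->
  (forall k, \int[mu]_x (f k x)%:E <= M) -> \int[mu]_x (g x)%:E <= M.
Proof.
move=> mf f0 mg g0 fg fM.
have mfE k : measurable_fun setT (EFin \o f k) by exact/measurable_EFinP.
apply: (@le_trans _ _ (\int[mu]_x limn_einf (fun k => (f k x)%:E))).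
  apply: ae_ge0_le_integral => //.
  - by move=> x _; rewrite lee_fin.
  - move=> x _; rewrite limn_einf_lim; apply: lime_ge; first exact: is_cvg_einfs.
    apply: nearW => n; apply: le_ereal_inf_tmp => _ [k _ <-].
    by rewrite lee_fin.
  - rewrite (_ : (fun x => _) = (fun x => - limn_esup (fun k => (- (f k x)%:E)))).
      apply: (measurableT_comp (@oppe_measurable R setT)).
      apply: measurable_fun_limn_esup => k.
      by apply/(measurable_EFinP _ (fun x => - f k x)%R)/measurable_opp.
    apply/funext => x; rewrite -limn_einfN; congr limn_einf; apply/funext => k /=.
    by rewrite opprK.
  apply: filterS fg => x fgx _.
  have /cvg_limn_einf_sup[-> _]// : (f k x)%:E @[k --> \oo] --> (g x)%:E.
  apply: cvg_EFin => //; exact: nearW.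
rewrite (le_trans (fatou mu measurableT mfE _))//.
  by move=> k x _; rewrite lee_fin.
rewrite limn_einf_lim; apply: lime_le; first exact: is_cvg_einfs.
apply: nearW => n; apply: le_trans (fM n).
by apply: ereal_inf_lbound; exists n => /=.
Qed.

Lemma integral_le_of_cvg (f : nat -> T -> R) (g : T -> R) (M : \bar R) :
  (forall k, measurable_fun setT (f k)) -> (forall k x, (0 <= f k x)%R) ->
  measurable_fun setT g -> (forall x, (0 <= g x)%R) ->
  (forall x, f k x @[k --> \oo] --> g x) ->
  (forall k, \int[mu]_x (f k x)%:E <= M) -> \int[mu]_x (g x)%:E <= M.
Proof.
by move=> mf f0 mg g0 fg; apply: integral_le_of_ae_cvg => //; exact: aeW.
Qed.

End integral.

Lemma tonelli_r d1 d2 (T1 : measurableType d1) (T2 : measurableType d2)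
  (R : realType) (m1 : {sigma_finite_measure set T1 -> \bar R})
  (m2 : {sigma_finite_measure set T2 -> \bar R}) (f : T1 * T2 -> R) :
  measurable_fun setT f -> (forall z, 0 <= f z) ->
  (\int[m1]_x \int[m2]_y (f (x, y))%:E = \int[m2]_y \int[m1]_x (f (x, y))%:E)%E.
Proof.
move=> mf f0; apply: (fubini_tonelli (EFin \o f)) => //;
  first [exact/measurable_EFinP | by move=> x *; rewrite lee_fin].
Qed.

Section lebesgue_1d.
Context (R : realType).
Local Notation lambda := (@lebesgue_measure R).
Local Open Scope ereal_scope.

(** The image of Lebesgue measure under [t -> c t + b], multiplied by [c], gives every interval its
    length, hence is Lebesgue measure. *)
Lemma integral_affine (f : R -> \bar R) (c b : R) : (0 < c)%R ->
  measurable_fun setT f -> (forall x, 0 <= f x) ->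
  \int[lambda]_t f (c * t + b)%R = c^-1%:E * \int[lambda]_t f t.
Proof.
move=> c0 mf f0; pose h (t : measurableTypeR R) : measurableTypeR R := (c * t + b)%R.
have mh : measurable_fun [set: measurableTypeR R] h.
  have : measurable_fun [set: R] (fun t : R => c * t + b)%R by measurability.
  exact.
pose hm : {mfun measurableTypeR R >-> measurableTypeR R} :=
  HB.pack h (isMeasurableFun.Build _ _ _ _ _ mh).
pose c' := NngNum (ltW c0).
have E A : measurable A -> lambda A = mscale c' (pushforward lambda hm) A.
  move=> mA; apply: lebesgue_measure_unique => //= _ [[x y]] _ <-.
  rewrite /mscale /pushforward /=.
  rewrite [X in _ = (_ * lebesgue_measure X)%E](_ : _ = `]((x - b) / c)%R, ((y - b) / c)%R]%classic); last first.
    apply/seteqP; split => t /=; rewrite !in_itv/= /h ltr_pdivrMr// ler_pdivlMr//;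
      by rewrite ltrBlDr lerBrDr mulrC.
  rewrite !lebesgue_measure_itv/= !lte_fin ltr_pM2r ?invr_gt0// ltrD2r.
  case: ifP => _; last by rewrite mule0.
  rewrite -!EFinB -EFinM -mulrBl opprB addrA subrK mulrCA divff ?mulr1//.
  exact: lt0r_neq0.
rewrite [in RHS](eq_measure_integral (mscale c' (pushforward lambda hm))); last first.
  by move=> A mA _; exact: E.
rewrite ge0_integral_mscale//= muleA -EFinM mulVf ?lt0r_neq0// mul1e.
by rewrite ge0_integral_pushforward.
Qed.

Lemma integral_affine_r (f : R -> R) (c b : R) : (0 < c)%R ->
  measurable_fun setT f -> (forall x, (0 <= f x)%R) ->
  \int[lambda]_t (f (c * t + b)%R)%:E = c^-1%:E * \int[lambda]_t (f t)%:E.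
Proof.
move=> c0 mf f0; rewrite (integral_affine b c0 (f := EFin \o f))//;
  first [exact/measurable_EFinP | by move=> x *; rewrite lee_fin].
Qed.

Lemma integral_scale (f : R -> R) (c : R) : (0 < c)%R ->
  measurable_fun setT f -> (forall x, (0 <= f x)%R) ->
  \int[lambda]_t (f (c * t)%R)%:E = c^-1%:E * \int[lambda]_t (f t)%:E.
Proof.
move=> c0 mf f0; rewrite -(integral_affine_r 0 c0)//.
by apply: eq_integral => x _; rewrite addr0.
Qed.

Let phi (x : R) : R := (((1 < x) && (x <= 2))%:R)%R.

Let mphi : measurable_fun setT phi.
Proof. by rewrite /phi; measurability. Qed.

Let phi0 x : (0 <= phi x)%R. Proof. exact: ler0n. Qed.

Let int_phi : \int[lambda]_x (phi x)%:E = 1.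
Proof.
rewrite [LHS](_ : _ = \int[lambda]_x (((1 < x) && (x <= 2))%:R * cst 1%R x)%:E);
  last first.
  by apply: eq_integral => x _; rewrite mulr1.
rewrite -integral_natb.
rewrite (_ : [set x : R | (1 < x)%R && (x <= 2)%R] = `]1%R, 2%R]%classic); last first.
  by apply/seteqP; split => x /=; rewrite in_itv.
rewrite (eq_integral (cst 1))// integral_cst//
  mul1e [LHS]lebesgue_measure_itv/= lte_fin ltr1n -EFinB.
by congr EFin; lra.
Qed.

(* No change of variables is needed: insert the mass-one density
   [y phi (z y) dz], exchange the integrals and rescale. *)
Lemma integral_inversion (f : R -> R) :
  measurable_fun setT f -> (forall x, (0 <= f x)%R) ->
  \int[lambda]_y ((0 < y)%R%:R * f y)%:E =
  \int[lambda]_r ((0 < r)%R%:R * (r ^- 2 * f r^-1))%:E.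
Proof.
move=> mf f0.
pose F (z : R * R) : R := ((0 < z.1)%R%:R * (f z.1 * (z.1 * phi (z.2 * z.1))))%R.
have F0 z : (0 <= F z)%R.
  by rewrite /F; case: ltP => z0; rewrite ?mul0r// mul1r !mulr_ge0// ltW.
have mF : measurable_fun setT F.
  apply: measurable_mul; first by measurability.
  apply: measurable_mul; first by apply: (measurable_compr mf); measurability.
  apply: measurable_mul; first by measurability.
  by apply: (measurable_compr mphi); measurability.
transitivity (\int[lambda]_y \int[lambda]_r (F (y, r))%:E).
  apply: eq_integral => y _; rewrite /F/=.
  case: ltP => y0; last by under eq_integral do rewrite mul0r; rewrite integral0 mul0r.
  rewrite mul1r; under eq_integral do rewrite mul1r mulrA.
  rewrite integral_rZl//; last by rewrite mulr_ge0// ltW.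
  under eq_integral do rewrite mulrC.
  rewrite integral_scale// int_phi mule1 -EFinM -mulrA divff ?mulr1//.
  by rewrite gt_eqF.
transitivity (\int[lambda]_r \int[lambda]_y (F (y, r))%:E).
  exact: (tonelli_r lambda lambda mF F0).
pose G (z : R * R) : R :=
  ((0 < z.2)%R%:R * (phi z.1 * z.1 * (z.2 ^- 2 * f (z.1 / z.2))))%R.
have G0 z : (0 <= G z)%R.
  rewrite /G /phi; case: ltP => z0; rewrite ?mul0r// mul1r.
  case: ltP => z1; last by rewrite !mul0r.
  rewrite mulr_ge0// ?mulr_ge0//; first by rewrite (le_trans _ (ltW z1)).
  by rewrite invr_ge0 sqr_ge0.
have mG : measurable_fun setT G.
  apply: measurable_mul; first by measurability.
  apply: measurable_mul.
    apply: measurable_mul; last by measurability.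
    by apply: (measurable_compr mphi); measurability.
  apply: measurable_mul; first by measurability.
  by apply: (measurable_compr mf); measurability.
transitivity (\int[lambda]_r \int[lambda]_z (G (z, r))%:E).
  apply: eq_integral => r _.
  case: (ltP 0%R r) => r0; last first.
    rewrite [LHS]integral0_eq//; last first.
      move=> y _; rewrite /F/=; case: ltP => y0; rewrite ?mul0r// mul1r /phi.
      by rewrite ltNge (le_trans (mulr_le0_ge0 r0 (ltW y0)))//= !mulr0.
    rewrite integral0_eq// => z _; rewrite /G/= ltNge r0 mul0r//.
  have mGr : measurable_fun setT (fun z => G (z, r)).
    by apply: (measurableT_comp mG); exact: measurable_pair2.
  transitivity (\int[lambda]_y (r * G (r * y, r)%R)%:E).
    apply: eq_integral => y _; congr EFin; rewrite /F /G/= r0 mul1r.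
    rewrite [(r * y / r)%R]mulrAC divff ?gt_eqF// mul1r.
    case: (ltP 0%R y) => y0.
      by rewrite mul1r; field; rewrite gt_eqF.
    rewrite mul0r /phi [(1 < r * y)%R]ltNge (le_trans (mulr_ge0_le0 (ltW r0) y0))//=.
    by rewrite !mul0r mulr0.
  rewrite integral_rZl//; last exact: ltW.
  rewrite (integral_scale (f := fun z => G (z, r)))// muleA -EFinM divff ?mul1e//.
  by rewrite gt_eqF.
transitivity (\int[lambda]_z \int[lambda]_r (G (z, r))%:E).
  by symmetry; exact: (tonelli_r lambda lambda mG G0).
transitivity (\int[lambda]_z ((phi z)%:E * \int[lambda]_r ((0 < r)%R%:R * (r ^- 2 * f r^-1))%:E)).
  apply: eq_integral => z _; rewrite /G /phi /=.
  case: (ltP 1%R z) => z1 /=; last first.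
    by under eq_integral do rewrite !mul0r mulr0; rewrite integral0 mul0e.
  case: (z <= 2)%R; last first.
    by under eq_integral do rewrite !mul0r mulr0; rewrite integral0 mul0e.
  have z0 : (0 < z)%R by rewrite (lt_trans _ z1).
  pose H r := ((0 < r)%R%:R * (r ^- 2 * f (z / r)))%R.
  have mH : measurable_fun setT H.
    apply: measurable_mul; first by measurability.
    apply: measurable_mul; first by measurability.
    by apply: (measurable_compr mf); measurability.
  have H0 r : (0 <= H r)%R.
    by rewrite /H !mulr_ge0// invr_ge0 sqr_ge0.
  rewrite mul1e; transitivity (\int[lambda]_r (z * H r)%:E).
    by apply: eq_integral => r _; congr EFin; rewrite /H/=; ring.
  rewrite integral_rZl//; last exact: ltW.
  have zz : \int[lambda]_r (H r)%:E = z%:E * \int[lambda]_r (H (z * r)%R)%:E.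
    by rewrite integral_scale// muleA -EFinM divff ?mul1e// gt_eqF.
  rewrite zz muleA -EFinM.
  have mHz : measurable_fun setT (fun r => H (z * r)%R).
    by apply: (measurable_compr mH); measurability.
  rewrite -integral_rZl//; last by rewrite mulr_ge0// ltW.
  apply: eq_integral => r _; congr EFin; rewrite /H pmulr_rgt0//.
  case: (ltP 0%R r) => r0; rewrite ?mul0r ?mulr0// !mul1r.
  have -> : (z / (z * r) = r^-1)%R by field; rewrite !gt_eqF.
  by field; rewrite !gt_eqF.
rewrite ge0_integralZr//; last 2 first.
- by move=> x _; rewrite lee_fin.
- by apply: integral_ge0 => r _; rewrite lee_fin !mulr_ge0// invr_ge0 sqr_ge0.
by rewrite int_phi mul1e.
Qed.

End lebesgue_1d.

Section tonelli_rV.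
Context (R : realType).
Local Notation lambda := (@lebesgue_measure R).
Local Open Scope ereal_scope.

Lemma integral_rcons n (f : 'rV[R]_n.+1 -> \bar R) :
  measurable_fun setT f -> (forall x, 0 <= f x) ->
  \int[lebesgue_rV n.+1]_x f x =
  \int[lambda]_t \int[lebesgue_rV n]_z f (rcons_rV (z, t)).
Proof.
move=> mf f0.
have mfr : measurable_fun setT (f \o @rcons_rV R n).
  exact: (measurableT_comp mf (@measurable_rcons_rV R n)).
rewrite -(fubini_tonelli (fun z => f (rcons_rV z)))//.
rewrite -(fubini_tonelli1 (f \o @rcons_rV R n))//.
rewrite [LHS](_ : _ =
  \int[pushforward (lebesgue_rV n \x lambda) (@rcons_rV R n)]_x f x)//.
rewrite ge0_integral_pushforward//; first exact: measurable_rcons_rV.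
by move=> z; exact: f0.
Qed.

End tonelli_rV.

(** * Powers and the gamma function *)

Section powR_bounds.
Context (R : realType).
Implicit Types a b k w : R.

Lemma ler_powRl a b w : 0 <= w -> 0 <= a -> a <= b -> a `^ w <= b `^ w.
Proof.
by move=> w0 a0 ab; apply: ge0_ler_powR; rewrite ?nnegrE// (le_trans a0).
Qed.

Lemma ger_powRl a b w : w <= 0 -> 0 < a -> a <= b -> b `^ w <= a `^ w.
Proof.
move=> w0 a0 ab; have b0 : 0 < b by exact: lt_le_trans ab.
rewrite -[w]opprK 2!(powRN _ (- w)) lef_pV2 ?posrE ?powR_gt0//.
by apply: ler_powRl; rewrite ?oppr_ge0// ltW.
Qed.

Lemma powR_ge1 k w : 1 <= k -> 0 <= w -> 1 <= k `^ w.
Proof. by move=> k1 w0; have := @ler_powRl 1 k w w0 ler01 k1; rewrite powR1. Qed.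

Lemma powR_ratio_le a b k w : 0 < a -> a <= b -> b <= k * a ->
  b `^ w <= k `^ `|w| * a `^ w /\ a `^ w <= k `^ `|w| * b `^ w.
Proof.
move=> a0 ab bka; have b0 : 0 < b by exact: lt_le_trans ab.
have k1 : 1 <= k by rewrite -(ler_pM2r a0) mul1r (le_trans ab).
have k0 : 0 < k by rewrite (lt_le_trans _ k1).
have kw1 : 1 <= k `^ `|w| by exact: powR_ge1.
have [w0|w0] := leP 0 w; split.
- rewrite ger0_norm// -powRM ?(ltW a0) ?(ltW k0)//.
  by apply: ler_powRl => //; exact: ltW.
- by rewrite (@le_trans _ _ (b `^ w)) ?ler_powRl ?(ltW a0)// ler_peMl// powR_ge0.
- by rewrite (@le_trans _ _ (a `^ w)) ?ger_powRl ?(ltW w0)// ler_peMl// powR_ge0.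
- rewrite ltr0_norm// powRN -ler_pdivrMl ?invr_gt0 ?powR_gt0// invrK.
  by rewrite -powRM ?(ltW a0) ?(ltW k0)//; apply: ger_powRl => //; exact: ltW.
Qed.

End powR_bounds.

Section integral_powR.
Context (R : realType).
Local Notation lambda := (@lebesgue_measure R).
Implicit Types a z : R.

Lemma lebesgue_natb_itv (x y : R) : x <= y ->
  (\int[lambda]_t (((x < t) && (t < y))%R%:R : R)%:E = (y - x)%:E)%E.
Proof.
move=> xy; transitivity (\int[lambda]_t (((x < t) && (t < y))%R%:R * cst 1%R t)%:E)%E.
  by apply: eq_integral => t _; rewrite mulr1.
rewrite -integral_natb.
rewrite (_ : [set t : R | (x < t) && (t < y)] = `]x, y[%classic); last first.
  by apply/seteqP; split => t /=; rewrite in_itv.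
rewrite (eq_integral (cst 1%E))// integral_cst// mul1e [LHS]lebesgue_measure_itv/=.
rewrite lte_fin; case: (ltP x y) => //= yx.
by have -> : y = x by [apply/eqP; rewrite eq_le xy yx]; rewrite subrr.
Qed.

(* Scaling by 1/2 maps (0, 1) into (0, 1/2), whence I <= 2^(-1-a) (I + 1) for
   the truncated integrals I, and 2^(-1-a) < 1. *)
Lemma integral_powR_lty a : -1 < a ->
  (\int[lambda]_x (((0 < x) && (x < 1))%R%:R * x `^ a)%:E < +oo)%E.
Proof.
move=> a1; have [a0|a0] := leP 0 a.
  apply: (@le_lt_trans _ _ (\int[lambda]_x (((0 < x) && (x < 1))%R%:R : R)%:E)%E).
    apply: le_integral_r.
    - by move=> x; rewrite mulr_ge0 ?powR_ge0.
    - by measurability.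
    - by measurability.
    move=> x; have [/andP[x0 x1]|_] := boolP (_ && _); last by rewrite mul0r.
    by have := ler_powRl a0 (ltW x0) (ltW x1); rewrite mul1r powR1.
  by rewrite lebesgue_natb_itv// ltry.
pose f (k : nat) (x : R) : R := ((k.+1%:R^-1 < x) && (x < 1))%R%:R * x `^ a.
have f0 k x : 0 <= f k x by rewrite mulr_ge0 ?powR_ge0.
have mf k : measurable_fun setT (f k) by rewrite /f; measurability.
have mul0x (x : R) : 0 <= x -> x < 1 -> (x%:E < 1)%E by rewrite lte_fin.
pose th : R := 2 `^ (-1 - a).
have th0 : 0 < th by exact: powR_gt0.
have th1 : th < 1.
  have a1' : 0 < 1 + a by rewrite -ltrBlDl sub0r.
  rewrite /th -opprD powRN invf_lt1 ?powR_gt0//.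
  have := gt0_ltr_powR a1' (x := 1) (y := 2).
  by rewrite powR1 !nnegrE ltr1n => ->.
have fin k : (\int[lambda]_x (f k x)%:E < +oo)%E.
  apply: (@le_lt_trans _ _ (\int[lambda]_x (k.+1%:R `^ `|a| * (((0 < x) && (x < 1))%R%:R : R))%:E)%E).
    apply: le_integral_r => //.
    move=> x; rewrite /f; have [/andP[x0 x1]|_] := boolP (_ && _); last first.
      by rewrite mul0r mulr_ge0 ?powR_ge0.
    have xp : 0 < x by rewrite (lt_trans _ x0)// invr_gt0.
    rewrite xp x1/= mul1r mulr1.
    have [|_] := @powR_ratio_le R x 1 k.+1%:R a xp (ltW x1).
      by rewrite -ler_pdivrMl ?mulr1 ?ltW.
    by rewrite powR1 mulr1.
  rewrite integral_rZl ?powR_ge0//.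
  by rewrite lebesgue_natb_itv// ltry.
have bnd k : (\int[lambda]_x (f k x)%:E <= (th * 2 / (1 - th))%:E)%E.
  have E : (\int[lambda]_x (f k x)%:E = 2^-1%:E * \int[lambda]_x (f k (2^-1 * x))%:E)%E.
    rewrite integral_scale// invrK muleA -EFinM mulVf ?mul1e//.
  have : (\int[lambda]_x (f k (2^-1 * x))%:E <= \int[lambda]_x (2 `^ (- a) *
       (f k x + ((0 < x) && (x < 2))%R%:R))%:E)%E.
    apply: le_integral_r => //.
    move=> x; rewrite {1}/f; have [/andP[x0 x1]|_] := boolP (_ && _); last first.
      by rewrite mul0r mulr_ge0 ?powR_ge0// addr_ge0.
    have xp : 0 < x by rewrite -(pmulr_rgt0 (x := 2^-1))// (lt_trans _ x0)// invr_gt0.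
    rewrite mul1r powRM ?(ltW xp)// -powR_inv1// -powRrM mulN1r ler_wpM2l ?powR_ge0//.
    have -> : (0 < x) && (x < 2) by rewrite xp /=; lra.
    have [x11|x11] := ltP x 1.
      rewrite /f x11 (lt_trans x0) ?mul1r ?lerDl//; lra.
    rewrite (@le_trans _ _ 1) ?lerDr//.
    by have := ger_powRl (ltW a0) ltr01 x11; rewrite powR1.
  move=> H.
  have fk : (\int[lambda]_x (f k x)%:E)%E \is a fin_num.
    by rewrite ge0_fin_numE//; apply: integral_ge0 => x _; rewrite lee_fin.
  move: H; rewrite integral_rZl ?powR_ge0//; last by move=> x; rewrite addr_ge0.
  rewrite integral_rD//.
  rewrite lebesgue_natb_itv// subr0 => H.
  have : (\int[lambda]_x (f k x)%:E <= 2^-1%:E * ((2 `^ (- a))%:E * (\int[lambda]_x (f k x)%:E + 2%:E)))%E.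
    by rewrite {1}E lee_pmul2l// lte_fin.
  rewrite -(fineK fk) -EFinD -!EFinM !lee_fin => {}H.
  rewrite ler_pdivlMr ?subr_gt0// mulrBr mulr1 lerBlDr.
  rewrite (le_trans H)// mulrA.
  have -> : 2^-1 * 2 `^ (- a) = th :> R.
    by rewrite -powR_inv1// -powRD// pnatr_eq0 implybT.
  by rewrite mulrDr addrC [_ * th]mulrC.
apply: (@le_lt_trans _ _ (th * 2 / (1 - th))%:E); last exact: ltry.
apply: integral_le_of_cvg bnd => //.
  by move=> x; rewrite mulr_ge0 ?powR_ge0.
move=> x; apply: cvg_near_cst; have [x0|x0] := ltP 0 x; last first.
  apply: nearW => k; rewrite /f [in LHS]ltNge (le_trans x0)//.
near=> k; rewrite /f; suff -> : k.+1%:R^-1 < x by [].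
near: k; exact: (near_infty_natSinv_lt (PosNum x0)).
Unshelve. all: by end_near. Qed.

End integral_powR.

Section gamma.
Context (R : realType).
Local Notation lambda := (@lebesgue_measure R).
Implicit Types a z t : R.

(** The integral before [fine] is applied; [Gamma] agrees with it once it is known to be finite
    ([Gamma_ereal_fin]). *)
Definition Gamma_ereal z : \bar R :=
  (\int[lambda]_t ((0 < t)%R%:R * (t `^ (z - 1) * expR (- t)))%:E)%E.

Lemma Gamma_erealE z : Gamma z = fine (Gamma_ereal z).
Proof.
rewrite /Gamma /Gamma_ereal /Rintegral -integral_natb; congr (fine (integral _ _ _)).
by apply/seteqP; split => t /=; rewrite in_itv/= andbT.
Qed.

(** This is [t/c <= 1 + t/c <= e^(t/c)] raised to the power [c]. *)
Lemma powR_expRN_le c t : 0 < c -> 0 <= t -> t `^ c * expR (- t) <= c `^ c.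
Proof.
move=> c0 t0; rewrite expRN ler_pdivrMr ?expR_gt0//.
rewrite (_ : expR t = expR (t / c) `^ c); last first.
  by rewrite -expRM mulfVK ?gt_eqF.
rewrite -powRM ?expR_ge0 ?(ltW c0)//; apply: ler_powRl => //; first exact: ltW.
rewrite (@le_trans _ _ (c * (1 + t / c)))//; last by rewrite ler_pM2l// expR_ge1Dx.
by rewrite mulrDr mulr1 mulrCA divff ?gt_eqF// mulr1 lerDr ltW.
Qed.

(** Below 1 the integrand is at most [t^(z-1)]. Beyond 1 it is at most a multiple of [t^-2], since
    [t^(z+1) e^-t] is bounded, and the inversion [t = 1/r] turns this tail into the length of a
    bounded interval. *)
Lemma Gamma_ereal_lty z : 0 < z -> (Gamma_ereal z < +oo)%E.
Proof.
move=> z0; pose c := z + 1; have c0 : 0 < c by rewrite addr_gt0.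
pose g (t : R) : R := (0 < t)%R%:R * ((1 <= t)%R%:R * t ^- 2).
have mg : measurable_fun setT g by rewrite /g.
apply: (@le_lt_trans _ _ (\int[lambda]_t
    (((0 < t) && (t < 1))%R%:R * t `^ (z - 1) + c `^ c * g t)%:E)%E).
  apply: le_integral_r => // [t|t]; first by rewrite !mulr_ge0 ?powR_ge0 ?expR_ge0.
  rewrite /g; have [t0|_] := ltP 0 t; last by rewrite !mul0r mulr0 addr0.
  have [t1|t1] /= := ltP t 1.
    rewrite !mul0r !mulr0 !mul1r addr0 ler_piMr ?powR_ge0//.
    by rewrite expR_le1 oppr_le0 ltW.
  rewrite mul0r add0r !mul1r ler_pdivlMr ?exprn_gt0//.
  rewrite -powR_mulrn ?(ltW t0)// mulrAC -powRD ?(gt_eqF t0) ?implybT//.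
  have -> : z - 1 + 2%:R = c by rewrite /c; ring.
  by rewrite powR_expRN_le// ltW.
have g0 x : 0 <= g x by rewrite /g !mulr_ge0// invr_ge0 sqr_ge0.
rewrite integral_rD//; last 2 first.
- by move=> t; rewrite mulr_ge0 ?powR_ge0.
- by move=> t; rewrite mulr_ge0 ?powR_ge0.
rewrite lte_add_pinfty//; first by apply: integral_powR_lty; rewrite ltrBrDl subrr.
rewrite integral_rZl ?powR_ge0// lte_mul_pinfty ?lee_fin ?powR_ge0//.
rewrite (integral_inversion (f := fun t : R => (1 <= t)%R%:R * t ^- 2))//; last first.
  by move=> t; rewrite mulr_ge0// invr_ge0 sqr_ge0.
apply: (@le_lt_trans _ _ (\int[lambda]_r ((((0 < r) && (r < 2))%R%:R : R))%:E)%E).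
  apply: le_integral_r => // r.
    by rewrite !mulr_ge0 // ?invr_ge0 ?exprn_even_ge0 ?sqr_ge0.
  have [r0|_] := ltP 0 r; last by rewrite mul0r.
  rewrite !mul1r invf_ge1//; have [r1|_] := leP r 1; last by rewrite mul0r mulr0.
  rewrite mul1r exprVn invrK mulVf ?expf_neq0 ?gt_eqF//=.
  by rewrite (le_lt_trans r1) ?ltr1n.
by rewrite lebesgue_natb_itv// ltry.
Qed.

Lemma Gamma_ereal_gt0 z : (0 < Gamma_ereal z)%E.
Proof.
pose c := 2 `^ (- `|z - 1|) * expR (- 2).
apply: (@lt_le_trans _ _ (\int[lambda]_t (c * (((1 < t) && (t < 2))%R%:R : R))%:E)%E).
  rewrite integral_rZl ?mulr_ge0 ?powR_ge0 ?expR_ge0// lebesgue_natb_itv ?ler1n//.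
  by rewrite -EFinM lte_fin !mulr_gt0 ?powR_gt0 ?expR_gt0// subr_gt0 ltr1n.
apply: le_integral_r => // [t|t]; first by rewrite !mulr_ge0 ?powR_ge0 ?expR_ge0.
have [/andP[t1 t2]|_] := boolP (_ && _); last first.
  by rewrite mulr0 !mulr_ge0 ?powR_ge0 ?expR_ge0.
rewrite (lt_trans _ t1)// mulr1 mul1r ler_pM ?powR_ge0 ?expR_ge0//; last first.
  by rewrite ler_expR lerN2 ltW.
have [|_] := @powR_ratio_le R 1 t 2 (z - 1) ltr01 (ltW t1); first by rewrite mulr1 ltW.
by rewrite powR1 powRN -ler_pdivrMl ?powR_gt0// mulr1.
Qed.

Lemma Gamma_ereal_fin z : 0 < z -> Gamma_ereal z = (Gamma z)%:E.
Proof.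
move=> z0; rewrite Gamma_erealE fineK// ge0_fin_numE ?Gamma_ereal_lty//.
exact: ltW (Gamma_ereal_gt0 z).
Qed.

Lemma Gamma_gt0 z : 0 < z -> 0 < Gamma z.
Proof. by move=> z0; rewrite -lte_fin -Gamma_ereal_fin// Gamma_ereal_gt0. Qed.

Lemma Gamma_scale z a : 0 < a -> 0 < z ->
  (\int[lambda]_t ((0 < t)%R%:R * (t `^ (z - 1) * expR (- (t * a))))%:E =
   (a `^ (- z) * Gamma z)%:E)%E.
Proof.
move=> a0 z0; pose f t : R := (0 < t)%R%:R * (t `^ (z - 1) * expR (- t)).
have f0 t : 0 <= f t by rewrite /f !mulr_ge0 ?powR_ge0 ?expR_ge0.
have mf : measurable_fun setT f by rewrite /f.
transitivity (\int[lambda]_t (a `^ (1 - z) * f (a * t))%:E)%E.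
  apply: eq_integral => t _; congr EFin; rewrite /f pmulr_rgt0//.
  have [t0|_] := ltP 0 t; last by rewrite !mul0r mulr0.
  rewrite !mul1r powRM ?(ltW a0) ?(ltW t0)// !mulrA -powRD ?(gt_eqF a0) ?implybT//.
  have -> : 1 - z + (z - 1) = 0 by ring.
  by rewrite powRr0 mul1r [t * a]mulrC.
rewrite integral_rZl ?powR_ge0// integral_scale//.
rewrite [X in (_ * (_ * X))%E](Gamma_ereal_fin z0) -!EFinM; congr EFin.
rewrite mulrA -powR_inv1 ?(ltW a0)// -powRD ?(gt_eqF a0) ?implybT//.
by congr (_ `^ _ * _); ring.
Qed.

End gamma.

(** * The integral of the kernel *)

Section kernel.
Context (R : realType).
Local Notation lambda := (@lebesgue_measure R).

Lemma lift_max_widen n (i : 'I_n) : widen_ord (leqnSn n) i = lift ord_max i.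
Proof. by apply/val_inj; rewrite /= /bump leqNgt ltn_ord. Qed.

Lemma rcons_rV_lift n (z : 'rV[R]_n) (t : R) j :
  rcons_rV (z, t) ord0 (lift ord_max j) = z ord0 j.
Proof. by rewrite mxE liftK. Qed.

Lemma rcons_rV_max n (z : 'rV[R]_n) (t : R) : rcons_rV (z, t) ord0 ord_max = t.
Proof. by rewrite mxE unlift_none. Qed.

Lemma sum_rcons n (G : 'I_n.+1 -> R -> R) (z : 'rV[R]_n) (t : R) :
  \sum_i G i (rcons_rV (z, t) ord0 i) =
  \sum_j G (lift ord_max j) (z ord0 j) + G ord_max t.
Proof.
rewrite big_ord_recr /= rcons_rV_max; congr (_ + _).
by apply: eq_bigr => j _; rewrite lift_max_widen rcons_rV_lift.
Qed.

Lemma gauss_1d (t b : R) : 0 < t ->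
  (\int[lambda]_y (expR (- (t * (b - y) ^+ 2)))%:E = ((pi / t) `^ 2^-1)%:E)%E.
Proof.
move=> t0; have st0 : 0 < Num.sqrt t by rewrite sqrtr_gt0.
have mg : measurable_fun setT (@gauss_fun R) by exact: measurable_gauss_fun.
transitivity (\int[lambda]_y (gauss_fun (Num.sqrt t * y + - (Num.sqrt t * b)))%:E)%E.
  apply: eq_integral => y _; rewrite /gauss_fun; congr (expR (- _))%:E.
  by rewrite -mulrBr exprMn sqr_sqrtr ?(ltW t0)// -[in RHS]sqrrN opprB.
rewrite integral_affine_r//; last by move=> x; exact: gauss_fun_ge0.
rewrite [X in (_ * X)%E]integralT_gauss -EFinM; congr EFin.
rewrite powRM ?pi_ge0 ?invr_ge0 ?(ltW t0)// powR12_sqrt ?pi_ge0// mulrC.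
by rewrite powR12_sqrt ?invr_ge0 ?(ltW t0)// sqrtrV ?(ltW t0).
Qed.

Lemma gauss_rV n (a : 'rV[R]_n) (t : R) : 0 < t ->
  (\int[lebesgue_rV n]_y (expR (- (t * \sum_(i < n) (a ord0 i - y ord0 i) ^+ 2)))%:E
   = ((pi / t) `^ (n%:R / 2))%:E)%E.
Proof.
move=> t0; elim: n a => [|n IH] a.
  rewrite [LHS](_ : _ = (\int[\d_(0%R : 'rV[R]_0)]_y (expR (- (t * \sum_(i < 0)
      (a ord0 i - y ord0 i) ^+ 2)))%:E)%E)//.
  by rewrite integral_dirac// diracT mul1e big_ord0 mulr0 oppr0 expR0 mul0r powRr0.
rewrite integral_rcons//.
transitivity (\int[lambda]_s ((pi / t) `^ (n%:R / 2) *
    expR (- (t * (a ord0 ord_max - s) ^+ 2)))%:E)%E.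
  apply: eq_integral => s _.
  rewrite mulrC EFinM -(IH (\row_j a ord0 (lift ord_max j))) -integral_rZl ?expR_ge0//.
  apply: eq_integral => z _; congr EFin; rewrite -expRD -opprD -mulrDr.
  rewrite (sum_rcons (fun i x => (a ord0 i - x) ^+ 2)) addrC;
    congr (expR (- (t * (_ + _)))).
  by apply: eq_bigr => j _; rewrite mxE.
rewrite integral_rZl ?powR_ge0//.
rewrite gauss_1d// -EFinM -powRD; last by rewrite gt_eqF ?divr_gt0 ?pi_gt0// implybT.
by congr (_ `^ _)%:E; rewrite -natr1; lra.
Qed.

(* Write (S + D)^(-beta) Gamma(beta) as the integral of t^(beta-1) e^(-t(S+D))
   and integrate the Gaussian e^(-tS) first. *)
Lemma integral_kernel n (a : 'rV[R]_n) (D beta : R) : 0 < D -> n%:R / 2 < beta ->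
  (\int[lebesgue_rV n]_y ((\sum_(i < n) (a ord0 i - y ord0 i) ^+ 2 + D) `^ (- beta))%:E
   = (pi `^ (n%:R / 2) * (Gamma (beta - n%:R / 2) / Gamma beta)
      * D `^ (n%:R / 2 - beta))%:E)%E.
Proof.
move=> D0 nb; have b0 : 0 < beta by rewrite (le_lt_trans _ nb)// divr_ge0.
have bn0 : 0 < beta - n%:R / 2 by rewrite subr_gt0.
pose S (y : 'rV[R]_n) : R := \sum_(i < n) (a ord0 i - y ord0 i) ^+ 2.
have mS : measurable_fun setT S by rewrite /S.
have S0 y : 0 <= S y by rewrite /S sumr_ge0// => i _; exact: sqr_ge0.
pose F (z : R * 'rV[R]_n) : R :=
  (0 < z.1)%R%:R * (z.1 `^ (beta - 1) * expR (- (z.1 * (S z.2 + D)))).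
have mF : measurable_fun setT F by rewrite /F.
have F0 z : 0 <= F z by rewrite /F !mulr_ge0 ?powR_ge0 ?expR_ge0.
have E := tonelli_r lambda (lebesgue_rV n) mF F0.
have E1 : (\int[lebesgue_rV n]_y \int[lambda]_t (F (t, y))%:E =
    (Gamma beta)%:E * \int[lebesgue_rV n]_y ((S y + D) `^ (- beta))%:E)%E.
  rewrite -integral_rZl//; last 2 first.
  - exact/ltW/Gamma_gt0.
  - by move=> y; exact: powR_ge0.
  apply: eq_integral => y _; rewrite mulrC -Gamma_scale//.
  by rewrite ltr_wpDl.
have E2 : (\int[lambda]_t \int[lebesgue_rV n]_y (F (t, y))%:E =
    (pi `^ (n%:R / 2) * (D `^ (- (beta - n%:R / 2)) * Gamma (beta - n%:R / 2)))%:E)%E.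
  rewrite [RHS]EFinM -Gamma_scale// -integral_rZl ?powR_ge0//; last first.
    by move=> t; rewrite !mulr_ge0 ?powR_ge0 ?expR_ge0.
  apply: eq_integral => t _.
  have [t0|t0] := ltP 0 t; last first.
    rewrite mul0r mulr0 integral0_eq// => y _.
    by rewrite /F/= ltNge t0 mul0r.
  transitivity (\int[lebesgue_rV n]_y (t `^ (beta - 1) * expR (- (t * D)) *
      expR (- (t * S y)))%:E)%E.
    apply: eq_integral => y _; congr EFin; rewrite /F/= t0 mul1r -mulrA -expRD.
    by rewrite -opprD -mulrDr [D + _]addrC.
  rewrite integral_rZl ?mulr_ge0 ?powR_ge0 ?expR_ge0//.
  rewrite gauss_rV// -EFinM mul1r powRM ?pi_ge0 ?invr_ge0 ?(ltW t0)//; congr EFin.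
  rewrite -[in t^-1]powR_inv1 ?(ltW t0)// -powRrM mulN1r.
  rewrite [beta - _ - 1]addrAC [t `^ (beta - 1 - _)]powRB ?(gt_eqF t0) ?implybT// powRN;
    ring.
have : ((Gamma beta)^-1%:E * ((Gamma beta)%:E *
    \int[lebesgue_rV n]_y ((S y + D) `^ (- beta))%:E) = (Gamma beta)^-1%:E *
    (pi `^ (n%:R / 2) * (D `^ (- (beta - n%:R / 2)) * Gamma (beta - n%:R / 2)))%:E)%E.
  by rewrite -E1 -E2 E.
rewrite muleA -!EFinM mulVf ?mul1e ?gt_eqF ?Gamma_gt0// => ->.
by congr EFin; rewrite opprB; ring.
Qed.

End kernel.

(** * Pointwise inequalities *)

Section pointwise.
Context (R : realType).
Implicit Types x y p t r W w X Y : R.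

Lemma convex_powR_ge0 p t x y : 1 <= p -> 0 <= t <= 1 -> 0 <= x -> 0 <= y ->
  (t * x + (1 - t) * y) `^ p <= t * x `^ p + (1 - t) * y `^ p.
Proof.
move=> p1 /andP[t0 t1] x0 y0.
by apply: (convex_powR p1 (Itv01 t0 t1)); rewrite ?inE/= in_itv/= andbT.
Qed.

Lemma convex_powR_norm p t x y : 1 <= p -> 0 <= t <= 1 ->
  `|t * x + (1 - t) * y| `^ p <= t * `|x| `^ p + (1 - t) * `|y| `^ p.
Proof.
move=> p1 /[dup] /andP[t0 t1] t01.
apply: le_trans (convex_powR_ge0 p1 t01 (normr_ge0 x) (normr_ge0 y)).
apply: ler_powRl => //; first by rewrite (le_trans _ p1).
rewrite (le_trans (ler_normD _ _))// !normrM (ger0_norm t0).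
by rewrite (@ger0_norm _ (1 - t)) ?subr_ge0.
Qed.

Lemma powR_superadditive r x y : 1 <= r -> 0 <= x -> 0 <= y ->
  x `^ r + y `^ r <= (x + y) `^ r.
Proof.
move=> r1 x0 y0; have r0 : 0 < r by rewrite (lt_le_trans _ r1).
rewrite -(mulr_powRB1 x0 r0) -(mulr_powRB1 y0 r0).
rewrite -(mulr_powRB1 (addr_ge0 x0 y0) r0) mulrDl.
by rewrite lerD// ler_wpM2l// ler_powRl// ?subr_ge0// ?lerDl ?lerDr.
Qed.

Lemma powR_sqr x p : (x ^+ 2) `^ (p / 2) = `|x| `^ p.
Proof.
rewrite -real_normK ?num_real// -powR_mulrn// -powRrM; congr (_ `^ _).
by rewrite mulrCA divff ?mulr1// pnatr_eq0.
Qed.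

(** As [p/2 >= 1], superadditivity of the power [p/2] merges the two squares; the parallelogram
    identity and convexity of the same power conclude. *)
Lemma clarkson p x y : 2 <= p ->
  `|(x + y) / 2| `^ p + `|(x - y) / 2| `^ p <= 2^-1 * (`|x| `^ p + `|y| `^ p).
Proof.
move=> p2; have p1 : 1 <= p / 2 by rewrite ler_pdivlMr// mul1r.
rewrite -!powR_sqr (le_trans (powR_superadditive p1 _ _)) ?sqr_ge0//.
have -> : ((x + y) / 2) ^+ 2 + ((x - y) / 2) ^+ 2 =
  2^-1 * x ^+ 2 + (1 - 2^-1) * y ^+ 2 by field.
rewrite (le_trans (convex_powR_ge0 p1 _ _ _)) ?sqr_ge0//; first by lra.
by rewrite mulrDr lerD2l ler_wpM2r ?powR_ge0//; lra.
Qed.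

Lemma uniform_convex_powR p t x y : 2 <= p -> 0 <= t <= 1 ->
  `|t * x + (1 - t) * y| `^ p + 2 `^ (1 - p) * (t * (1 - t)) * `|x - y| `^ p
  <= t * `|x| `^ p + (1 - t) * `|y| `^ p.
Proof.
move=> p2; have p1 : 1 <= p by rewrite (le_trans _ p2)// ler1n.
have half : forall t x y, 0 <= t <= 2^-1 ->
    `|t * x + (1 - t) * y| `^ p + 2 `^ (1 - p) * (t * (1 - t)) * `|x - y| `^ p
    <= t * `|x| `^ p + (1 - t) * `|y| `^ p.
  move=> {}t {}x {}y /andP[t0 t12].
  (* For [t <= 1/2] the point lies between [y] and the midpoint, so plain convexity reduces to the
     midpoint, where [clarkson] gives a gain of [2 t 2^-p |x - y|^p]. The other half follows by
     exchanging [x] and [y]. *)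
  have -> : t * x + (1 - t) * y = (2 * t) * ((x + y) / 2) + (1 - 2 * t) * y by field.
  have t2 : 0 <= 2 * t <= 1 by lra.
  have h1 := convex_powR_norm ((x + y) / 2) y p1 t2.
  have h2 : 2 * t * `|(x + y) / 2| `^ p <= 2 * t * (2^-1 * (`|x| `^ p + `|y| `^ p)
      - `|(x - y) / 2| `^ p).
    by rewrite ler_wpM2l ?mulr_ge0// lerBrDr clarkson.
  have h3 : 2 `^ (1 - p) * (t * (1 - t)) * `|x - y| `^ p <= 2 * t * `|(x - y) / 2| `^ p.
    have e : `|(x - y) / 2| `^ p = 2 `^ (- p) * `|x - y| `^ p.
      rewrite normrM powRM// (@ger0_norm _ 2^-1)// -[2^-1]powR_inv1//.
      by rewrite -powRrM mulN1r mulrC.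
    rewrite e powRD ?pnatr_eq0 ?implybT// powRr1//.
    set A := 2 `^ (- p); set N := `|x - y| `^ p.
    have -> : 2 * A * (t * (1 - t)) * N = (2 * A * N) * (t * (1 - t)) by ring.
    have -> : 2 * t * (A * N) = (2 * A * N) * t by ring.
    by rewrite ler_wpM2l ?mulr_ge0 ?powR_ge0// ler_piMr//; lra.
  by lra.
move=> /andP[t0 t1]; have [t12|t12] := leP t 2^-1; first by rewrite half ?t0.
have := half (1 - t) y x; rewrite subKr distrC [(1 - t) * t]mulrC.
rewrite [(1 - t) * y + _]addrC [_ + t * `|x| `^ p]addrC; apply.
by lra.
Qed.

(* X is the convex combination of (WX - wY)/(W - w) and Y with weights
   1 - w/W and w/W. *)
Lemma ground_state_ineq p W w X Y : 2 <= p -> 0 < w -> w <= W ->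
  (W - w) `^ (p - 1) * (W * `|X| `^ p)
    + 2 `^ (1 - p) * (W `^ (p - 1) * w * `|X - Y| `^ p)
  <= `|W * X - w * Y| `^ p + (W - w) `^ (p - 1) * (w * `|Y| `^ p).
Proof.
move=> p2 w0; have p0 : 0 < p by rewrite (lt_le_trans _ p2).
rewrite le_eqVlt => /predU1P[<-|wW].
  (* With equal weights the convex combination is undefined, but only [2^(1-p) <= 1] is left to
     prove. *)
  have p10 : p - 1 != 0 by rewrite gt_eqF//; lra.
  rewrite subrr powR0// !mul0r add0r addr0 -mulrBr normrM powRM//.
  rewrite (gtr0_norm w0) [w `^ _ * w]mulrC mulr_powRB1 ?(ltW w0)//.
  rewrite ler_piMl ?mulr_ge0 ?powR_ge0//.
  have : 2 `^ (1 - p) <= 2 `^ 0 :> R by apply: ler_powR; [rewrite ler1n|lra].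
  by rewrite powRr0.
have W0 : 0 < W by exact: lt_trans wW.
have Ww : 0 < W - w by rewrite subr_gt0.
pose t := (W - w) / W.
pose Z := (W * X - w * Y) / (W - w).
have t01 : 0 <= t <= 1.
  rewrite /t divr_ge0 ?(ltW W0) ?(ltW Ww)//= ler_pdivrMr// mul1r gerBl; exact: ltW.
have tW : t * W = W - w by rewrite /t divfK// gt_eqF.
have t1W : (1 - t) * W = w by rewrite mulrBl tW mul1r subKr.
have EX : t * Z + (1 - t) * Y = X.
  by rewrite /t /Z; field; rewrite !gt_eqF.
have EZY : `|Z - Y| `^ p * (W - w) `^ p = W `^ p * `|X - Y| `^ p.
  rewrite -{1}(gtr0_norm Ww) -powRM// -normrM -{2}(gtr0_norm W0) -powRM// -normrM.
  by congr (`|_| `^ _); rewrite /Z; field; rewrite gt_eqF.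
have EZ : `|Z| `^ p * (W - w) `^ p = `|W * X - w * Y| `^ p.
  rewrite -(gtr0_norm Ww) -powRM// -normrM.
  by congr (`|_| `^ _); rewrite /Z divfK ?gt_eqF// (gtr0_norm Ww).
have := uniform_convex_powR Z Y p2 t01; rewrite EX.
rewrite -(ler_pM2r (mulr_gt0 W0 (powR_gt0 (p - 1) Ww))).
set A := (W - w) `^ (p - 1) in EZ EZY *.
have EA : (W - w) * A = (W - w) `^ p by rewrite mulr_powRB1 ?ltW.
have EW : W * W `^ (p - 1) = W `^ p by rewrite mulr_powRB1 ?ltW.
suff -> : (`|X| `^ p + 2 `^ (1 - p) * (t * (1 - t)) * `|Z - Y| `^ p) * (W * A) =
  A * (W * `|X| `^ p) + 2 `^ (1 - p) * (W `^ (p - 1) * w * `|X - Y| `^ p).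
  suff -> : (t * `|Z| `^ p + (1 - t) * `|Y| `^ p) * (W * A) =
    `|W * X - w * Y| `^ p + A * (w * `|Y| `^ p) by [].
  by rewrite -EZ -EA -tW -[in RHS]t1W; ring.
have -> : (`|X| `^ p + 2 `^ (1 - p) * (t * (1 - t)) * `|Z - Y| `^ p) * (W * A) =
  A * (W * `|X| `^ p) + 2 `^ (1 - p) * ((1 - t) * (`|Z - Y| `^ p * ((t * W) * A))).
  by ring.
rewrite tW EA EZY -EW -t1W; congr (_ + _ * _); ring.
Qed.

(** Convexity applied to [x = t ((x-y)/t) + (1-t) (y/(1-t))]. The coefficient on the left tends to 1
    with [t -> 0], which later gives the stability of weighted [L^p] integrals under small
    perturbations. *)
Lemma powR_norm_split p t x y : 1 <= p -> 0 < t < 1 ->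
  (1 - t) `^ (p - 1) * `|x| `^ p <=
  `|y| `^ p + ((1 - t) / t) `^ (p - 1) * `|x - y| `^ p.
Proof.
move=> p1 /andP[t0 t1]; have t10 : 0 < 1 - t by rewrite subr_gt0.
have p0 : 0 < p by rewrite (lt_le_trans _ p1).
have t01 : 0 <= t <= 1 by rewrite !ltW.
have := convex_powR_norm ((x - y) / t) (y / (1 - t)) p1 t01.
have -> : t * ((x - y) / t) + (1 - t) * (y / (1 - t)) = x.
  by field; rewrite !gt_eqF.
have e1 : `|t^-1| = t^-1 by rewrite ger0_norm// invr_ge0 ltW.
have e2 : `|(1 - t)^-1| = (1 - t)^-1 by rewrite ger0_norm// invr_ge0 ltW.
rewrite !normrM e1 e2 !powRM ?invr_ge0 ?(ltW t0) ?(ltW t10)//.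
rewrite -!powR_inv1 ?(ltW t0) ?(ltW t10)// -!powRrM !mulN1r => h.
have e (a : R) : 0 < a -> a * a `^ (- p) = a `^ (1 - p).
  by move=> a0; rewrite powRD ?(gt_eqF a0) ?implybT// powRr1// ltW.
have {}h : `|x| `^ p <= t `^ (1 - p) * `|x - y| `^ p + (1 - t) `^ (1 - p) * `|y| `^ p.
  by rewrite (le_trans h)// -!e// !mulrA [_ * `|x - y| `^ p]mulrAC [_ * `|y| `^ p]mulrAC.
apply: le_trans (ler_wpM2l (powR_ge0 _ _) h) _.
by rewrite mulrDr addrC !mulrA -[1 - p]opprB !powRN divff ?gt_eqF ?powR_gt0// mul1r.
Qed.

End pointwise.

(** * Partial integrals, boxes and the Euclidean norm *)

Lemma measurable_integral_r d1 d2 (T1 : measurableType d1)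
  (T2 : measurableType d2) (R : realType)
  (m2 : {sigma_finite_measure set T2 -> \bar R}) (F : T1 * T2 -> R) :
  measurable_fun setT F -> (forall z, 0 <= F z) ->
  measurable_fun setT (fun x => \int[m2]_y (F (x, y))%:E)%E.
Proof.
move=> mF F0; exact: (measurable_fun_fubini_tonelli_F (EFin \o F)).
Qed.

Lemma measurable_forall d (T : measurableType d) (I : finType)
    (b : I -> T -> bool) : (forall i, measurable_fun setT (b i)) ->
  measurable_fun setT (fun x => [forall i, b i x]).
Proof.
move=> mb; apply: (measurable_fun_bool true); rewrite setTI.
rewrite (_ : _ @^-1` _ = \bigcap_(i in [set: I]) (b i @^-1` [set true])).
  apply: fin_bigcap_measurable => // i _; rewrite -[X in measurable X]setTI.
  exact: mb.
apply/seteqP; split=> x /=.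
  by move=> /forallP bx i _; exact: bx.
by move=> bx; apply/forallP => i; exact: bx.
Qed.

Section boxes.
Context (R : realType) (n : nat).
Implicit Types (x y : 'rV[R]_n) (l u : 'I_n -> R).

Definition in_box l u y := [forall i, (l i < y ord0 i) && (y ord0 i < u i)].

Lemma integral_box l u : (forall i, l i <= u i) ->
  (\int[lebesgue_rV n]_y ((in_box l u y)%:R : R)%:E = (\prod_i (u i - l i))%:E)%E.
Proof.
move=> lu; transitivity (\int[lebesgue_rV n]_y ((in_box l u y)%:R * cst 1 y)%:E)%E.
  by apply: eq_integral => y _; rewrite mulr1.
rewrite -integral_natb (eq_integral (cst 1%E))// integral_cst; last first.
  have mb : measurable_fun setT (in_box l u).
    by apply: measurable_forall => i.
  by rewrite -[X in measurable X]setTI; exact: mb.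
rewrite mul1e; transitivity (lebesgue_rV n
    [set y : 'rV[R]_n | forall i, [set` `]l i, u i[%R] (y ord0 i)]).
  congr (lebesgue_rV n _); apply/seteqP; split=> y /=.
    by move=> /forallP yb i; have := yb i; rewrite in_itv.
  by move=> yb; apply/forallP => i; have := yb i; rewrite in_itv.
rewrite (lebesgue_rV_box (A := fun i => [set` `]l i, u i[%R]))// -prodEFin;
  apply: eq_bigr => i _.
rewrite lebesgue_measure_itv/= lte_fin; case: (ltP (l i) (u i)) => // ul.
by have -> : u i = l i by [apply/eqP; rewrite eq_le ul lu]; rewrite subrr.
Qed.

Lemma enorm_le x (c : R) : (forall i, `|x ord0 i| <= c) -> enorm x <= n%:R * c.
Proof.
move=> xc; have nc0 : 0 <= n%:R * c.
  case: n x xc => [|k] x xc; first by rewrite mul0r.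
  by rewrite mulr_ge0// (le_trans _ (xc ord0)).
rewrite -(ger0_norm nc0) -sqrtr_sqr ler_wsqrtr// exprMn.
apply: (@le_trans _ _ (\sum_(i < n) c ^+ 2)).
  apply: ler_sum => i _; rewrite -real_normK ?num_real//.
  by rewrite lerXn2r ?nnegrE// (le_trans _ (xc i)).
rewrite sumr_const card_ord -[leLHS]mulr_natl ler_wpM2r ?sqr_ge0//.
by rewrite -natrX ler_nat; case: (n) => // k; rewrite leq_pmulr.
Qed.

Lemma coord_le_enorm x i : `|x ord0 i| <= enorm x.
Proof.
rewrite /enorm -sqrtr_sqr ler_wsqrtr// (bigD1 i)//= lerDl sumr_ge0// => j _.
exact: sqr_ge0.
Qed.

Lemma enormB x y : enorm (x - y) = enorm (y - x).
Proof.
rewrite /enorm; congr Num.sqrt; apply: eq_bigr => i _.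
by rewrite !mxE -sqrrN opprB.
Qed.

End boxes.

Local Notation ht x := (x ord0 ord_max).

(** * The weighted Sobolev inequality *)

Lemma powRM4 (R : realType) (a b c d w : R) :
  0 <= a -> 0 <= b -> 0 <= c -> 0 <= d ->
  (a * b * c * d) `^ w = a `^ w * b `^ w * c `^ w * d `^ w.
Proof. by move=> a0 b0 c0 d0; rewrite !powRM ?mulr_ge0. Qed.

Section weighted_sobolev.
Context (R : realType) (m : nat) (p q s lam : R).
Context (p1 : 1 <= p) (pq : p < q) (s0 : 0 < s) (lam1 : 1 <= lam).
Local Notation V := 'rV[R]_m.+1.
Local Notation mu := (@lebesgue_rV R m.+1).
Local Notation n := (m.+1%:R : R).
Implicit Types (x y : V) (f : V -> R) (a b : R).

Definition kern x y : R := enorm (x - y) `^ (- (n + s * p)).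

(** The boxes over which [v] is averaged at [x] contain only such [y]. The bound on the ratio of
    heights is what lets the convexity remainder dominate the weight [t^(s p - 1)] of the lower
    point alone ([ground_state_real]). *)
Definition near_above x y : bool :=
  [&& 0 < ht x, ht x < ht y & ht y <= 2 * lam * ht x].

Definition local_density f (z : V * V) : R :=
  (near_above z.1 z.2)%:R *
  (ht z.1 `^ (s * p - 1) * (`|f z.1 - f z.2| `^ p * kern z.1 z.2)).

Definition local_energy f : \bar R :=
  (\int[mu]_x \int[mu]_y (local_density f (x, y))%:E)%E.

Lemma kern_ge0 x y : 0 <= kern x y. Proof. exact: powR_ge0. Qed.

Lemma local_density_ge0 f z : 0 <= local_density f z.
Proof. by rewrite /local_density !mulr_ge0 ?powR_ge0. Qed.

Lemma measurable_local_density f : measurable_fun setT f ->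
  measurable_fun setT (local_density f).
Proof. by move=> mf; rewrite /local_density /near_above /kern. Qed.

(** Either [|a| <= 2 |b|], or [|a| <= 2 |a - b|]; in the second case only [p] of the [q] powers of
    [|a|] are exchanged for the difference, to match the exponent of the energy. *)
Lemma powR_split_average a b :
  `|a| `^ q <= 2 `^ q * `|b| `^ q + 2 `^ p * (`|a| `^ (q - p) * `|a - b| `^ p).
Proof.
have p0 : 0 <= p by rewrite (le_trans _ p1).
have q0 : 0 <= q by rewrite (le_trans p0)// ltW.
have [ab|ba] := leP `|a| (2 * `|b|).
  rewrite -powRM// (@le_trans _ _ ((2 * `|b|) `^ q))//; first exact: ler_powRl.
  by rewrite lerDl !mulr_ge0 ?powR_ge0.
have a0 : 0 < `|a| by rewrite (le_lt_trans _ ba)// mulr_ge0.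
rewrite (@le_trans _ _ (2 `^ p * (`|a| `^ (q - p) * `|a - b| `^ p)))//; last first.
  by rewrite lerDr mulr_ge0 ?powR_ge0.
have -> : `|a| `^ q = `|a| `^ (q - p) * `|a| `^ p.
  by rewrite -powRD ?(gt_eqF a0) ?implybT// subrK.
rewrite [leRHS]mulrCA ler_wpM2l ?powR_ge0//.
rewrite -powRM//; apply: ler_powRl => //.
have := ler_normD (a - b) b; rewrite subrK; lra.
Qed.

Lemma box_average f (B : V -> bool) (v a : R) : measurable_fun setT f ->
  measurable_fun setT B -> (\int[mu]_y ((B y)%:R : R)%:E = v%:E)%E ->
  ((v * `|a| `^ q)%:E <= (2 `^ q)%:E * \int[mu]_y ((B y)%:R * `|f y| `^ q)%:E
   + (2 `^ p * `|a| `^ (q - p))%:E * \int[mu]_y ((B y)%:R * `|a - f y| `^ p)%:E)%E.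
Proof.
move=> mf mB vB; rewrite mulrC EFinM -vB -!integral_rZl ?mulr_ge0 ?powR_ge0//;
  try by move=> y; rewrite mulr_ge0 ?powR_ge0.
rewrite -integral_rD//; try by move=> y; rewrite !mulr_ge0 ?powR_ge0.
apply: le_integral_r => // y.
case: (B y); last by rewrite !mul0r !mulr0 addr0.
by rewrite !mul1r mulr1 -mulrA powR_split_average.
Qed.

(** Within distance [c] the kernel is at least [c^-(n + s p)], so it can be inserted at the price of
    the inverse power; the weight of the lower point is inserted in the same way. *)
Lemma local_bound f x (B : V -> bool) c : measurable_fun setT f ->
  measurable_fun setT B -> 0 < c ->
  (forall y, B y -> near_above x y /\ enorm (x - y) <= c) ->
  (\int[mu]_y ((B y)%:R * `|f x - f y| `^ p)%:E <=
   (c `^ (n + s * p) * ht x `^ (1 - s * p))%:E *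
   \int[mu]_y (local_density f (x, y))%:E)%E.
Proof.
move=> mf mB c0 Bx; have mF := measurable_local_density mf.
have mFx : measurable_fun setT (fun y => local_density f (x, y)).
  by apply: (measurable_compr mF).
have F0 y : 0 <= local_density f (x, y) by exact: local_density_ge0.
have c0' : 0 <= c `^ (n + s * p) * ht x `^ (1 - s * p) by rewrite mulr_ge0 ?powR_ge0.
rewrite -(integral_rZl _ c0' mFx F0).
apply: le_integral_r => // y.
have [/Bx[xy ec]|_] := boolP (B y); last first.
  by rewrite mul0r !mulr_ge0 ?powR_ge0 ?local_density_ge0.
rewrite /local_density/= xy !mul1r.
move: xy => /and3P[x0 xy _].
have e0 : 0 < enorm (x - y).
  rewrite (lt_le_trans _ (coord_le_enorm _ ord_max))// normr_gt0 !mxE.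
  by rewrite lt_eqF// subr_lt0.
have K : c `^ (- (n + s * p)) <= kern x y.
  apply: ger_powRl => //; rewrite oppr_le0 addr_ge0// mulr_ge0 ?(ltW s0)//.
  by rewrite (le_trans _ p1).
set u := `|_| `^ p.
have -> : c `^ (n + s * p) * ht x `^ (1 - s * p) *
    (ht x `^ (s * p - 1) * (u * kern x y)) =
  u * (c `^ (n + s * p) * kern x y) * (ht x `^ (1 - s * p) * ht x `^ (s * p - 1)).
  by ring.
rewrite -powRD ?(gt_eqF x0) ?implybT//.
have -> : 1 - s * p + (s * p - 1) = 0 by ring.
rewrite powRr0 mulr1 ler_peMr ?powR_ge0//.
rewrite (@le_trans _ _ (c `^ (n + s * p) * c `^ (- (n + s * p))))//.
  by rewrite powRN divff// gt_eqF// powR_gt0.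
by rewrite ler_wpM2l ?powR_ge0.
Qed.

Local Notation gam := (m%:R * q / p - n).
Local Notation th := (1 - p / q).

Let p0 : 0 < p. Proof. by rewrite (lt_le_trans _ p1). Qed.
Let q0 : 0 < q. Proof. exact: lt_trans pq. Qed.
Let lam0 : 0 < lam. Proof. by rewrite (lt_le_trans _ lam1). Qed.

(* The average over [upper_box x] is used where [f] is small, that over a small
   cube where it is large. *)
Definition upper_box x : V -> bool :=
  in_box (fun i => if i == ord_max then lam * ht x else x ord0 i)
         (fun i => if i == ord_max then 2 * lam * ht x else x ord0 i + ht x).

Definition cube x (r : R) : V -> bool :=
  in_box (fun i => x ord0 i) (fun i => x ord0 i + r).

Lemma powR_th a : `|a| `^ (q - p) = (`|a| `^ q) `^ th.
Proof. by rewrite -powRrM; congr (_ `^ _); field; rewrite gt_eqF. Qed.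

Lemma measurable_upper_box x : measurable_fun setT (upper_box x).
Proof. by rewrite /upper_box /in_box; apply: measurable_forall => i. Qed.

Lemma measurable_cube x r : measurable_fun setT (cube x r).
Proof. by rewrite /cube /in_box; apply: measurable_forall => i. Qed.

Lemma integral_cube x r : 0 <= r ->
  (\int[mu]_y ((cube x r y)%:R : R)%:E = (r `^ n)%:E)%E.
Proof.
move=> r0; rewrite integral_box => [|i]; last by rewrite lerDl.
congr EFin; rewrite (eq_bigr (fun=> r)) => [|i _]; last by rewrite addrC addKr.
by rewrite prodr_const card_ord powR_mulrn.
Qed.

Lemma integral_upper_box x : 0 < ht x ->
  (\int[mu]_y ((upper_box x y)%:R : R)%:E = (lam * ht x `^ n)%:E)%E.
Proof.
move=> x0; have lx0 : 0 < lam * ht x by rewrite mulr_gt0.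
rewrite integral_box => [|i]; last first.
  by case: eqP => _; [rewrite -mulrA ler_peMl ?ler1n// ltW|rewrite lerDl ltW].
congr EFin; rewrite big_ord_recr /= eqxx.
rewrite (eq_bigr (fun=> ht x)) => [|i _]; last first.
  by rewrite -val_eqE/= ltn_eqF ?ltn_ord// addrC addKr.
rewrite prodr_const card_ord powR_mulrn ?(ltW x0)// exprS; ring.
Qed.

Lemma cube_near_above x r y : 0 < ht x -> 0 < r -> r <= ht x -> cube x r y ->
  near_above x y /\ enorm (x - y) <= n * r.
Proof.
move=> x0 r0 rx /forallP xy; split.
  have /andP[h1 h2] := xy ord_max; rewrite /near_above x0 h1/=.
  rewrite (@le_trans _ _ (2 * ht x))//; first by lra.
  by rewrite -mulrA ler_wpM2l// ler_peMl// ltW.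
apply: enorm_le => i; have /andP[h1 h2] := xy i; rewrite !mxE ler_norml; lra.
Qed.

Lemma upper_box_near_above x y : 0 < ht x -> upper_box x y ->
  near_above x y /\ enorm (x - y) <= n * (2 * lam * ht x).
Proof.
move=> x0 /forallP xy; have lx : ht x <= lam * ht x by rewrite ler_peMl// ltW.
split.
  have := xy ord_max; rewrite eqxx => /andP[h1 h2]; rewrite /near_above x0/=.
  by rewrite (le_lt_trans lx h1)/= ltW.
apply: enorm_le => i; have := xy i; rewrite !mxE; case: eqP => [->|_] /andP[h1 h2];
  by rewrite ler_norml; lra.
Qed.

(** The threshold between small and large values: [2^q] comes from [powR_split_average], [2^|gam|]
    from comparing the weight at heights between [t] and [2 t], and the further 2 leaves half of
    [|f x|^q] once the average is subtracted. *)
Definition cgam : R := 2 `^ (q + 1) * 2 `^ `|gam|.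
Definition clow : R := 2 `^ p / lam * (2 * lam * n) `^ (n + s * p) * cgam `^ th.
Definition chigh : R := 2 `^ (p + 1) * n `^ (n + s * p) * cgam `^ th.

(** Dilation invariance as an identity of exponents: it cancels all powers of the height in the two
    bounds that follow. *)
Let exponent0 : 1 + gam * (p / q) - n + n * (p / q) = 0.
Proof. by rewrite -natr1; field; rewrite !gt_eqF. Qed.

(** Smallness of [f x] bounds [|f x|^(q-p) = (|f x|^q)^th] by [I^th] times a power of the height.
    The average over the upper box is kept as it stands, to be integrated in [x] and absorbed. *)
Lemma low_bound f x (I : R) : measurable_fun setT f -> 0 < ht x -> 0 < I ->
  `|f x| `^ q * ht x `^ (gam + n) <= cgam * I ->
  ((`|f x| `^ q * ht x `^ gam)%:E <=
   (2 `^ q / lam * ht x `^ (gam - n))%:E *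
     \int[mu]_y ((upper_box x y)%:R * `|f y| `^ q)%:E
   + (clow * I `^ th)%:E * \int[mu]_y (local_density f (x, y))%:E)%E.
Proof.
move=> mf x0 I0 fx.
have mB := measurable_upper_box x.
have := box_average (f x) mf mB (integral_upper_box x0).
have c0 : 0 < n * (2 * lam * ht x) by rewrite !mulr_gt0.
have lb := local_bound mf mB c0 (fun y => @upper_box_near_above x y x0).
set G := (\int[mu]_y (local_density f (x, y))%:E)%E in lb *.
set J := (\int[mu]_y ((upper_box x y)%:R * `|f y| `^ q)%:E)%E.
set L := (\int[mu]_y ((upper_box x y)%:R * `|f x - f y| `^ p)%:E)%E in lb *.
move=> av.
have J0 : (0 <= J)%E by apply: integral_ge0 => y _; rewrite lee_fin.
have L0 : (0 <= L)%E by apply: integral_ge0 => y _; rewrite lee_fin.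
have G0 : (0 <= G)%E by apply: integral_ge0 => y _; rewrite lee_fin local_density_ge0.
move: (J) (L) (G) J0 L0 G0 av lb => {J L G} J L G J0 L0 G0 av lb.
pose k := lam^-1 * ht x `^ (gam - n).
have k0 : 0 <= k by rewrite mulr_ge0 ?invr_ge0 ?(ltW lam0) ?powR_ge0.
have -> : (`|f x| `^ q * ht x `^ gam = k * (lam * ht x `^ n * `|f x| `^ q)).
  have -> : ht x `^ gam = ht x `^ (gam - n) * ht x `^ n.
    by rewrite -powRD ?(gt_eqF x0) ?implybT// subrK.
  by rewrite /k; field; rewrite gt_eqF.
rewrite EFinM.
apply: le_trans (lee_wpmul2l _ av) _; first by rewrite lee_fin.
rewrite ge0_muleDr ?mule_ge0 ?lee_fin ?mulr_ge0 ?powR_ge0//.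
rewrite !muleA -!EFinM; apply: leeD.
  by rewrite /k le_eqVlt; apply/orP; left; apply/eqP; congr (_%:E * _)%E; ring.
apply: le_trans (lee_wpmul2l _ lb) _.
  by rewrite lee_fin; apply: mulr_ge0 => //; apply: mulr_ge0; exact: powR_ge0.
rewrite muleA -EFinM; apply: lee_wpmul2r => //; rewrite lee_fin.
rewrite powR_th.
have th0 : 0 <= th by rewrite subr_ge0 ler_pdivrMr ?mul1r ?ltW.
have cg0 : 0 <= cgam by rewrite mulr_ge0 ?powR_ge0.
have h : (`|f x| `^ q) `^ th <= cgam `^ th * (I `^ th * ht x `^ (- (gam + n) * th)).
  rewrite powRrM -powRM ?powR_ge0 ?(ltW I0)// -powRM ?mulr_ge0 ?powR_ge0 ?(ltW I0)//.
  apply: ler_powRl => //; rewrite ?powR_ge0//.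
  by rewrite mulrA powRN ler_pdivlMr ?powR_gt0.
have c1 : (n * (2 * lam * ht x)) `^ (n + s * p) =
    (2 * lam * n) `^ (n + s * p) * ht x `^ (n + s * p).
  rewrite -powRM ?(ltW x0) ?mulr_ge0 ?(ltW lam0)//; congr (_ `^ _); ring.
have c2 : ht x `^ (gam - n) * ht x `^ (n + s * p) * ht x `^ (1 - s * p) *
    ht x `^ (- (gam + n) * th) = 1.
  rewrite -!powRD ?(gt_eqF x0) ?implybT//.
  suff -> : gam - n + (n + s * p) + (1 - s * p) + - (gam + n) * th = 0 by rewrite powRr0.
  by rewrite -exponent0; ring.
rewrite c1.
set P := 2 `^ p; set Q := (2 * lam * n) `^ (n + s * p).
rewrite /k; set X1 := ht x `^ (gam - n) in c2 *; set X2 := ht x `^ (n + s * p) in c2 *.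
set X3 := ht x `^ (1 - s * p) in c2 *; set X4 := ht x `^ (- _ * th) in c2 h *.
apply: (@le_trans _ _ (lam^-1 * X1 * (P * (cgam `^ th * (I `^ th * X4))) * (Q * X2 * X3))).
  rewrite ler_wpM2r ?mulr_ge0 ?powR_ge0//
    ler_wpM2l ?mulr_ge0 ?invr_ge0 ?powR_ge0 ?(ltW lam0)//.
  by rewrite ler_wpM2l ?powR_ge0.
have -> : lam^-1 * X1 * (P * (cgam `^ th * (I `^ th * X4))) * (Q * X2 * X3) =
  P / lam * Q * cgam `^ th * I `^ th * (X1 * X2 * X3 * X4) by ring.
by rewrite c2 mulr1 /clow.
Qed.

(** The larger [f x], the smaller a cube suffices for its own value to dominate the average. That
    average is subtracted at once, so the difference term alone remains and nothing has to be
    absorbed. *)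
Lemma high_bound f x (I : R) : measurable_fun setT f -> 0 < ht x -> 0 < I ->
  (\int[mu]_y ((0 < ht y)%R%:R * (`|f y| `^ q * ht y `^ gam))%:E <= I%:E)%E ->
  n * th <= s * p ->
  cgam * I < `|f x| `^ q * ht x `^ (gam + n) ->
  ((`|f x| `^ q * ht x `^ gam)%:E <=
   (chigh * I `^ th)%:E * \int[mu]_y (local_density f (x, y))%:E)%E.
Proof.
move=> mf x0 I0 HI nsp fx.
have th0 : 0 <= th by rewrite subr_ge0 ler_pdivrMr ?mul1r ?ltW.
have cg0 : 0 < cgam by rewrite mulr_gt0 ?powR_gt0.
set A := `|f x| `^ q in fx *.
have A0 : 0 < A.
  rewrite -(pmulr_lgt0 _ (powR_gt0 (gam + n) x0)).
  by rewrite (lt_trans _ fx)// mulr_gt0.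
(* The volume of the cube, making [2^q] times the average of [|f|^q] at
   most [|f x|^q / 2]. *)
pose rho := cgam * I * ht x `^ (- gam) / A.
have rho0 : 0 < rho by rewrite /rho divr_gt0// mulr_gt0 ?powR_gt0// mulr_gt0.
pose r := rho `^ n^-1.
have r0 : 0 < r by exact: powR_gt0.
have rn : r `^ n = rho by rewrite /r -powRrM mulVf ?pnatr_eq0// powRr1// ltW.
(* This is exactly the assumption that [f x] exceeds the threshold. *)
have rx : r <= ht x.
  have -> : ht x = (ht x `^ n) `^ n^-1.
    by rewrite -powRrM divff ?pnatr_eq0// powRr1// ltW.
  apply: ler_powRl; rewrite ?(ltW rho0)// /rho ler_pdivrMr// powRN.
  rewrite ler_pdivrMr ?powR_gt0// [leRHS]mulrAC -powRD ?(gt_eqF x0) ?implybT//.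
  by rewrite [n + gam]addrC [leRHS]mulrC ltW.
have mB := measurable_cube x r.
have := box_average (f x) mf mB (integral_cube x (ltW r0)).
have c0 : 0 < n * r by rewrite mulr_gt0.
have lb := local_bound mf mB c0 (fun y => @cube_near_above x r y x0 r0 rx).
have fb : (\int[mu]_y ((cube x r y)%:R * `|f y| `^ q)%:E <=
    (2 `^ `|gam| * ht x `^ (- gam) * I)%:E)%E.
  rewrite [leRHS]EFinM; apply: le_trans (lee_wpmul2l _ HI); last first.
    by rewrite lee_fin mulr_ge0 ?powR_ge0.
  rewrite -integral_rZl ?mulr_ge0 ?powR_ge0//; last first.
    by move=> y; rewrite !mulr_ge0 ?powR_ge0.
  apply: le_integral_r => // y.
  have [/forallP xy|_] := boolP (cube x r y); last first.
    by rewrite mul0r !mulr_ge0 ?powR_ge0.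
  have /andP[h1 h2] := xy ord_max.
  rewrite (lt_trans x0 h1) !mul1r.
  have [|_ h] := @powR_ratio_le R (ht x) (ht y) 2 gam x0 (ltW h1); first by lra.
  have -> : 2 `^ `|gam| * ht x `^ (- gam) * (`|f y| `^ q * ht y `^ gam) =
    `|f y| `^ q * (ht x `^ (- gam) * (2 `^ `|gam| * ht y `^ gam)) by ring.
  by rewrite ler_peMr ?powR_ge0// powRN -ler_pdivrMl ?invr_gt0 ?powR_gt0// invrK mulr1.
set G := (\int[mu]_y (local_density f (x, y))%:E)%E in lb *.
set J := (\int[mu]_y ((cube x r y)%:R * `|f y| `^ q)%:E)%E in fb *.
set L := (\int[mu]_y ((cube x r y)%:R * `|f x - f y| `^ p)%:E)%E in lb *.
have L0 : (0 <= L)%E by apply: integral_ge0 => y _; rewrite lee_fin.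
have G0 : (0 <= G)%E by apply: integral_ge0 => y _; rewrite lee_fin local_density_ge0.
move: (J) (L) (G) L0 G0 lb fb => {J L G} J L G L0 G0 lb fb av.
rewrite rn in av.
have rA : rho * A = cgam * I * ht x `^ (- gam) by rewrite /rho divfK// gt_eqF.
have rAhalf : 2 `^ q * (2 `^ `|gam| * ht x `^ (- gam) * I) = rho * A / 2.
  by rewrite rA /cgam powRD ?pnatr_eq0 ?implybT// powRr1//; field.
have {av} av : ((rho * A / 2)%:E <= (2 `^ p * `|f x| `^ (q - p))%:E * L)%E.
  have : ((rho * A)%:E <= (rho * A / 2)%:E + (2 `^ p * `|f x| `^ (q - p))%:E * L)%E.
    apply: le_trans av _; apply: leeD => //.
    by rewrite -rAhalf EFinM lee_wpmul2l// lee_fin powR_ge0.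
  rewrite -leeBlDl// -EFinB; have -> // : rho * A - rho * A / 2 = rho * A / 2; by field.
pose k := 2 / rho * ht x `^ gam.
have k0 : 0 <= k by rewrite !mulr_ge0 ?invr_ge0 ?powR_ge0// ltW.
have -> : A * ht x `^ gam = k * (rho * A / 2).
  by rewrite /k; field; rewrite gt_eqF.
rewrite EFinM; apply: le_trans (lee_wpmul2l _ av) _; first by rewrite lee_fin.
rewrite muleA -EFinM.
apply: le_trans (lee_wpmul2l _ lb) _.
  by rewrite lee_fin; apply: mulr_ge0 => //; apply: mulr_ge0; exact: powR_ge0.
rewrite muleA -EFinM; apply: lee_wpmul2r => //; rewrite lee_fin powR_th -/A.
have -> : A = cgam * I * ht x `^ (- gam) * r `^ (- n).
  by rewrite [r `^ _]powRN rn -rA mulrAC divff ?mul1r// gt_eqF.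
have -> : (cgam * I * ht x `^ (- gam) * r `^ (- n)) `^ th =
    cgam `^ th * I `^ th * ht x `^ (- gam * th) * r `^ (- n * th).
  have h1 := powRM4 th (ltW cg0) (ltW I0) (powR_ge0 (ht x) (- gam)) (powR_ge0 r (- n)).
  have h2 := powRrM (ht x) (- gam) th.
  have h3 := powRrM r (- n) th.
  rewrite h1 h2 h3; reflexivity.
have -> : (n * r) `^ (n + s * p) = n `^ (n + s * p) * r `^ (n + s * p).
  by rewrite powRM// ltW.
have -> : k = r `^ (- n) * 2 * ht x `^ gam.
  by rewrite /k -rn [r `^ (- n)]powRN [_^-1 * 2]mulrC.
have -> : chigh = 2 * 2 `^ p * n `^ (n + s * p) * cgam `^ th.
  by rewrite /chigh powRD ?pnatr_eq0 ?implybT// powRr1// [_ * 2]mulrC.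
(* The upper bound on [q] enters here: [n th <= s p] makes the exponent of [r] nonnegative, so
   [r <= ht x] can be used. *)
have c2 : r `^ (- n) * r `^ (- n * th) * r `^ (n + s * p) <= ht x `^ (s * p - n * th).
  rewrite -!powRD ?(gt_eqF r0) ?implybT//.
  have -> : - n + - n * th + (n + s * p) = s * p - n * th by ring.
  by apply: ler_powRl => //; rewrite ?subr_ge0 ?(ltW r0).
have c3 : ht x `^ gam * ht x `^ (- gam * th) * ht x `^ (1 - s * p) *
    ht x `^ (s * p - n * th) = 1.
  rewrite -!powRD ?(gt_eqF x0) ?implybT//.
  suff -> : gam + - gam * th + (1 - s * p) + (s * p - n * th) = 0 by rewrite powRr0.
  by rewrite -exponent0; ring.
set P := 2 `^ p; set Q := n `^ (n + s * p); set Y := cgam `^ th.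
set Z := I `^ th; set X1 := ht x `^ gam in c3 *.
set X2 := ht x `^ (- gam * th) in c3 *.
set X3 := ht x `^ (1 - s * p) in c3 *; set X4 := ht x `^ (s * p - n * th) in c3 c2 *.
set R1 := r `^ (- n) in c2 *; set R2 := r `^ (- n * th) in c2 *.
set R3 := r `^ (n + s * p) in c2 *.
have nneg : [/\ 0 <= P, 0 <= Q, 0 <= Y & 0 <= Z] /\ [/\ 0 <= X1, 0 <= X2 & 0 <= X3].
  by split; split; exact: powR_ge0.
clearbody P Q Y Z X1 X2 X3 X4 R1 R2 R3; case: nneg => -[P0 Q0 Y0 Z0] [X10 X20 X30].
rewrite [leLHS](_ : _ = 2 * P * Q * Y * Z * (X1 * X2 * X3 * (R1 * R2 * R3)));
  last by ring.
apply: (@le_trans _ _ (2 * P * Q * Y * Z * (X1 * X2 * X3 * X4))).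
  by rewrite ler_wpM2l ?mulr_ge0// ler_wpM2l ?mulr_ge0.
by rewrite c3 mulr1.
Qed.

End weighted_sobolev.

Section weighted_sobolev_integrated.
Context (R : realType) (m : nat) (p q s : R).
Context (m0 : (0 < m)%N) (p1 : 1 <= p) (pq : p < q) (s0 : 0 < s).
Context (nsp : m.+1%:R * (1 - p / q) <= s * p).
Local Notation V := 'rV[R]_m.+1.
Local Notation mu := (@lebesgue_rV R m.+1).
Local Notation n := (m.+1%:R : R).
Local Notation gam := (m%:R * q / p - n).
Local Notation th := (1 - p / q).
Implicit Types (x y : V) (f : V -> R).

Let p0 : 0 < p. Proof. by rewrite (lt_le_trans _ p1). Qed.
Let q0 : 0 < q. Proof. exact: lt_trans pq. Qed.

Let gam1 : 0 < 1 + gam.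
Proof.
have -> : 1 + gam = m%:R * (q - p) / p.
  by rewrite -natr1; field; rewrite gt_eqF.
by rewrite divr_gt0 ?mulr_gt0 ?subr_gt0 ?ltr0n.
Qed.

(* Chosen so that integrating the averages over the boxes [upper_box lam x] in
   [x] gives at most half of the weighted norm ([integral_H_le]). *)
Definition box_ratio : R := (2 `^ (q + 1 + `|gam - n|)) `^ (1 + gam)^-1.
Local Notation lam := box_ratio.

Lemma box_ratio_ge1 : 1 <= lam.
Proof.
rewrite /box_ratio; apply: powR_ge1; last by rewrite invr_ge0 ltW.
apply: powR_ge1; first by rewrite ler1n.
by rewrite !addr_ge0// ltW.
Qed.

Let lam0 : 0 < lam. Proof. exact: lt_le_trans box_ratio_ge1. Qed.

Let lamE : lam `^ (1 + gam) = 2 `^ (q + 1 + `|gam - n|).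
Proof. by rewrite -powRrM mulVf ?gt_eqF// powRr1// powR_ge0. Qed.

(** The average term of [low_bound] as a function of the pair, ready for an exchange of
    integrals. *)
Let H f (z : V * V) : R := (0 < ht z.1)%R%:R *
  (2 `^ q / lam * ht z.1 `^ (gam - n) * ((upper_box lam z.1 z.2)%:R * `|f z.2| `^ q)).

Let measurable_H f : measurable_fun setT f -> measurable_fun setT (H f).
Proof.
move=> mf; have mB : measurable_fun setT (fun z : V * V => upper_box lam z.1 z.2).
  rewrite /upper_box /in_box; apply: measurable_forall => i.
  by case: (i == ord_max).
by rewrite /H.
Qed.

Let H_ge0 f z : 0 <= H f z.
Proof. by rewrite /H !mulr_ge0 ?powR_ge0 ?invr_ge0 ?(ltW lam0). Qed.

Let integral_H_le f y : measurable_fun setT f ->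
  (\int[mu]_x (H f (x, y))%:E <=
   (2^-1 * ((0 < ht y)%R%:R * (`|f y| `^ q * ht y `^ gam)))%:E)%E.
Proof.
move=> mf; set h := ht y; have [h0|h0] := ltP 0 h; last first.
  rewrite mul0r mulr0 integral0_eq// => x _.
  rewrite /H/=; have [x0|_] := ltP 0 (ht x); last by rewrite mul0r.
  have [/forallP/(_ ord_max)|_] := boolP (upper_box _ x y); last by rewrite mul0r !mulr0.
  rewrite eqxx => /andP[]; rewrite -/h ltNge (le_trans h0)//.
  by rewrite mulr_ge0 ?(ltW x0) ?(ltW lam0).
(* For fixed [y] at height [h], the points [x] whose upper box contains [y] have heights between
   [h / (2 lam)] and [h / lam] and lie within [h / lam] of [y] in each other coordinate. *)
pose l i : R := if i == ord_max then h / (2 * lam) else y ord0 i - h / lam.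
pose u i : R := if i == ord_max then h / lam else y ord0 i.
have hl0 : 0 < h / lam by rewrite divr_gt0.
have hl2 : h / (2 * lam) = h / lam / 2 by field; rewrite gt_eqF.
have lu i : l i <= u i.
  by rewrite /l /u; case: eqP => _; rewrite ?hl2; lra.
have vol : \prod_i (u i - l i) = (h / lam) `^ n / 2.
  rewrite big_ord_recr /= {2}/u {2}/l eqxx.
  rewrite (eq_bigr (fun=> h / lam)) => [|i _]; last first.
    by rewrite /u /l -val_eqE/= ltn_eqF ?ltn_ord// subKr.
  rewrite prodr_const card_ord powR_mulrn ?(ltW hl0)// exprS hl2; field.
  by rewrite gt_eqF.
pose K := 2 `^ q / lam * (2 `^ `|gam - n| * (h / lam) `^ (gam - n)) * `|f y| `^ q.
have K0 : 0 <= K by rewrite /K !mulr_ge0 ?powR_ge0 ?invr_ge0 ?(ltW lam0).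
have mlu : measurable_fun setT (in_box l u).
  by rewrite /in_box; apply: measurable_forall => i.
apply: (@le_trans _ _ (\int[mu]_x (K * (in_box l u x)%:R)%:E)%E).
  apply: le_integral_r => [x|||x].
  - exact: H_ge0.
  - by have mHf := measurable_H mf; apply: (measurable_compr mHf).
  - by [].
  rewrite /H/=; have [x0|_] := ltP 0 (ht x); last by rewrite mul0r mulr_ge0.
  have [/forallP xy|_] := boolP (upper_box _ x y); last by rewrite mul0r !mulr0 mulr_ge0.
  have := xy ord_max; rewrite eqxx -/h => /andP[h1 h2].
  have th1 : ht x < h / lam by rewrite ltr_pdivlMr// mulrC.
  have th2 : h / lam < 2 * ht x by rewrite ltr_pdivrMr// mulrAC.
  have -> : in_box l u x.
    apply/forallP => i; rewrite /l /u; have := xy i.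
    case: eqP => [->|_] /andP[h3 h4]; first by rewrite hl2; lra.
    by lra.
  rewrite !mul1r mulr1 /K ler_wpM2r ?powR_ge0// ler_wpM2l ?mulr_ge0 ?powR_ge0//.
    by rewrite invr_ge0 ltW.
  by have [] := powR_ratio_le (gam - n) x0 (ltW th1) (ltW th2).
rewrite integral_rZl// integral_box// vol -EFinM lee_fin mul1r.
have -> : K * ((h / lam) `^ n / 2) =
    2 `^ q / lam * 2 `^ `|gam - n| * ((h / lam) `^ (gam - n) * (h / lam) `^ n)
    * `|f y| `^ q / 2 by rewrite /K; ring.
rewrite -powRD ?(gt_eqF hl0) ?implybT// subrK.
have hg := powRM gam (ltW hl0) (ltW lam0).
rewrite divfK ?gt_eqF// in hg.
have lg : lam * lam `^ gam = 2 `^ q * 2 * 2 `^ `|gam - n|.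
  rewrite -[X in X * _](powRr1 (ltW lam0)) -powRD ?(gt_eqF lam0) ?implybT// lamE.
  rewrite powRD ?pnatr_eq0 ?implybT// powRD ?pnatr_eq0 ?implybT//.
  by rewrite powRr1.
have {}lg : lam `^ gam = 2 `^ q * 2 * 2 `^ `|gam - n| / lam.
  apply: (mulfI (lt0r_neq0 lam0)); rewrite lg [RHS]mulrC divfK//.
  exact: lt0r_neq0.
rewrite hg lg.
have X0 : 0 <= (h / lam) `^ gam by exact: powR_ge0.
have P0 : 0 <= 2 `^ q :> R by exact: powR_ge0.
have Q0 : 0 <= 2 `^ `|gam - n| :> R by exact: powR_ge0.
have F0 : 0 <= `|f y| `^ q by exact: powR_ge0.
have L0 : 0 <= lam^-1 by rewrite invr_ge0 ltW.
set X := (h / lam) `^ gam in X0 *; set P := 2 `^ q in P0 *.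
set Q := 2 `^ _ in Q0 *; set F := `|f y| `^ q in F0 *; set L := lam^-1 in L0 *.
clearbody X P Q F L.
rewrite [leRHS](_ : _ = P * L * Q * X * F); last by rewrite /=; field.
by rewrite ler_piMr ?mulr_ge0// invf_le1 ?ler1n.
Qed.

Let cgam_gt0 : 0 < cgam m p q.
Proof. by rewrite mulr_gt0 ?powR_gt0. Qed.

Let clow_gt0 : 0 < clow m p q s lam.
Proof.
rewrite /clow !mulr_gt0 ?powR_gt0 ?invr_gt0//.
by rewrite !mulr_gt0.
Qed.

Let chigh_gt0 : 0 < chigh m p q s.
Proof. by rewrite /chigh !mulr_gt0 ?powR_gt0. Qed.

Lemma weighted_sobolev : exists2 C : R, 0 < C &
  forall f, measurable_fun setT f ->
  let I := (\int[mu]_x ((0 < ht x)%R%:R * (`|f x| `^ q * ht x `^ gam))%:E)%E in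
  (I < +oo)%E -> (I `^ (p / q) <= C%:E * local_energy p s lam f)%E.
Proof.
pose C := clow m p q s lam + chigh m p q s.
have C0 : 0 < C by exact: addr_gt0.
exists (2 * C); first by rewrite mulr_gt0.
move=> f mf I Ioo.
have I0 : (0 <= I)%E by apply: integral_ge0 => x _; rewrite lee_fin !mulr_ge0 ?powR_ge0.
have If : I \is a fin_num by rewrite ge0_fin_numE.
have pq0 : 0 < p / q by rewrite divr_gt0.
have E0 : (0 <= local_energy p s lam f)%E.
  apply: integral_ge0 => x _; apply: integral_ge0 => y _.
  by rewrite lee_fin local_density_ge0.
(* The value 0 is set apart, because the final step divides by [J^th]. *)
have [Iz|Inz] := eqVneq I 0%E.
  by rewrite Iz poweR0r ?gt_eqF// mule_ge0// lee_fin ltW// mulr_gt0.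
pose J := fine I.
have IJ : I = J%:E by rewrite fineK.
have J0 : 0 < J by rewrite -lte_fin -IJ lt_neqAle eq_sym Inz.
have pw x : (((0 < ht x)%R%:R * (`|f x| `^ q * ht x `^ gam))%:E <=
    \int[mu]_y (H f (x, y))%:E +
    (C * J `^ th)%:E * \int[mu]_y (local_density p s lam f (x, y))%:E)%E.
  have HH : (0 <= \int[mu]_y (H f (x, y))%:E)%E.
    by apply: integral_ge0 => y _; rewrite lee_fin H_ge0.
  have GG : (0 <= \int[mu]_y (local_density p s lam f (x, y))%:E)%E.
    by apply: integral_ge0 => y _; rewrite lee_fin local_density_ge0.
  have [x0|_] := ltP 0 (ht x); last first.
    rewrite mul0r; apply: adde_ge0; [exact: HH|apply: mule_ge0; [|exact: GG]].
    by rewrite lee_fin; apply: mulr_ge0; [exact: ltW|exact: powR_ge0].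
  rewrite mul1r; have [fx|fx] := leP (`|f x| `^ q * ht x `^ (gam + n)) (cgam m p q * J).
    apply: le_trans (low_bound p1 pq s0 box_ratio_ge1 mf x0 J0 fx) _.
    apply: leeD; last first.
      apply: lee_wpmul2r; first exact: GG.
      rewrite lee_fin ler_wpM2r ?powR_ge0// /C lerDl; exact: ltW.
    have mB := measurable_upper_box lam x.
    rewrite -integral_rZl; last 3 first.
    - by rewrite !mulr_ge0 ?powR_ge0 ?invr_ge0 ?(ltW lam0).
    - by [].
    - by move=> y; rewrite mulr_ge0 ?powR_ge0.
    by rewrite le_eqVlt; apply/orP; left; apply/eqP; apply: eq_integral => y _;
      rewrite /H/= x0 mul1r.
  have IJ' : (I <= J%:E)%E by rewrite IJ.
  apply: le_trans (high_bound p1 pq s0 box_ratio_ge1 mf x0 J0 IJ' nsp fx) _.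
  rewrite -[leLHS]add0e; apply: leeD; first exact: HH.
  apply: lee_wpmul2r; first exact: GG.
  rewrite lee_fin ler_wpM2r ?powR_ge0// /C lerDr; exact: ltW.
have mF := measurable_local_density p s lam mf.
have mH := measurable_H mf.
have mFi := measurable_integral_r mu mF (local_density_ge0 p s lam f).
have mHi := measurable_integral_r mu mH (H_ge0 f).
have int_H : (\int[mu]_x \int[mu]_y (H f (x, y))%:E <= 2^-1%:E * I)%E.
  rewrite (tonelli_r _ _ mH (H_ge0 f)) /I -integral_rZl; last 3 first.
  - by rewrite invr_ge0.
  - by [].
  - by move=> y; rewrite !mulr_ge0 ?powR_ge0.
  have mHs : measurable_fun setT (fun z : V * V => H f (z.2, z.1)).
    by apply: (measurable_compr mH).
  have mHy := measurable_integral_r mu mHs (fun z => H_ge0 f (z.2, z.1)).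
  apply: le_integralT => [y|||y]; [|exact: mHy|by []|exact: integral_H_le].
  by apply: integral_ge0 => x _; rewrite lee_fin H_ge0.
have C1 : 0 <= C * J `^ th by apply: mulr_ge0; [exact: ltW|exact: powR_ge0].
set HI := (fun x => \int[mu]_y (H f (x, y))%:E)%E in mHi int_H.
set GI := (fun x => \int[mu]_y (local_density p s lam f (x, y))%:E)%E in mFi.
have {}pw x : (((0 < ht x)%R%:R * (`|f x| `^ q * ht x `^ gam))%:E <=
    HI x + (C * J `^ th)%:E * GI x)%E by exact: pw.
have HI0 x : (0 <= HI x)%E by apply: integral_ge0 => y _; rewrite lee_fin H_ge0.
have GI0 x : (0 <= GI x)%E.
  by apply: integral_ge0 => y _; rewrite lee_fin local_density_ge0.
have EG : (\int[mu]_x GI x)%E = local_energy p s lam f by [].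
clearbody HI GI; set c := C * J `^ th in C1 pw.
have mcG : measurable_fun setT (fun x => c%:E * GI x)%E by exact: measurable_funeM.
(* The half of [I] on the right is absorbed, which is legitimate as [I] is finite; since [c]
   contains [J^th], dividing by it turns [J] into [J^(p/q)]. *)
have key : (I <= 2^-1%:E * I + c%:E * local_energy p s lam f)%E.
  apply: (@le_trans _ _ (\int[mu]_x (HI x + c%:E * GI x))%E).
    apply: le_integralT => [x|||x]; last exact: pw.
    - by rewrite lee_fin !mulr_ge0 ?powR_ge0.
    - by [].
    - by apply: emeasurable_funD; [exact: mHi|exact: mcG].
  rewrite (ge0_integralD mu measurableT) //; last first.
    by move=> x _; apply: mule_ge0 => //.
  apply: leeD; first exact: int_H.
  by rewrite ge0_integralZl// EG.
move: E0 key; rewrite IJ; case: (local_energy p s lam f) => [e|_ _|]//; last first.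
  rewrite mulry gtr0_sg ?mul1e ?leey//; exact: mulr_gt0.
rewrite lee_fin -EFinM -[X in (_ + X)%E]EFinM -EFinD lee_fin => e0 key.
rewrite poweR_EFin -EFinM lee_fin.
have JJ : J = J `^ th * J `^ (p / q).
  by rewrite -powRD ?(gt_eqF J0) ?implybT// subrK powRr1// ltW.
have Jth : 0 < J `^ th by exact: powR_gt0.
rewrite -(ler_pM2l Jth) -JJ.
have -> : J `^ th * (2 * C * e) = 2 * (c * e) by rewrite /c; ring.
lra.
Qed.

End weighted_sobolev_integrated.

(** * The Hardy inequality with remainder *)

Section kernel_slices.
Context (R : realType) (m : nat) (p s : R).
Context (p0 : 0 < p) (s0 : 0 < s).
Local Notation V := 'rV[R]_m.+1.
Local Notation mu := (@lebesgue_rV R m.+1).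
Local Notation lambda := (@lebesgue_measure R).
Local Notation n := (m.+1%:R : R).
Implicit Types (x y : V).

(** The integral of the kernel over a hyperplane at distance 1 from its centre. *)
Definition kernel_const : R :=
  pi `^ (m%:R / 2) * (Gamma ((1 + s * p) / 2) / Gamma ((n + s * p) / 2)).

Let sp0 : 0 < s * p. Proof. exact: mulr_gt0. Qed.

Lemma kernel_const_gt0 : 0 < kernel_const.
Proof.
rewrite /kernel_const mulr_gt0 ?powR_gt0 ?pi_gt0// divr_gt0 ?Gamma_gt0//;
  by rewrite divr_gt0// addr_gt0.
Qed.

Lemma kernC x y : kern p s x y = kern p s y x.
Proof. by rewrite /kern enormB. Qed.

Lemma integral_kern_slice x (t : R) : t != ht x ->
  (\int[lebesgue_rV m]_z (kern p s x (rcons_rV (z, t)))%:E =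
   (kernel_const * `|ht x - t| `^ (- (1 + s * p)))%:E)%E.
Proof.
move=> tx; have D0 : 0 < (ht x - t) ^+ 2.
  by rewrite exprn_even_gt0//= subr_eq0 eq_sym.
have nb : m%:R / 2 < (n + s * p) / 2.
  by rewrite ltr_pM2r ?invr_gt0// -natr1 -addrA ltrDl addr_gt0.
transitivity (\int[lebesgue_rV m]_z ((\sum_(i < m) ((\row_j x ord0 (lift ord_max j))
  ord0 i - z ord0 i) ^+ 2 + (ht x - t) ^+ 2) `^ (- ((n + s * p) / 2)))%:E)%E.
  apply: eq_integral => z _; congr EFin; rewrite /kern /enorm -powR12_sqrt; last first.
    by rewrite sumr_ge0// => i _; exact: sqr_ge0.
  rewrite -powRrM mulrN [2^-1 * _]mulrC; congr (_ `^ _).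
  transitivity (\sum_i (fun i c => (x ord0 i - c) ^+ 2) i (rcons_rV (z, t) ord0 i)).
    by apply: eq_bigr => i _; rewrite !mxE.
  by rewrite (sum_rcons (fun i c => (x ord0 i - c) ^+ 2)); congr (_ + _);
    apply: eq_bigr => j _; rewrite mxE.
rewrite integral_kernel//; congr EFin; rewrite /kernel_const.
have -> : (n + s * p) / 2 - m%:R / 2 = (1 + s * p) / 2 by rewrite -natr1; field.
have -> : m%:R / 2 - (n + s * p) / 2 = - (1 + s * p) / 2 by rewrite -natr1; field.
by rewrite powR_sqr.
Qed.

(** The slice formula is available off the hyperplane through [x]; the assumption [phi (ht x) = 0]
    makes both sides vanish on that one. *)
Lemma integral_kern x (phi : R -> R) : measurable_fun setT phi ->
  (forall t, 0 <= phi t) -> phi (ht x) = 0 ->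
  (\int[mu]_y (phi (ht y) * kern p s x y)%:E =
   kernel_const%:E * \int[lambda]_t (phi t * `|ht x - t| `^ (- (1 + s * p)))%:E)%E.
Proof.
move=> mphi phi0 phix.
have mk : measurable_fun setT (fun y => kern p s x y) by rewrite /kern.
rewrite integral_rcons => [||y]; last 2 first.
- by [].
- by rewrite lee_fin mulr_ge0// kern_ge0.
rewrite -integral_rZl => [|||t]; last 3 first.
- exact: ltW kernel_const_gt0.
- by [].
- by rewrite mulr_ge0 ?powR_ge0.
apply: eq_integral => t _; under eq_integral do rewrite rcons_rV_max.
have [->|tx] := eqVneq (t : R) (ht x).
  rewrite phix; under eq_integral do rewrite mul0r.
  by rewrite integral0 mul0r mulr0.
have mz : measurable_fun setT (fun z : 'rV[R]_m => kern p s x (rcons_rV (z, t))).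
  apply: (measurable_compr mk); apply: (measurableT_comp (@measurable_rcons_rV R m)).
  exact: measurable_fun_pair.
rewrite integral_rZl ?integral_kern_slice//; last by move=> z; exact: kern_ge0.
by rewrite -EFinM; congr EFin; rewrite mulrCA.
Qed.

End kernel_slices.

(** * One-dimensional integrals over the ratio of heights *)

Section ratio_integrals.
Context (R : realType) (p s : R).
Context (p2 : 2 <= p) (s0 : 0 < s).
Local Notation lambda := (@lebesgue_measure R).
Local Notation al := ((s * p - 1) / p).
Implicit Types r t rho : R.

Let p0 : 0 < p. Proof. by rewrite (lt_le_trans _ p2). Qed.
Let p1 : 0 <= p - 1. Proof. by rewrite subr_ge0 (le_trans _ p2)// ler1n. Qed.
Let sp0 : 0 < s * p. Proof. exact: mulr_gt0. Qed.

(** What is left of a main term, as a function of the ratio of heights, when the power of the height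
    has been scaled out. *)
Definition ratio_density r : R :=
  `|1 - r `^ al| `^ (p - 1) * (1 - r) `^ (- (1 + s * p)).

Definition hardy_density r : R :=
  `|1 - r `^ al| `^ p / (1 - r) `^ (1 + s * p).

Lemma ratio_density_ge0 r : 0 <= ratio_density r.
Proof. by rewrite mulr_ge0 ?powR_ge0. Qed.

Lemma hardy_density_ge0 r : 0 <= hardy_density r.
Proof. by rewrite divr_ge0 ?powR_ge0. Qed.

(** The cut-off keeps away from the singularity at 1. Near 0, [r^al] is bounded or unbounded
    according to the sign of [al]; bounding by the sum [1 + r^(al (p-1))] treats both signs and
    explains the two conditions on exponents. *)
Lemma integral_ratio_lty rho (e : R) : 0 < rho < 1 -> -1 < e -> -1 < e + al * (p - 1) ->
  (\int[lambda]_r ((((0 < r) && (r < rho))%R%:R : R) * (r `^ e * ratio_density r))%:E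
    < +oo)%E.
Proof.
move=> /andP[rho0 rho1] e1 eal.
pose K := (1 - rho) `^ (- (1 + s * p)) * 2 `^ (p - 1).
have K0 : 0 <= K by rewrite mulr_ge0 ?powR_ge0.
pose g (r : R) : R := ((0 < r) && (r < 1))%R%:R * r `^ e +
  ((0 < r) && (r < 1))%R%:R * r `^ (e + al * (p - 1)).
have g0 r : 0 <= g r by rewrite addr_ge0// mulr_ge0 ?powR_ge0.
have mg : measurable_fun setT g by rewrite /g.
have md : measurable_fun setT ratio_density by rewrite /ratio_density.
apply: (@le_lt_trans _ _ (\int[lambda]_r (K * g r)%:E)%E).
  apply: le_integral_r => [r|||r].
  - by rewrite !mulr_ge0 ?powR_ge0.
  - by [].
  - by [].
  have [/andP[r0 r1]|_] := boolP (_ && _); last by rewrite mul0r mulr_ge0.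
  have r11 : r < 1 by exact: lt_trans rho1.
  rewrite /g r0 r11 !mul1r /K /ratio_density.
  have h1 : (1 - r) `^ (- (1 + s * p)) <= (1 - rho) `^ (- (1 + s * p)).
    apply: ger_powRl; rewrite ?subr_gt0// ?lerD2l ?lerN2 ?(ltW r1)//.
    by rewrite oppr_le0 addr_ge0// ltW.
  have h2 : `|1 - r `^ al| `^ (p - 1) <= 2 `^ (p - 1) * (1 + r `^ (al * (p - 1))).
    rewrite (powRrM r al (p - 1)); have [ra|ra] := leP (r `^ al) 1.
      rewrite (@le_trans _ _ (1 `^ (p - 1)))//.
        apply: ler_powRl => //; rewrite ger0_norm ?subr_ge0// gerBl; exact: powR_ge0.
      rewrite powR1 mulrDr mulr1 (@le_trans _ _ (2 `^ (p - 1)))//.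
        by apply: powR_ge1; rewrite ?ler1n.
      by rewrite lerDl mulr_ge0 ?powR_ge0.
    rewrite (@le_trans _ _ ((2 * r `^ al) `^ (p - 1)))//.
      apply: ler_powRl => //; rewrite ler_norml; lra.
    by rewrite powRM ?powR_ge0// ler_wpM2l ?powR_ge0// lerDr.
  rewrite [r `^ (e + _)]powRD ?(gt_eqF r0) ?implybT//.
  have -> : (1 - rho) `^ (- (1 + s * p)) * 2 `^ (p - 1) *
      (r `^ e + r `^ e * r `^ (al * (p - 1))) =
    r `^ e * ((2 `^ (p - 1) * (1 + r `^ (al * (p - 1)))) * (1 - rho) `^ (- (1 + s * p))).
    by ring.
  by rewrite ler_wpM2l ?powR_ge0// ler_pM ?powR_ge0.
rewrite integral_rZl// lte_mul_pinfty ?lee_fin//.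
rewrite integral_rD => [||r||r]; last 4 first.
- by [].
- by rewrite mulr_ge0 ?powR_ge0.
- by [].
- by rewrite mulr_ge0 ?powR_ge0.
by rewrite lte_add_pinfty// integral_powR_lty.
Qed.

End ratio_integrals.

Section ratio_identities.
Context (R : realType) (p s rho : R).
Context (p2 : 2 <= p) (s0 : 0 < s) (rho01 : 0 < rho < 1).
Local Notation lambda := (@lebesgue_measure R).
Local Notation al := ((s * p - 1) / p).
Implicit Types a b r t : R.

Let p0 : 0 < p. Proof. by rewrite (lt_le_trans _ p2). Qed.
Let sp0 : 0 < s * p. Proof. exact: mulr_gt0. Qed.
Let rho0 : 0 < rho. Proof. by case/andP: rho01. Qed.
Let rho1 : rho < 1. Proof. by case/andP: rho01. Qed.

Definition ratio_cut r : R := ((0 < r) && (r < rho))%R%:R.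

Lemma measurable_cut : measurable_fun setT ratio_cut.
Proof. by rewrite /ratio_cut. Qed.

Lemma measurable_ratio_density : measurable_fun setT (ratio_density p s).
Proof. by rewrite /ratio_density. Qed.

Lemma measurable_hardy_density : measurable_fun setT (hardy_density p s).
Proof. by rewrite /hardy_density. Qed.

(** [low_ratio] and [high_ratio] are, up to [kernel_const], the coefficients of the Hardy integral
    in the terms carrying [|u|^p] at the lower and at the upper point of a pair. *)
Definition low_ratio : R :=
  fine (\int[lambda]_r (ratio_cut r * (r `^ al * ratio_density p s r))%:E)%E.

Definition high_ratio : R :=
  fine (\int[lambda]_r (ratio_cut r * ratio_density p s r)%:E)%E.

Let al1 : -1 < al.
Proof. by rewrite ltr_pdivlMr// mulN1r; move: (p2) (sp0); lra. Qed.

Lemma low_ratioE :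
  (\int[lambda]_r (ratio_cut r * (r `^ al * ratio_density p s r))%:E = low_ratio%:E)%E.
Proof.
rewrite fineK// ge0_fin_numE; last first.
  by apply: integral_ge0 => r _; rewrite lee_fin !mulr_ge0 ?powR_ge0 ?ratio_density_ge0.
apply: integral_ratio_lty => //.
have -> : al + al * (p - 1) = s * p - 1 by field; rewrite gt_eqF.
by move: (sp0); lra.
Qed.

Lemma high_ratioE :
  (\int[lambda]_r (ratio_cut r * ratio_density p s r)%:E = high_ratio%:E)%E.
Proof.
rewrite fineK// ge0_fin_numE; last first.
  by apply: integral_ge0 => r _; rewrite lee_fin mulr_ge0 ?ratio_density_ge0.
have al' : -1 < 0 + al * (p - 1).
  have -> : 0 + al * (p - 1) = s * p * (p - 1) / p - 1 + p^-1 by field; rewrite gt_eqF.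
  have : 0 <= s * p * (p - 1) / p.
    by rewrite !mulr_ge0 ?invr_ge0 ?(ltW p0) ?(ltW s0)//; move: (p2); lra.
  have : 0 < p^-1 by rewrite invr_gt0.
  lra.
apply: le_lt_trans (integral_ratio_lty p2 s0 rho01 (e := 0) _ al'); last by lra.
rewrite le_eqVlt; apply/orP; left; apply/eqP; apply: eq_integral => r _.
by rewrite powRr0 mul1r.
Qed.

Lemma low_ratio_ge0 : 0 <= low_ratio.
Proof.
by apply/fine_ge0/integral_ge0 => r _;
  rewrite lee_fin !mulr_ge0 ?powR_ge0 ?ratio_density_ge0.
Qed.

Lemma high_ratio_ge0 : 0 <= high_ratio.
Proof.
by apply/fine_ge0/integral_ge0 => r _; rewrite lee_fin mulr_ge0 ?ratio_density_ge0.
Qed.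

Let hardy_split r : ratio_cut r * hardy_density p s r =
  ratio_cut r * (`|1 - r `^ al| * ratio_density p s r).
Proof.
rewrite /ratio_cut; case: andP => [[r0 r1]|_]; rewrite ?mul0r// !mul1r.
rewrite /hardy_density /ratio_density mulrA mulr_powRB1// powRN//.
Qed.

(** The sign of [al] decides which of 1 and [r^al] is the larger on [(0, 1)], hence which of the two
    coefficients exceeds the other by the truncated Hardy constant. *)
Let cut_norm r : ratio_cut r * (`|1 - r `^ al| * ratio_density p s r) =
  if 0 <= al then ratio_cut r * ratio_density p s r - ratio_cut r * (r `^ al * ratio_density p s r)
  else ratio_cut r * (r `^ al * ratio_density p s r) - ratio_cut r * ratio_density p s r.
Proof.
rewrite /ratio_cut; case: andP => [[r0 r1]|_]; last by case: ifP; rewrite !mul0r subrr.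
rewrite !mul1r; have r11 : r <= 1 by rewrite ltW// (lt_trans r1).
case: ifPn => [al0|]; last rewrite -ltNge => /ltW al0.
  have h := ler_powRl al0 (ltW r0) r11; rewrite powR1 in h.
  by rewrite ger0_norm ?subr_ge0// mulrBl mul1r.
have h := ger_powRl al0 r0 r11; rewrite powR1 in h.
by rewrite ler0_norm ?subr_le0// opprB mulrBl mul1r.
Qed.

Lemma hardy_ratio_nneg : 0 <= al ->
  (high_ratio%:E = low_ratio%:E + \int[lambda]_r (ratio_cut r * hardy_density p s r)%:E)%E.
Proof.
move=> al0; have mc := measurable_cut; have mr := measurable_ratio_density.
have mh := measurable_hardy_density.
rewrite -low_ratioE -high_ratioE -integral_rD => [||r||r]; last 4 first.
- by [].
- by rewrite !mulr_ge0 ?powR_ge0 ?ratio_density_ge0.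
- by [].
- by rewrite mulr_ge0 ?hardy_density_ge0.
apply: eq_integral => r _; rewrite hardy_split cut_norm al0; congr EFin; ring.
Qed.

Lemma hardy_ratio_npos : al < 0 ->
  (low_ratio%:E = high_ratio%:E + \int[lambda]_r (ratio_cut r * hardy_density p s r)%:E)%E.
Proof.
move=> al0; have mc := measurable_cut; have mr := measurable_ratio_density.
have mh := measurable_hardy_density.
rewrite -low_ratioE -high_ratioE -integral_rD => [||r||r]; last 4 first.
- by [].
- by rewrite mulr_ge0 ?ratio_density_ge0.
- by [].
- by rewrite mulr_ge0 ?hardy_density_ge0.
apply: eq_integral => r _; rewrite hardy_split cut_norm leNgt al0/=; congr EFin; ring.
Qed.

Lemma integral_high b : 0 < b ->
  (\int[lambda]_t (((0 < t) && (t < rho * b))%R%:R *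
     `|b `^ al - t `^ al| `^ (p - 1) * `|b - t| `^ (- (1 + s * p)))%:E =
   (b `^ (al * (p - 1) - s * p) * high_ratio)%:E)%E.
Proof.
move=> b0; pose f t : R := ((0 < t) && (t < rho * b))%R%:R *
  `|b `^ al - t `^ al| `^ (p - 1) * `|b - t| `^ (- (1 + s * p)).
transitivity (\int[lambda]_t (f t)%:E)%E; first reflexivity.
have mf : measurable_fun setT f by rewrite /f.
have f0 t : 0 <= f t by rewrite /f !mulr_ge0 ?powR_ge0.
have mc := measurable_cut; have mr := measurable_ratio_density.
have -> : (\int[lambda]_t (f t)%:E = b%:E * \int[lambda]_r (f (b * r))%:E)%E.
  by rewrite integral_scale// muleA -EFinM divff ?gt_eqF// mul1e.
have E r : f (b * r) = b `^ (al * (p - 1) - (1 + s * p)) * (ratio_cut r * ratio_density p s r).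
  rewrite /f /ratio_cut pmulr_rgt0// [rho * b]mulrC ltr_pM2l//.
  case: andP => [[r0 r1]|_]; last by rewrite !mul0r mulr0.
  rewrite !mul1r powRM ?(ltW b0) ?(ltW r0)// /ratio_density.
  have -> : b `^ al - b `^ al * r `^ al = b `^ al * (1 - r `^ al) by ring.
  have -> : b - b * r = b * (1 - r) by ring.
  rewrite !normrM (gtr0_norm b0) (ger0_norm (powR_ge0 b al)).
  rewrite (@gtr0_norm _ (1 - r)) ?subr_gt0 ?(lt_trans r1)//.
  rewrite !powRM ?powR_ge0 ?(ltW b0)//; last first.
    by rewrite subr_ge0 ltW// (lt_trans r1).
  rewrite -(powRrM b al) [b `^ (_ - (1 + _))]powRD ?(gt_eqF b0) ?implybT//; ring.
under eq_integral do rewrite E.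
rewrite integral_rZl ?powR_ge0//; last by move=> r; rewrite mulr_ge0 ?ratio_density_ge0.
rewrite high_ratioE -!EFinM mulrA; congr (_ * _)%:E.
rewrite -[X in X * _](powRr1 (ltW b0)) -powRD ?(gt_eqF b0) ?implybT//.
by congr (_ `^ _); ring.
Qed.

(** Heights above [a] are scaled by [a] and then inverted, which brings the ratio into [(0, rho)].
    As [al p = s p - 1], the powers of [r] so produced combine to [r^al], the factor that
    distinguishes [low_ratio] from [high_ratio]. *)
Lemma integral_low a : 0 < a ->
  (\int[lambda]_t ((a < rho * t)%R%:R *
     `|t `^ al - a `^ al| `^ (p - 1) * `|a - t| `^ (- (1 + s * p)))%:E =
   (a `^ (al * (p - 1) - s * p) * low_ratio)%:E)%E.
Proof.
move=> a0; pose f t : R := (a < rho * t)%R%:R *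
  `|t `^ al - a `^ al| `^ (p - 1) * `|a - t| `^ (- (1 + s * p)).
transitivity (\int[lambda]_t (f t)%:E)%E; first reflexivity.
have mf : measurable_fun setT f by rewrite /f.
have f0 t : 0 <= f t by rewrite /f !mulr_ge0 ?powR_ge0.
have mc := measurable_cut; have mr := measurable_ratio_density.
have -> : (\int[lambda]_t (f t)%:E = a%:E * \int[lambda]_r (f (a * r))%:E)%E.
  by rewrite integral_scale// muleA -EFinM divff ?gt_eqF// mul1e.
pose g t : R := (1 < rho * t)%R%:R * `|t `^ al - 1| `^ (p - 1) * `|1 - t| `^ (- (1 + s * p)).
have mg : measurable_fun setT g by rewrite /g.
have g0 t : 0 <= g t by rewrite /g !mulr_ge0 ?powR_ge0.
have E t : f (a * t) = a `^ (al * (p - 1) - (1 + s * p)) * ((0 < t)%R%:R * g t).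
  rewrite /f /g mulrCA -[X in X < _]mulr1 ltr_pM2l//.
  have [t0|t0] := ltP 0 t; last first.
    rewrite mul0r mulr0 ltNge (le_trans (mulr_ge0_le0 (ltW rho0) t0))//.
    by rewrite !mul0r.
  case: ltP => _; last by rewrite !mul0r !mulr0.
  rewrite !mul1r powRM ?(ltW a0) ?(ltW t0)//.
  have -> : a `^ al * t `^ al - a `^ al = a `^ al * (t `^ al - 1) by ring.
  have -> : a - a * t = a * (1 - t) by ring.
  rewrite !normrM (gtr0_norm a0) (ger0_norm (powR_ge0 a al)).
  rewrite !powRM ?powR_ge0 ?(ltW a0)//.
  rewrite -(powRrM a al) [a `^ (_ - (1 + _))]powRD ?(gt_eqF a0) ?implybT//; ring.
under eq_integral do rewrite E.
rewrite integral_rZl ?powR_ge0//; last by move=> r; rewrite mulr_ge0.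
rewrite integral_inversion//.
have Eg r : (0 < r)%R%:R * (r ^- 2 * g r^-1) = ratio_cut r * (r `^ al * ratio_density p s r).
  rewrite /g /ratio_cut; have [r0|_] := ltP 0 r; last by rewrite !mul0r.
  rewrite ltr_pdivlMr// !mul1r /=; have [r1|_] := ltP r rho;
    last by rewrite !(mul0r, mulr0).
  rewrite !mul1r /ratio_density.
  have r11 : r < 1 by exact: lt_trans rho1.
  have -> : r^-1 `^ al - 1 = r `^ (- al) * (1 - r `^ al).
    rewrite mulrBr mulr1 -powRD ?(gt_eqF r0) ?implybT// addNr powRr0.
    by rewrite -[r^-1]powR_inv1 ?(ltW r0)// -powRrM mulN1r.
  have -> : `|1 - r^-1| = r^-1 * (1 - r).
    rewrite mulrBr mulr1 mulVf ?gt_eqF// ler0_norm ?opprB// subr_le0.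
    by rewrite invf_ge1// ltW.
  rewrite normrM (ger0_norm (powR_ge0 r _)) powRM ?powR_ge0//.
  rewrite powRM ?invr_ge0 ?subr_ge0 ?(ltW r0) ?(ltW r11)//.
  rewrite -[r^-1]powR_inv1 ?(ltW r0)// -!powRrM -powR_mulrn ?(ltW r0)// -powRN.
  set X := `|_| `^ _; set Y := (1 - r) `^ _.
  have -> : r `^ (- 2%:R) * (r `^ (- al * (p - 1)) * X * (r `^ (-1 * - (1 + s * p)) * Y)) =
    r `^ (- 2%:R) * r `^ (- al * (p - 1)) * r `^ (-1 * - (1 + s * p)) * (X * Y) by ring.
  rewrite -!powRD ?(gt_eqF r0) ?implybT//; congr (_ `^ _ * _).
  by field; rewrite gt_eqF.
under eq_integral do rewrite Eg.
rewrite low_ratioE -!EFinM mulrA; congr (_ * _)%:E.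
rewrite -[X in X * _](powRr1 (ltW a0)) -powRD ?(gt_eqF a0) ?implybT//.
by congr (_ `^ _); ring.
Qed.

End ratio_identities.

(** * The convexity inequality along pairs of heights *)

Section ground_state.
Context (R : realType) (m : nat) (p s lam : R).
Context (p2 : 2 <= p) (s0 : 0 < s) (lam1 : 1 <= lam).
Local Notation V := 'rV[R]_m.+1.
Local Notation mu := (@lebesgue_rV R m.+1).
Local Notation lambda := (@lebesgue_measure R).
Local Notation n := (m.+1%:R : R).
Local Notation al := ((s * p - 1) / p).
Local Notation Cn := (kernel_const m p s).
Implicit Types (x y : V) (u : V -> R) (t a b rho : R).

Let p0 : 0 < p. Proof. by rewrite (lt_le_trans _ p2). Qed.
Let p10 : 0 <= p - 1. Proof. by rewrite subr_ge0 (le_trans _ p2)// ler1n. Qed.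
Let lam0 : 0 < lam. Proof. by rewrite (lt_le_trans _ lam1). Qed.

(** [2^(1-p)] is the constant of uniform convexity; [(2 lam)^-|al|] pays, when [al < 0], for
    replacing the power [al] of the upper height by that of the lower one. *)
Definition remainder_const : R := 2 `^ (1 - p) * (2 * lam) `^ (- `|al|).
Local Notation c1 := remainder_const.

Lemma remainder_const_gt0 : 0 < c1.
Proof. by rewrite mulr_gt0 ?powR_gt0// mulr_gt0. Qed.

Let alE t : 0 < t -> t `^ al * (t `^ (- al)) `^ p = t `^ (- (al * (p - 1))).
Proof.
move=> t0; rewrite -powRrM -powRD ?(gt_eqF t0) ?implybT//; congr (_ `^ _); ring.
Qed.

Let alK t : 0 < t -> t `^ al * t `^ (- al) = 1.
Proof. by move=> t0; rewrite -powRD ?(gt_eqF t0) ?implybT// subrr powRr0. Qed.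

(** [ground_state_ineq] with [W] and [w] the larger and the smaller of [t^al] and [t'^al], applied
    to the two values of the quotient. Which height gives [W] depends on the sign of [al], so [A]
    and [B] change sides with it. *)
Lemma ground_state_real t t' a b A B : 0 < t -> t < t' ->
  A = `|t' `^ al - t `^ al| `^ (p - 1) * (t' `^ (- (al * (p - 1))) * `|b| `^ p) ->
  B = `|t' `^ al - t `^ al| `^ (p - 1) * (t `^ (- (al * (p - 1))) * `|a| `^ p) ->
  c1 * ((t' <= 2 * lam * t)%R%:R *
    (t `^ (s * p - 1) * `|a * t `^ (- al) - b * t' `^ (- al)| `^ p))
  + (if 0 <= al then A else B) <= `|a - b| `^ p + (if 0 <= al then B else A).
Proof.
move=> t0 tt' -> ->; have t'0 : 0 < t' by exact: lt_trans t0 tt'.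
set X := t `^ al; set Y := t' `^ al.
set v := a * t `^ (- al); set w := b * t' `^ (- al).
have X0 : 0 < X by exact: powR_gt0.
have Y0 : 0 < Y by exact: powR_gt0.
have Xv : X * v = a by rewrite /v mulrCA alK// mulr1.
have Yw : Y * w = b by rewrite /w mulrCA alK// mulr1.
have Xvp : X * `|v| `^ p = t `^ (- (al * (p - 1))) * `|a| `^ p.
  by rewrite /v normrM powRM// (ger0_norm (powR_ge0 _ _)) mulrCA mulrC alE.
have Ywp : Y * `|w| `^ p = t' `^ (- (al * (p - 1))) * `|b| `^ p.
  by rewrite /w normrM powRM// (ger0_norm (powR_ge0 _ _)) mulrCA mulrC alE.
have tsp : X `^ (p - 1) * X = t `^ (s * p - 1).
  rewrite mulrC mulr_powRB1 ?(ltW X0)// -powRrM divfK// gt_eqF//.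
have W0 : 0 <= `|v - w| `^ p by exact: powR_ge0.
have lam21 : 1 <= 2 * lam by rewrite mulr_ege1 ?ler1n.
have L0 : 0 < (2 * lam) `^ `|al| by rewrite powR_gt0// mulr_gt0.
have rem W : 0 <= W -> (t' <= 2 * lam * t ->
  X `^ (p - 1) * X <= (2 * lam) `^ `|al| * W) ->
    c1 * ((t' <= 2 * lam * t)%R%:R * (t `^ (s * p - 1) * `|v - w| `^ p)) <=
    2 `^ (1 - p) * (W * `|v - w| `^ p).
  move=> HW; have [tl h|_ _] := leP t' (2 * lam * t); last first.
    by rewrite mul0r mulr0 mulr_ge0 ?powR_ge0// mulr_ge0.
  rewrite mul1r /remainder_const -mulrA ler_wpM2l ?powR_ge0//.
  rewrite mulrA ler_wpM2r// -tsp powRN mulrC ler_pdivrMr// mulrC.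
  by rewrite mulrC [leRHS]mulrC; exact: h.
case: ifPn => [al0|].
  have XY : X <= Y by apply: ler_powRl => //; exact: ltW.
  have := ground_state_ineq w v p2 X0 XY.
  rewrite Xv Yw Xvp Ywp [`|w - v|]distrC [`|b - a|]distrC => h.
  rewrite -/X -/Y (ger0_norm (_ : 0 <= Y - X)) ?subr_ge0//.
  apply: le_trans h; rewrite addrC lerD2l.
  apply: rem; first by rewrite mulr_ge0 ?powR_ge0// ltW.
  move=> _; rewrite mulrA ler_wpM2r ?(ltW X0)//.
  apply: (@le_trans _ _ (Y `^ (p - 1))).
    exact: ler_powRl p10 (ltW X0) XY.
  by rewrite ler_peMl ?powR_ge0// powR_ge1.
rewrite -ltNge => /ltW al0.
have YX : Y <= X by apply: ger_powRl => //; exact: ltW.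
have := ground_state_ineq v w p2 Y0 YX.
rewrite Xv Yw Xvp Ywp => h.
rewrite -/X -/Y (distrC Y X) (ger0_norm (_ : 0 <= X - Y)) ?subr_ge0//.
apply: le_trans h; rewrite addrC lerD2l.
apply: rem; first by rewrite mulr_ge0 ?powR_ge0// ltW.
move=> tl; rewrite mulrCA ler_wpM2l ?powR_ge0//.
by have [] := powR_ratio_le al t0 (ltW tt') tl.
Qed.

Definition hardy_integrand u y : R := (0 < ht y)%R%:R * (`|u y| `^ p * ht y `^ (- (s * p))).

Lemma hardy_integrand_ge0 u y : 0 <= hardy_integrand u y.
Proof. by rewrite /hardy_integrand !mulr_ge0 ?powR_ge0. Qed.

Lemma measurable_hardy_integrand u : measurable_fun setT u ->
  measurable_fun setT (hardy_integrand u).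
Proof. by move=> mu_; rewrite /hardy_integrand. Qed.

Definition below rho x y : bool := (0 < ht x) && (ht x < rho * ht y).

Section fixed_ratio.
Context (rho : R) (rho01 : 0 < rho < 1).
Let rho0 : 0 < rho. Proof. by case/andP: rho01. Qed.
Let rho1 : rho < 1. Proof. by case/andP: rho01. Qed.

Local Notation weight x y := (`|ht y `^ al - ht x `^ al| `^ (p - 1)).

Definition upper_term u (z : V * V) : R := (below rho z.1 z.2)%:R *
  (weight z.1 z.2 * (ht z.2 `^ (- (al * (p - 1))) * `|u z.2| `^ p)) * kern p s z.1 z.2.

Definition lower_term u (z : V * V) : R := (below rho z.1 z.2)%:R *
  (weight z.1 z.2 * (ht z.1 `^ (- (al * (p - 1))) * `|u z.1| `^ p)) * kern p s z.1 z.2.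

Lemma measurable_upper_term u : measurable_fun setT u ->
  measurable_fun setT (upper_term u).
Proof. by move=> mu_; rewrite /upper_term /below /kern; measurability. Qed.

Lemma measurable_lower_term u : measurable_fun setT u ->
  measurable_fun setT (lower_term u).
Proof. by move=> mu_; rewrite /lower_term /below /kern; measurability. Qed.

Lemma upper_term_ge0 u z : 0 <= upper_term u z.
Proof. by rewrite /upper_term !mulr_ge0 ?powR_ge0. Qed.

Lemma lower_term_ge0 u z : 0 <= lower_term u z.
Proof. by rewrite /lower_term !mulr_ge0 ?powR_ge0. Qed.

(** After the exchange of integrals the lower point is integrated first: the kernel is integrated
    along horizontal slices, and a one-dimensional integral over the lower height remains. *)
Lemma integral_upper_term u : measurable_fun setT u ->
  (\int[mu]_x \int[mu]_y (upper_term u (x, y))%:E =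
   (Cn * high_ratio p s rho)%:E * \int[mu]_y (hardy_integrand u y)%:E)%E.
Proof.
move=> mu_; have mU := measurable_upper_term mu_.
have mH := measurable_hardy_integrand mu_.
rewrite (tonelli_r _ _ mU (upper_term_ge0 u)).
have c0 : 0 <= Cn * high_ratio p s rho.
  by apply: mulr_ge0; [apply/ltW/kernel_const_gt0|exact: high_ratio_ge0].
rewrite -(integral_rZl _ c0 mH (hardy_integrand_ge0 u)).
apply: eq_integral => y _; rewrite /hardy_integrand.
have [y0|y0] := ltP 0 (ht y); last first.
  rewrite mul0r mulr0 integral0_eq// => x _; rewrite /upper_term /below/=.
  have [x0|_] := ltP 0 (ht x); last by rewrite !mul0r.
  rewrite ltNge (le_trans (mulr_ge0_le0 (ltW rho0) y0) (ltW x0))/=.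
  by rewrite !mul0r.
pose phi t : R := ((0 < t) && (t < rho * ht y))%R%:R * `|ht y `^ al - t `^ al| `^ (p - 1).
have mphi : measurable_fun setT phi by rewrite /phi.
have phi0 t : 0 <= phi t by rewrite /phi mulr_ge0 ?powR_ge0.
have phiy : phi (ht y) = 0.
  by rewrite /phi [_ < rho * _]ltNge ler_piMl ?(ltW y0) ?(ltW rho1)// andbF mul0r.
pose K := ht y `^ (- (al * (p - 1))) * `|u y| `^ p.
have K0 : 0 <= K by rewrite mulr_ge0 ?powR_ge0.
have mk : measurable_fun setT (fun x => phi (ht x) * kern p s y x) by rewrite /kern;
  measurability.
have k0 x : 0 <= phi (ht x) * kern p s y x by rewrite mulr_ge0// kern_ge0.
transitivity (\int[mu]_x (K * (phi (ht x) * kern p s y x))%:E)%E.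
  by apply: eq_integral => x _; rewrite /upper_term /phi /K/= (kernC p s x y);
    congr EFin; ring.
rewrite (integral_rZl _ K0 mk k0) integral_kern// integral_high//.
rewrite -!EFinM; congr EFin; rewrite mul1r /K.
have -> : ht y `^ (al * (p - 1) - s * p) = ht y `^ (al * (p - 1)) * ht y `^ (- (s * p)).
  by rewrite powRD ?(gt_eqF y0) ?implybT.
have e : ht y `^ (- (al * (p - 1))) * ht y `^ (al * (p - 1)) = 1.
  by rewrite -powRD ?(gt_eqF y0) ?implybT// addNr powRr0.
transitivity (Cn * high_ratio p s rho * (`|u y| `^ p * ht y `^ (- (s * p))) *
  (ht y `^ (- (al * (p - 1))) * ht y `^ (al * (p - 1)))); first by ring.
by rewrite e mulr1.
Qed.

Lemma integral_lower_term u : measurable_fun setT u ->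
  (\int[mu]_x \int[mu]_y (lower_term u (x, y))%:E =
   (Cn * low_ratio p s rho)%:E * \int[mu]_y (hardy_integrand u y)%:E)%E.
Proof.
move=> mu_; have mH := measurable_hardy_integrand mu_.
have c0 : 0 <= Cn * low_ratio p s rho.
  by apply: mulr_ge0; [apply/ltW/kernel_const_gt0|exact: low_ratio_ge0].
rewrite -(integral_rZl _ c0 mH (hardy_integrand_ge0 u)).
apply: eq_integral => x _; rewrite /hardy_integrand.
have [x0|x0] := ltP 0 (ht x); last first.
  rewrite mul0r mulr0 integral0_eq// => y _; rewrite /lower_term /below/=.
  by rewrite ltNge x0 !mul0r.
pose phi t : R := (ht x < rho * t)%R%:R * `|t `^ al - ht x `^ al| `^ (p - 1).
have mphi : measurable_fun setT phi by rewrite /phi.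
have phi0 t : 0 <= phi t by rewrite /phi mulr_ge0 ?powR_ge0.
have phix : phi (ht x) = 0.
  by rewrite /phi [_ < rho * _]ltNge ler_piMl ?(ltW x0) ?(ltW rho1)// mul0r.
pose K := ht x `^ (- (al * (p - 1))) * `|u x| `^ p.
have K0 : 0 <= K by rewrite mulr_ge0 ?powR_ge0.
have mk : measurable_fun setT (fun y => phi (ht y) * kern p s x y) by rewrite /kern;
  measurability.
have k0 y : 0 <= phi (ht y) * kern p s x y by rewrite mulr_ge0// kern_ge0.
transitivity (\int[mu]_y (K * (phi (ht y) * kern p s x y))%:E)%E.
  by apply: eq_integral => y _; rewrite /lower_term /phi /K/= /below x0; congr EFin; ring.
rewrite (integral_rZl _ K0 mk k0) integral_kern// integral_low//.
rewrite -!EFinM; congr EFin; rewrite mul1r /K.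
have -> : ht x `^ (al * (p - 1) - s * p) = ht x `^ (al * (p - 1)) * ht x `^ (- (s * p)).
  by rewrite powRD ?(gt_eqF x0) ?implybT.
have e : ht x `^ (- (al * (p - 1))) * ht x `^ (al * (p - 1)) = 1.
  by rewrite -powRD ?(gt_eqF x0) ?implybT// addNr powRr0.
transitivity (Cn * low_ratio p s rho * (`|u x| `^ p * ht x `^ (- (s * p))) *
  (ht x `^ (- (al * (p - 1))) * ht x `^ (al * (p - 1)))); first by ring.
by rewrite e mulr1.
Qed.

End fixed_ratio.
End ground_state.

Lemma tonelli_prod d1 d2 (T1 : measurableType d1) (T2 : measurableType d2)
  (R : realType) (m1 : {sigma_finite_measure set T1 -> \bar R})
  (m2 : {sigma_finite_measure set T2 -> \bar R}) (f : T1 * T2 -> R) :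
  measurable_fun setT f -> (forall z, 0 <= f z) ->
  (\int[m1 \x m2]_z (f z)%:E = \int[m1]_x \int[m2]_y (f (x, y))%:E)%E.
Proof.
by move=> mf f0; rewrite (fubini_tonelli1 (EFin \o f)).
Qed.

Section ground_state_bound.
Context (R : realType) (m : nat) (p s lam : R).
Context (p2 : 2 <= p) (s0 : 0 < s) (lam1 : 1 <= lam).
Local Notation V := 'rV[R]_m.+1.
Local Notation mu := (@lebesgue_rV R m.+1).
Local Notation lambda := (@lebesgue_measure R).
Local Notation al := ((s * p - 1) / p).
Local Notation Cn := (kernel_const m p s).
Local Notation c1 := (remainder_const p s lam).
Implicit Types (x y : V) (u : V -> R) (z : V * V).

Let p0 : 0 < p. Proof. by rewrite (lt_le_trans _ p2). Qed.

Definition ground_quotient u x : R := u x * ht x `^ (- al).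

Definition energy_density u z : R := `|u z.1 - u z.2| `^ p * kern p s z.1 z.2.

Definition ordered z : bool := (0 < ht z.1) && (ht z.1 < ht z.2).

Lemma energy_density_ge0 u z : 0 <= energy_density u z.
Proof. by rewrite /energy_density mulr_ge0 ?powR_ge0. Qed.

Lemma measurable_ground_quotient u : measurable_fun setT u ->
  measurable_fun setT (ground_quotient u).
Proof. by move=> mu_; rewrite /ground_quotient; measurability. Qed.

Lemma measurable_energy_density u : measurable_fun setT u ->
  measurable_fun setT (energy_density u).
Proof. by move=> mu_; rewrite /energy_density /kern; measurability. Qed.

Lemma measurable_below rho : measurable_fun setT (fun z => below (m := m) rho z.1 z.2).
Proof. by rewrite /below; measurability. Qed.

Lemma measurable_ordered : measurable_fun setT ordered.
Proof. by rewrite /ordered; measurability. Qed.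

Lemma below_ordered rho z : 0 < rho < 1 -> below rho z.1 z.2 -> ordered z.
Proof.
move=> /andP[rho0 rho1] /andP[x0 xy]; rewrite /ordered x0/=.
have y0 : 0 < ht z.2 by rewrite -(pmulr_rgt0 _ rho0) (lt_trans x0).
by rewrite (lt_trans xy)// gtr_pMl.
Qed.

Let scale_if_le (b : bool) (c N T Q E A B k : R) :
  c * (N * (T * Q)) + (if b then A else B) <= E + (if b then B else A) ->
  0 <= k ->
  c * (N * (T * (Q * k))) + (if b then A * k else B * k) <=
  E * k + (if b then B * k else A * k).
Proof.
move=> h k0; have := ler_wpM2r k0 h.
by case: b {h}; rewrite !mulrDl !mulrA.
Qed.

Lemma ground_state_density u rho z : 0 < rho < 1 ->
  (below rho z.1 z.2)%:R * (c1 * local_density p s lam (ground_quotient u) z) +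
  (if 0 <= al then upper_term p s rho u z else lower_term p s rho u z) <=
  (below rho z.1 z.2)%:R * energy_density u z +
  (if 0 <= al then lower_term p s rho u z else upper_term p s rho u z).
Proof.
move=> rho01; rewrite /upper_term /lower_term.
have [xy|_] := boolP (below rho z.1 z.2); last first.
  by case: ifP => _; rewrite !mul0r addr0.
have /andP[x0 xy'] := below_ordered rho01 xy.
rewrite !mul1r /local_density /energy_density /near_above x0 xy'/=.
have h := ground_state_real (a := u z.1) (b := u z.2) p2 lam1 x0 xy' erefl erefl.
exact: scale_if_le (h s) (kern_ge0 p s z.1 z.2).
Qed.

Section fixed.
Context (u : V -> R) (mu_ : measurable_fun setT u) (h : R).
Context (hu : (\int[mu]_y (hardy_integrand p s u y)%:E = h%:E)%E).

Let h0 : 0 <= h.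
Proof.
by rewrite -lee_fin -hu; apply: integral_ge0 => y _; rewrite lee_fin hardy_integrand_ge0.
Qed.

Let mld : measurable_fun setT (local_density p s lam (ground_quotient u)).
Proof. exact: measurable_local_density (measurable_ground_quotient mu_). Qed.

Let med := measurable_energy_density mu_.
Let ld0 := local_density_ge0 p s lam (ground_quotient u).
Let ed0 := energy_density_ge0 u.
Let c10 : 0 <= c1. Proof. by apply/ltW/remainder_const_gt0. Qed.
(** The cut-off makes both main terms finite, so the smaller can be cancelled against part of the
    larger; what survives of it is the truncated Hardy constant. *)
Lemma ground_state_below rho : 0 < rho < 1 ->
  (c1%:E * \int[mu \x mu]_z ((below rho z.1 z.2)%:R *
      local_density p s lam (ground_quotient u) z)%:E +
   (Cn * h)%:E * \int[lambda]_r (ratio_cut rho r * hardy_density p s r)%:E <=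
   \int[mu \x mu]_z ((ordered z)%:R * energy_density u z)%:E)%E.
Proof.
move=> rho01; have mb := measurable_below rho; have mo := measurable_ordered.
pose L z := (below rho z.1 z.2)%:R * local_density p s lam (ground_quotient u) z.
have mL : measurable_fun setT L by rewrite /L; measurability.
have L0 z : 0 <= L z by rewrite mulr_ge0.
pose D := (\int[lambda]_r (ratio_cut rho r * hardy_density p s r)%:E)%E.
have D0 : (0 <= D)%E.
  by apply: integral_ge0 => r _; rewrite lee_fin mulr_ge0// hardy_density_ge0.
pose U z := upper_term p s rho u z.
pose W z := lower_term p s rho u z.
have mU : measurable_fun setT U by exact: measurable_upper_term.
have mW : measurable_fun setT W by exact: measurable_lower_term.
have U0 z : 0 <= U z by exact: upper_term_ge0.
have W0 z : 0 <= W z by exact: lower_term_ge0.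
have IU : (\int[mu \x mu]_z (U z)%:E = (Cn * high_ratio p s rho * h)%:E)%E.
  by rewrite (tonelli_prod _ _ mU U0) integral_upper_term// hu -EFinM.
have IW : (\int[mu \x mu]_z (W z)%:E = (Cn * low_ratio p s rho * h)%:E)%E.
  by rewrite (tonelli_prod _ _ mW W0) integral_lower_term// hu -EFinM.
pose P z := (below rho z.1 z.2)%:R * energy_density u z.
have mP : measurable_fun setT P by rewrite /P; measurability.
have P0 z : 0 <= P z by rewrite mulr_ge0.
have mL1 : measurable_fun setT (fun z => c1 * L z) by measurability.
have L10 z : 0 <= c1 * L z by rewrite mulr_ge0.
(* Both signs of [al] at once: [A] is the term with the larger coefficient, the upper one for
   [al >= 0] and the lower one otherwise. From [a = b + D] with real [a] and [b], [D] is finite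
   too. *)
have step (A B : V * V -> R) a b : measurable_fun setT A -> measurable_fun setT B ->
    (forall z, 0 <= A z) -> (forall z, 0 <= B z) ->
    (forall z, c1 * L z + A z <= P z + B z) ->
    (\int[mu \x mu]_z (A z)%:E = (Cn * a * h)%:E)%E ->
    (\int[mu \x mu]_z (B z)%:E = (Cn * b * h)%:E)%E ->
    (a%:E = b%:E + D)%E ->
    (c1%:E * \int[mu \x mu]_z (L z)%:E + (Cn * h)%:E * D <=
      \int[mu \x mu]_z (P z)%:E)%E.
  move=> mA mB A0 B0 AB IA IB; move: D D0 => {}D D0 ab.
  have [e De] : exists e, D = e%:E.
    by case: D D0 ab => [e _ _|//|//]; exists e.
  have : (\int[mu \x mu]_z (c1 * L z + A z)%:E <= \int[mu \x mu]_z (P z + B z)%:E)%E.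
    apply: le_integral_r => [z|||z]; [|by measurability|by measurability|exact: AB].
    exact: addr_ge0.
  rewrite (integral_rD _ mL1 L10 mA A0) (integral_rD _ mP P0 mB B0) IA IB.
  rewrite (integral_rZl _ c10 mL L0).
  move: ab; rewrite De -EFinD => -[->].
  have -> : Cn * (b + e) * h = Cn * h * e + Cn * b * h by ring.
  by rewrite -EFinM EFinD addeA leeD2rE.
apply: (@le_trans _ _ (\int[mu \x mu]_z (P z)%:E)%E); last first.
  apply: le_integral_r => [//|//||z]; first by measurability.
  rewrite /P ler_wpM2r//.
  have [/(below_ordered rho01) ->//|_] := boolP (below rho z.1 z.2).
  by rewrite ler0n.
have dens z : c1 * L z + (if 0 <= al then U z else W z) <= P z +
  (if 0 <= al then W z else U z).
  by have := ground_state_density u z rho01; rewrite /L /P /U /W mulrCA.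
have [al0|al0] := leP 0 al.
  apply: (step U W (high_ratio p s rho) (low_ratio p s rho)) => //.
    by move=> z; have := dens z; rewrite al0.
  exact: hardy_ratio_nneg.
apply: (step W U (low_ratio p s rho) (high_ratio p s rho)) => //.
  by move=> z; have := dens z; rewrite [0 <= _]leNgt al0.
exact: hardy_ratio_npos.
Qed.

End fixed.
End ground_state_bound.

(** * Removing the cut-off of the ratio *)

Section full_ratio.
Context (R : realType) (m : nat) (p s lam : R).
Context (p2 : 2 <= p) (s0 : 0 < s) (lam1 : 1 <= lam).
Local Notation V := 'rV[R]_m.+1.
Local Notation mu := (@lebesgue_rV R m.+1).
Local Notation lambda := (@lebesgue_measure R).
Local Notation Cn := (kernel_const m p s).
Local Notation c1 := (remainder_const p s lam).
Implicit Types (x y : V) (u : V -> R) (z : V * V).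

Let p0 : 0 < p. Proof. by rewrite (lt_le_trans _ p2). Qed.

Definition hardy_ratio_integral : \bar R :=
  (\int[lambda]_r (((0 < r) && (r < 1))%R%:R * hardy_density p s r)%:E)%E.

(** The shift by 2 makes the first ratio 1/2 rather than 0. *)
Let rk (k : nat) : R := 1 - k.+2%:R^-1.

Let rk01 k : 0 < rk k < 1.
Proof.
by rewrite /rk subr_gt0 invf_lt1 ?ltr1n//= ltrBlDr ltrDl invr_gt0.
Qed.

Let rk_le k j : (k <= j)%N -> rk k <= rk j.
Proof. by move=> kj; rewrite lerD2l lerN2 lef_pV2 ?posrE// ler_nat !ltnS. Qed.

Let rk_near (a b : R) k0 : a < b -> 0 < b -> \forall k \near \oo, a < rk (k0 + k)%N * b.
Proof.
move=> ab b0; have e0 : 0 < (b - a) / b by rewrite divr_gt0// subr_gt0.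
near=> k.
have : k.+1%:R^-1 < (b - a) / b.
  by near: k; exact: (near_infty_natSinv_lt (PosNum e0)).
rewrite ltr_pdivlMr// => h.
rewrite /rk mulrBl mul1r ltrBrDr -ltrBrDl (le_lt_trans _ h)// ler_wpM2r ?(ltW b0)//.
by rewrite lef_pV2 ?posrE// ler_nat ltnS leqW// leq_addl.
Unshelve. all: by end_near. Qed.

(** The remainder and the Hardy constant are integrals over different spaces, so the cut-off is
    removed in two successive limits, each by [integral_le_of_cvg]. *)
Lemma ground_state_bound u (h : R) : measurable_fun setT u ->
  (\int[mu]_y (hardy_integrand p s u y)%:E = h%:E)%E ->
  (c1%:E * local_energy p s lam (ground_quotient p s u) +
   (Cn * fine hardy_ratio_integral * h)%:E <=
   \int[mu \x mu]_z ((ordered z)%:R * energy_density p s u z)%:E)%E.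
Proof.
move=> mu_ hu.
set P := (\int[mu \x mu]_z _)%E.
pose L z := local_density p s lam (ground_quotient p s u) z.
have mL : measurable_fun setT L.
  exact: measurable_local_density (measurable_ground_quotient p s mu_).
have L0 z : 0 <= L z by exact: local_density_ge0.
have Lo z : ~~ ordered z -> L z = 0.
  rewrite /L /local_density /near_above /ordered negb_and => /orP[] /negbTE -> /=;
    by rewrite ?andbF mul0r.
have h0 : 0 <= h.
  by rewrite -lee_fin -hu; apply: integral_ge0 => y _;
    rewrite lee_fin hardy_integrand_ge0.
have c10 : 0 < c1 by exact: remainder_const_gt0.
have Cnh : 0 <= Cn * h by rewrite mulr_ge0// ltW// kernel_const_gt0.
have B k := ground_state_below p2 s0 lam1 mu_ hu (rk01 k).
have EE : local_energy p s lam (ground_quotient p s u) = (\int[mu \x mu]_z (L z)%:E)%E.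
  by rewrite (tonelli_prod _ _ mL L0).
rewrite EE {EE}.
set E := (\int[mu \x mu]_z (L z)%:E)%E.
have E0 : (0 <= E)%E by apply: integral_ge0 => z _; rewrite lee_fin.
pose D k := (\int[lambda]_r (ratio_cut (rk k) r * hardy_density p s r)%:E)%E.
have D0 k : (0 <= D k)%E.
  by apply: integral_ge0 => r _; rewrite lee_fin mulr_ge0 ?hardy_density_ge0.
pose Ek k := (\int[mu \x mu]_z ((below (rk k) z.1 z.2)%:R * L z)%:E)%E.
have mb k := measurable_below (m := m) (rk k).
have mh := measurable_hardy_density p s.
have mc k := measurable_cut (rk k).
have Ek0 k : (0 <= Ek k)%E.
  by apply: integral_ge0 => z _; rewrite lee_fin mulr_ge0.
have {}B k : (c1%:E * Ek k + (Cn * h)%:E * D k <= P)%E by exact: B.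
clearbody L.
have D_le k j : (k <= j)%N -> (D k <= D j)%E.
  move=> kj; have mk := mc k; have mj := mc j.
  apply: le_integral_r => [r|||r]; [|by measurability|by measurability|].
    by rewrite mulr_ge0 ?hardy_density_ge0.
  rewrite ler_wpM2r ?hardy_density_ge0// /ratio_cut.
  have [/andP[r0 rr]|_] := boolP (_ && _); last by rewrite ler0n.
  by rewrite r0 (lt_le_trans rr)// rk_le.
have P0 : (0 <= P)%E.
  by apply: le_trans (B 0%N); rewrite adde_ge0// mule_ge0// lee_fin// ltW.
move: B; case: P P0 => [P P0 B|_ _|//]; last by rewrite leey.
(* The cut-off [k0] in the Hardy constant is frozen while that of the remainder tends to 1; this is
   possible because [D] increases with its index. *)
have S1 k0 : (c1%:E * E + (Cn * h)%:E * D k0 <= P%:E)%E.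
  have fD : ((Cn * h)%:E * D k0)%E \is a fin_num.
    rewrite ge0_fin_numE ?mule_ge0 ?lee_fin//.
    apply: le_lt_trans (ltry P); apply: le_trans (B k0).
    by rewrite leeDr// mule_ge0// lee_fin ltW.
  rewrite -leeBrDr// -integral_rZl ?(ltW c10)//.
  apply: (integral_le_of_cvg (f := fun k z => c1 * ((below (rk (k0 + k)%N) z.1 z.2)%:R * L z))).
  - by move=> k; have mbk := mb (k0 + k)%N; measurability.
  - by move=> k z; apply: mulr_ge0; [exact: ltW|exact: mulr_ge0].
  - by measurability.
  - by move=> z; apply: mulr_ge0; [exact: ltW|exact: L0].
  - move=> z; have [/andP[x0 xy]|/Lo ->] := boolP (ordered z); last first.
      by under eq_fun do rewrite !mulr0; rewrite mulr0; exact: cvg_cst.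
    apply: cvg_near_cst; near=> k; rewrite /below x0/=.
    have -> : ht z.1 < rk (k0 + k)%N * ht z.2.
      by near: k; apply: rk_near => //; exact: lt_trans xy.
    by rewrite mul1r.
  - move=> k; have mbk := mb (k0 + k)%N; rewrite leeBrDr//.
    rewrite integral_rZl ?(ltW c10)//; last by move=> z; rewrite mulr_ge0.
    apply: le_trans (B (k0 + k)%N); apply: leeD => //.
    by apply: lee_wpmul2l; [rewrite lee_fin|exact: D_le (leq_addr _ _)].
have fE : (c1%:E * E)%E \is a fin_num.
  rewrite ge0_fin_numE ?mule_ge0 ?lee_fin ?(ltW c10)//.
  apply: le_lt_trans (ltry P); apply: le_trans (S1 0%N).
  by rewrite leeDl// mule_ge0// lee_fin.
have H0 : (0 <= hardy_ratio_integral)%E.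
  by apply: integral_ge0 => r _; rewrite lee_fin mulr_ge0 ?hardy_density_ge0.
have S2 : ((Cn * h)%:E * hardy_ratio_integral <= P%:E - c1%:E * E)%E.
  rewrite /hardy_ratio_integral -[leLHS]integral_rZl//; last by move=> r;
    rewrite mulr_ge0 ?hardy_density_ge0.
  apply: (@integral_le_of_cvg _ _ R lambda
    (fun k r => Cn * h * (ratio_cut (rk k) r * hardy_density p s r))).
  - by move=> k; have mck := mc k; measurability.
  - by move=> k r; apply: mulr_ge0 => //; rewrite mulr_ge0 ?hardy_density_ge0.
  - by measurability.
  - by move=> r; apply: mulr_ge0 => //; rewrite mulr_ge0 ?hardy_density_ge0.
  - move=> r; apply: cvg_near_cst.
    have [/andP[r0 r1]|] := boolP (_ && _); last first.
      rewrite negb_and => nr; apply: nearW => k; rewrite /ratio_cut.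
      case: andP => // -[r0 rr]; move: nr; rewrite r0/= => /negP[].
      by rewrite (lt_trans rr)//; have /andP[] := rk01 k.
    near=> k; rewrite /ratio_cut r0/=.
    have : r < rk (0 + k)%N * 1 by near: k; exact: rk_near.
    by rewrite add0n mulr1 => ->.
  - move=> k; have mck := mc k; rewrite leeBrDr// addeC integral_rZl//; last first.
      by move=> r; rewrite mulr_ge0 ?hardy_density_ge0.
    exact: S1.
rewrite addeC -leeBrDr//; apply: le_trans S2.
rewrite [Cn * _ * h]mulrAC EFinM; apply: lee_wpmul2l; first by rewrite lee_fin.
(* If the ratio integral were infinite, [fine] would give 0 and the bound would still hold. *)
by case: hardy_ratio_integral H0 => [r _|_|]//=; rewrite leey.
Unshelve. all: by end_near. Qed.

End full_ratio.

Section half_space_integrals.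
Context (R : realType) (m : nat) (p s : R).
Local Notation V := 'rV[R]_m.+1.
Local Notation mu := (@lebesgue_rV R m.+1).
Implicit Types (x y : V) (u : V -> R) (z : V * V).

Definition both_above z : bool := (0 < ht z.1) && (0 < ht z.2).

Lemma measurable_both_above : measurable_fun setT both_above.
Proof. by rewrite /both_above; measurability. Qed.

Lemma gagliardoE u : gagliardo s p u =
  (\int[mu \x mu]_z ((both_above z)%:R * energy_density p s u z)%:E)%E.
Proof.
rewrite -(integral_natb _ both_above) /gagliardo.
rewrite (_ : half_space `*` half_space = [set z : V * V | both_above z]).
  by apply: eq_integral => z _; rewrite /energy_density /kern powRN.
by apply/seteqP; split=> z /andP.
Qed.

Lemma hardy_integralE u :
  hardy_integral s p u = (\int[mu]_y (hardy_integrand p s u y)%:E)%E.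
Proof.
by rewrite /hardy_integrand -(integral_natb _ (fun y : V => 0 < ht y)).
Qed.

Lemma weighted_integralE q b u : weighted_integral q b u =
  (\int[mu]_y ((0 < ht y)%R%:R * (`|u y| `^ q * ht y `^ (- (b * q))))%:E)%E.
Proof. by rewrite -(integral_natb _ (fun y : V => 0 < ht y)). Qed.

Lemma hardy_constE : hardy_const m.+1 s p =
  2 * kernel_const m p s * fine (hardy_ratio_integral p s).
Proof.
rewrite /hardy_const /hardy_ratio_integral -(integral_natb _
  (fun r : measurableTypeR R => (0 < (r : R)) && ((r : R) < 1))).
rewrite /kernel_const (_ : m.+1%:R - 1 = m%:R :> R); last by rewrite -natr1 addrK.
by rewrite !mulrA.
Qed.

(** Exchanging the points preserves the energy, and the two orderings of the heights are disjoint.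
    The factor 2 is the one in front of the Hardy constant. *)
Lemma ordered_le_gagliardo u : measurable_fun setT u ->
  (2%:E * \int[mu \x mu]_z ((ordered z)%:R * energy_density p s u z)%:E <=
   gagliardo s p u)%E.
Proof.
move=> mu_; rewrite gagliardoE.
have me := measurable_energy_density p s mu_.
have e0 := energy_density_ge0 p s u.
pose f z := (ordered z)%:R * energy_density p s u z.
have fz z : f z = (ordered z)%:R * energy_density p s u z by [].
have mo := measurable_ordered (R := R) (m := m).
have mf : measurable_fun setT f by rewrite /f; measurability.
have f0 z : 0 <= f z by rewrite mulr_ge0.
clearbody f; pose g z := f (z.2, z.1).
have mg : measurable_fun setT g.
  by apply: (measurable_compr mf); measurability.
have g0 z : 0 <= g z by exact: f0.
have fg : (\int[mu \x mu]_z (f z)%:E = \int[mu \x mu]_z (g z)%:E)%E.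
  have fE := tonelli_prod mu mu mf f0.
  have fC := tonelli_r mu mu mf f0.
  have gE := tonelli_prod mu mu mg g0.
  exact: (eq_trans fE (eq_trans fC (esym gE))).
have -> : (\int[mu \x mu]_z ((ordered z)%:R * energy_density p s u z)%:E =
    \int[mu \x mu]_z (f z)%:E)%E by apply: eq_integral => z _; rewrite fz.
rewrite -[2%R]/(1 + 1)%R EFinD ge0_muleDl// !mul1e {2}fg.
rewrite -(integral_rD _ mf f0 mg g0).
have mb := measurable_both_above.
apply: le_integral_r => [z|||z].
- by rewrite addr_ge0.
- by measurability.
- by measurability.
- rewrite /g !fz; have -> : energy_density p s u (z.2, z.1) = energy_density p s u z.
    by rewrite /energy_density/= distrC kernC.
  rewrite -mulrDl ler_wpM2r// /ordered /both_above/= -natrD ler_nat.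
  have [xy|yx|_] := ltgtP (ht z.1) (ht z.2); rewrite ?andbF ?andbT//.
    by case: (ltP 0 (ht z.1)) => // x0; rewrite (lt_trans x0 xy).
  by case: (ltP 0 (ht z.2)) => // y0; rewrite (lt_trans y0 yx).
Qed.

End half_space_integrals.

(** * The inequality when both weighted integrals are finite *)

Section finite_integrals.
Context (R : realType) (m : nat) (p q s : R).
Context (m0 : (0 < m)%N) (p2 : 2 <= p) (pq : p < q) (s0 : 0 < s).
Context (nsp : m.+1%:R * (1 - p / q) <= s * p).
Local Notation V := 'rV[R]_m.+1.
Local Notation mu := (@lebesgue_rV R m.+1).
Local Notation b := (m.+1%:R * (q^-1 - p^-1) + s).
Implicit Types (x y : V) (u : V -> R) (z : V * V).

Let p0 : 0 < p. Proof. by rewrite (lt_le_trans _ p2). Qed.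
Let q0 : 0 < q. Proof. exact: lt_trans pq. Qed.
Let p1 : 1 <= p. Proof. by rewrite (le_trans _ p2)// ler1n. Qed.

(** The origin of [b]: [al q - b q = m q / p - n], the exponent for which the weighted Sobolev
    inequality is scale invariant. *)
Lemma weighted_integral_ground u : weighted_integral q b u =
  (\int[mu]_x ((0 < ht x)%R%:R * (`|ground_quotient p s u x| `^ q *
    ht x `^ (m%:R * q / p - m.+1%:R)))%:E)%E.
Proof.
rewrite weighted_integralE; apply: eq_integral => x _; congr (_ %:E).
have [x0|] := ltP 0 (ht x); last by rewrite !mul0r.
rewrite /ground_quotient normrM (ger0_norm (powR_ge0 _ _)) powRM ?powR_ge0//
  -[(_ `^ _) `^ q]powRrM -[in RHS]mulrA.
rewrite -[ht x `^ _ * _]powRD ?(gt_eqF x0) ?implybT//; congr (_ * (_ * _ `^ _)).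
rewrite -natr1; field.
by rewrite !gt_eqF.
Qed.

Lemma hardy_sobolev_finite : exists2 sg : R, 0 < sg & forall u, measurable_fun setT u ->
  (hardy_integral s p u < +oo)%E -> (weighted_integral q b u < +oo)%E ->
  (sg%:E * weighted_integral q b u `^ (p / q) +
   (hardy_const m.+1 s p)%:E * hardy_integral s p u <= gagliardo s p u)%E.
Proof.
have [C C0 hC] := weighted_sobolev m0 p1 pq s0 nsp.
set lam := box_ratio m p q in hC.
have lam1 : 1 <= lam by exact: box_ratio_ge1.
have c0 : 0 < remainder_const p s lam by exact: remainder_const_gt0.
(* The 2 comes from the two orderings of a pair, and [C] from the weighted Sobolev inequality for
   the quotient. *)
exists (2 * (remainder_const p s lam / C)); first by rewrite mulr_gt0// divr_gt0.
move=> u mu_ Hu Wu; apply: le_trans (ordered_le_gagliardo p s mu_).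
have H0 : (0 <= hardy_integral s p u)%E.
  by apply: integral_ge0 => x _; rewrite lee_fin mulr_ge0 ?powR_ge0.
have := Hu; rewrite -ge0_fin_numE// => /fineK Hfin.
have hu : (\int[mu]_y (hardy_integrand p s u y)%:E = (fine (hardy_integral s p u))%:E)%E.
  by rewrite Hfin hardy_integralE.
have B := ground_state_bound p2 s0 lam1 mu_ hu.
rewrite weighted_integral_ground in Wu *.
have S := hC _ (measurable_ground_quotient p s mu_) Wu.
set W := (X in (_ * X + _ <= _)%E); rewrite -/W in S.
have {}B := lee_wpmul2l (lee_tofin (ler0n R 2)) B.
apply: (le_trans _ B).
have E0 : (0 <= local_energy p s lam (ground_quotient p s u))%E.
  do 2 (apply: integral_ge0 => ? _).
  by rewrite lee_fin local_density_ge0.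
have Cn0 : 0 < kernel_const m p s by exact: kernel_const_gt0.
have D0 : 0 <= fine (hardy_ratio_integral p s).
  by apply/fine_ge0/integral_ge0 => r _; rewrite lee_fin mulr_ge0 ?hardy_density_ge0.
have h0 : 0 <= fine (hardy_integral s p u) by exact: fine_ge0.
rewrite -Hfin hardy_constE -EFinM.
move: E0 c0 Cn0 D0 h0 S; clear -C0; set E := local_energy _ _ _ _.
set c := remainder_const p s lam; set K := kernel_const m p s.
set D := fine (hardy_ratio_integral p s); set h := fine (hardy_integral s p u).
clearbody E c K D h => E0 c0 K0 D0 h0 S; rewrite /=.
rewrite ge0_muleDr; last 2 first.
- by rewrite mule_ge0// lee_fin ltW.
- by rewrite lee_fin !mulr_ge0// ltW.
rewrite -EFinM; have -> : 2 * K * D * h = 2 * (K * D * h) by ring.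
apply: leeD; last exact: lexx.
rewrite muleA -EFinM.
have -> : 2 * c = 2 * (c / C) * C.
  by rewrite -mulrA divfK// gt_eqF.
rewrite [in leRHS](EFinM (2 * (c / C))) -muleA; apply: lee_wpmul2l => //.
by rewrite lee_fin mulr_ge0// divr_ge0// ltW.
Qed.
End finite_integrals.

(** * Test functions *)

Section continuous_rV.
Context (R : realType) (n : nat).
Implicit Types (x y : 'rV[R]_n) (U : set 'rV[R]_n).

Lemma measurable_in_box (l u : 'I_n -> R) : measurable_fun setT (in_box l u).
Proof. by apply: measurable_forall => i; measurability. Qed.

(** The measurable sets are generated by the coordinates, so an open set is written as a countable
    union of boxes with rational centres. *)
Lemma open_measurable_rV U : open U -> measurable U.
Proof.
move=> oU.
pose e_ (k : nat) : R := k.+1%:R^-1.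
pose B (c : 'rV[rat]_n * nat) : set 'rV[R]_n :=
  [set y | in_box (fun i => ratr (c.1 ord0 i) - e_ c.2)
                  (fun i => ratr (c.1 ord0 i) + e_ c.2) y].
rewrite (_ : U = \bigcup_c (if `[< B c `<=` U >] then B c else set0)).
  apply: countable_bigcupT_measurable => [|c]; first exact: countableP.
  case: ifP => _; last exact: measurable0.
  rewrite -[X in measurable X]setTI; apply: measurable_in_box => //.
apply/seteqP; split=> [x Ux|x [c _]]; last by case: ifP => // /asboolP; exact.
have /nbhs_ballP[e /= e0 eU] : nbhs x U by exact: open_nbhs_nbhs.
(* The rational centre is within [e_ k] of [x] and the box has half-width [e_ k]; below [e / 2], the
   two together stay in the ball of radius [e]. *)
have [k _ /(_ k (leqnn k)) ke] : \forall k \near \oo, k.+1%:R^-1 < e / 2.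
  exact: (near_infty_natSinv_lt (PosNum (divr_gt0 e0 (ltr0n R 2)))).
rewrite -/(e_ k) in ke.
have k0 : 0 < e_ k by rewrite /e_ invr_gt0.
have cE i : exists c : rat, ratr c \in `]x ord0 i - e_ k, x ord0 i + e_ k[.
  by apply: rat_in_itvoo; rewrite ltrD2l gtrN.
have [c hc] := choice cE.
clearbody e_.
exists (\row_i c i, k) => //; case: asboolP => [_|].
  apply/forallP => i; have := hc i; rewrite in_itv/= !mxE => /andP[h1 h2].
  by move: (ratr (c i)) h1 h2 => r h1 h2; apply/andP; split; lra.
case=> y /forallP yB; apply: eU; split=> // a i; rewrite (ord1 a) /ball/=.
have := hc i; have := yB i; rewrite /= !mxE in_itv/= ltr_norml.
by move: (ratr (c i)) => r /andP[h1 h2] /andP[h3 h4]; apply/andP; split; lra.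
Qed.

Lemma continuous_measurable_rV (f : 'rV[R]_n -> R) : continuous f ->
  measurable_fun setT f.
Proof.
move=> /continuousP cf;
  apply: (measurable_function.measurability _ (RGenOpens.measurableE R)).
move=> _ [_ [a [b ->] <-]]; rewrite setTI; apply: open_measurable_rV.
exact/cf/interval_open.
Qed.

End continuous_rV.

Section tame.
Context (R : realType) (m : nat).
Local Notation V := 'rV[R]_m.+1.
Local Notation mu := (@lebesgue_rV R m.+1).
Implicit Types (x y : V) (u v : V -> R).

(** Bounded measurable functions living in a bounded region away from the boundary: a class closed
    under differences, on which both weighted integrals are finite. *)
Definition tame u := measurable_fun setT u /\ exists2 B, 0 < B & forall x, u x != 0 ->
  [/\ `|u x| <= B, in_box (fun=> - B) (fun=> B) x & B^-1 <= ht x].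

Lemma test_function_tame u : test_function u -> tame u.
Proof.
move=> [/(_ [::]) [/= cu _] cK Kh]; split; first exact: continuous_measurable_rV.
set K := fun_support u in cK Kh.
have uK x : u x != 0 -> K x by move=> ux; apply: subset_closure.
have [[x0 Kx0]|/set0P/negP] := pselect (K !=set0); last first.
  move=> /negPn/eqP K0; exists 1 => // x /uK; by rewrite K0.
have K0 : K !=set0 by exists x0.
have [M [_ hM]] := compact_bounded cK.
have cn : {within K, continuous (fun x => `|u x|)}.
  by apply: continuous_subspaceT => x; apply: (continuous_comp (cu x));
    exact: norm_continuous.
have ch : {within K, continuous (fun x : V => ht x)}.
  by apply: continuous_subspaceT => x; exact: coord_continuous.
have [a _ ha] := EVT_max_rV K0 cK cn.
have [b bK hb] := EVT_min_rV K0 cK ch.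
have b0 : 0 < ht b by apply: (Kh b); exact/set_mem.
(* The sum of the maximum of [|u|], the inverse of the least height and a strict bound on the
   coordinates over the support, so that it dominates each of them. *)
exists (`|u a| + (ht b)^-1 + (`|M| + 2)).
  by rewrite addr_gt0// ?ltr_wpDl// invr_gt0.
move=> x /uK Kx; have xK : x \in K by exact/mem_set.
have ib : 0 < (ht b)^-1 by rewrite invr_gt0.
have M0 := normr_ge0 M; have u0 := normr_ge0 (u a).
split.
- by apply: le_trans (ha _ xK) _; lra.
- have M1 : M < `|M| + 1 by rewrite (le_lt_trans (ler_norm _))// ltrDl.
  have xM : `|x| <= `|M| + 1 by exact: (hM _ M1 _ Kx).
  apply/forallP => i; rewrite -ltr_norml.
  have xi : `|x ord0 i| <= `|x|.
    rewrite {2}/Num.norm/= mx_normrE.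
    exact: (le_bigmax _ (fun ij => `|x ij.1 ij.2|) (ord0, i)).
  by apply: le_lt_trans xi _; apply: le_lt_trans xM _; lra.
- rewrite -(invrK (ht x)) lef_pV2 ?posrE ?invr_gt0//; last 2 first.
  + lra.
  + by rewrite (lt_le_trans b0)// hb.
  apply: (@le_trans _ _ (ht b)^-1); last lra.
  by rewrite lef_pV2 ?posrE// ?hb// (lt_le_trans b0)// hb.
Qed.
End tame.

Section tame_properties.
Context (R : realType) (m : nat).
Local Notation V := 'rV[R]_m.+1.
Local Notation mu := (@lebesgue_rV R m.+1).
Implicit Types (x y : V) (u v : V -> R).

Lemma tame_sub u v : tame u -> tame v -> tame (u \- v).
Proof.
move=> [mu_ [A A0 uA]] [mv [B B0 vB]]; split; first exact: measurable_funB.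
have AB : 0 < A + B by exact: addr_gt0.
have box C x : 0 < C -> C <= A + B -> in_box (fun=> - C) (fun=> C) x ->
    in_box (fun=> - (A + B)) (fun=> A + B) x.
  move=> C0 CAB /forallP xC; apply/forallP => i; have /andP[h1 h2] := xC i.
  by apply/andP; split; lra.
have inv C x : 0 < C -> C <= A + B -> C^-1 <= ht x -> (A + B)^-1 <= ht x.
  by move=> C0 CAB; apply: le_trans; rewrite lef_pV2.
have nu x : `|u x| <= A.
  by have [->|/uA[]//] := eqVneq (u x) 0; rewrite normr0 ltW.
have nv x : `|v x| <= B.
  by have [->|/vB[]//] := eqVneq (v x) 0; rewrite normr0 ltW.
exists (A + B) => // x /= uv; split.
- by rewrite (le_trans (ler_normB _ _))// lerD.
- have [u0|/uA[_ h _]] := eqVneq (u x) 0; last by apply: (box A) => //; rewrite lerDl ltW.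
  have /vB[_ h _] : v x != 0 by apply: contra_neq uv => ->; rewrite u0 subrr.
  by apply: (box B) => //; rewrite lerDr ltW.
- have [u0|/uA[_ _ h]] := eqVneq (u x) 0; last by apply: (inv A) => //; rewrite lerDl ltW.
  have /vB[_ _ h] : v x != 0 by apply: contra_neq uv => ->; rewrite u0 subrr.
  by apply: (inv B) => //; rewrite lerDr ltW.
Qed.

(** On the support the height lies between [1/B] and [B], so its power [c] is at most [B^|c|] for
    either sign of [c]. *)
Lemma tame_integral_lty u (a c : R) : 0 < a -> tame u ->
  (\int[mu]_x ((0 < ht x)%R%:R * (`|u x| `^ a * ht x `^ c))%:E < +oo)%E.
Proof.
move=> a0 [mu_ [B B0 uB]].
pose M := B `^ a * B `^ `|c|.
have M0 : 0 <= M by rewrite mulr_ge0 ?powR_ge0.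
pose b := in_box (n := m.+1) (fun=> - B) (fun=> B).
have mb : measurable_fun setT b by exact: measurable_in_box.
apply: (@le_lt_trans _ _ (\int[mu]_x (M * (b x)%:R)%:E)%E); last first.
  have mbn : measurable_fun setT (fun x => (b x)%:R : R) by measurability.
  rewrite (integral_rZl _ M0 mbn (fun=> ler0n R _)).
  rewrite integral_box ?ltry// => i; lra.
apply: le_integral_r.
- by move=> x; rewrite !mulr_ge0 ?powR_ge0.
- by measurability.
- by measurability.
move=> x; have [->|/uB[ux bx hx]] := eqVneq (u x) 0.
  by rewrite normr0 powR0 ?gt_eqF// mul0r mulr0 mulr_ge0.
have x0 : 0 < ht x by rewrite (lt_le_trans _ hx)// invr_gt0.
rewrite x0 mul1r /b bx mulr1 /M.
have /forallP/(_ ord_max)/andP[_ /ltW xB] := bx.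
apply: ler_pM; rewrite ?powR_ge0//.
  by apply: ge0_ler_powR; rewrite ?nnegrE// ltW.
have [c0|c0] := leP 0 c.
  by rewrite ger0_norm// ge0_ler_powR ?nnegrE// ltW.
rewrite ltr0_norm// -[c in leLHS]opprK powRN -powR_inv1 ?powR_ge0// -powRrM.
rewrite mulrC powRrM powR_inv1 ?(ltW x0)//.
rewrite ge0_ler_powR ?nnegrE ?oppr_ge0 ?invr_ge0 ?(ltW c0) ?(ltW x0) ?(ltW B0)//.
by rewrite -[B]invrK lef_pV2 ?posrE// invr_gt0.
Qed.

End tame_properties.

Lemma product_ae1 d1 d2 (T1 : measurableType d1) (T2 : measurableType d2)
  (R : realType) (m1 : {sigma_finite_measure set T1 -> \bar R})
  (m2 : {sigma_finite_measure set T2 -> \bar R}) (P : T1 -> Prop) :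
  {ae m1, forall x, P x} -> {ae (m1 \x m2)%E, forall z, P z.1}.
Proof.
move=> [N [mN N0 PN]]; exists (N `*` setT); split.
- exact: measurableX.
(* The other factor may have infinite measure; the product is 0 by the convention [0 * oo = 0]. *)
- rewrite product_measure1E//; apply/eqP; rewrite mule_eq0; apply/orP; left.
  exact/eqP/N0.
- by move=> z /= Pz; split => //; apply: PN.
Qed.

Lemma product_ae2 d1 d2 (T1 : measurableType d1) (T2 : measurableType d2)
  (R : realType) (m1 : {sigma_finite_measure set T1 -> \bar R})
  (m2 : {sigma_finite_measure set T2 -> \bar R}) (P : T2 -> Prop) :
  {ae m2, forall x, P x} -> {ae (m1 \x m2)%E, forall z, P z.2}.
Proof.
move=> [N [mN N0 PN]]; exists (setT `*` N); split.
- exact: measurableX.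
- rewrite product_measure1E//; apply/eqP; rewrite mule_eq0; apply/orP; right.
  exact/eqP/N0.
- by move=> z /= Pz; split => //; apply: PN.
Qed.

(** * Passage to the limit *)

Lemma cvg_norm_powR (R : realType) (a : nat -> R) (l p : R) : 0 < p ->
  a k @[k --> \oo] --> l -> `|a k| `^ p @[k --> \oo] --> `|l| `^ p.
Proof.
(* A zero limit is set apart, since elsewhere the power is treated as [exp (p ln)]. *)
move=> p0 al; have [l0|l0] := eqVneq l 0.
  rewrite l0 normr0 powR0 ?gt_eqF//; apply/cvgr0Pnorm_lt => e e0.
  have e1 : 0 < e `^ p^-1 by exact: powR_gt0.
  near=> k; rewrite ger0_norm ?powR_ge0//.
  have -> : e = (e `^ p^-1) `^ p by rewrite -powRrM mulVf ?gt_eqF// powRr1// ltW.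
  rewrite gt0_ltr_powR ?nnegrE ?(ltW e1)//.
  by near: k; move: al; rewrite l0 => /cvgr0Pnorm_lt; apply.
have nl : `|a k| @[k --> \oo] --> `|l| by exact: cvg_norm.
have l1 : 0 < `|l| by rewrite normr_gt0.
apply: (@cvg_trans _ (expR (p * ln `|a k|) @[k --> \oo])).
  apply: near_eq_cvg; near=> k; rewrite /powR gt_eqF//.
  by near: k; exact: (cvgr_gt _ nl).
rewrite /powR gt_eqF//.
have lnl : ln `|a k| @[k --> \oo] --> ln `|l|.
  exact: (cvg_comp (fun k => `|a k|) (@ln R) nl (continuous_ln l1)).
have plnl : p * ln `|a k| @[k --> \oo] --> p * ln `|l| by exact: cvgMr.
exact: (@continuous_cvg _ _ _ _ _ _ (@expR R) _ (@continuous_expR R _) plnl).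
Unshelve. all: by end_near. Qed.

Section weighted_Lp.
Context d (T : measurableType d) (R : realType) (mu : {measure set T -> \bar R}).
Context (p : R) (p1 : 1 < p) (w : T -> R).
Context (mw : measurable_fun setT w) (w0 : forall x, 0 <= w x).
Implicit Types (a b : T -> R).

(** The same limit argument serves twice: for the energy, over pairs of points and with differences
    as functions, and for the Hardy term. *)
Definition weighted_Lp a : \bar R := (\int[mu]_x (`|a x| `^ p * w x)%:E)%E.

Lemma weighted_Lp_ge0 a : (0 <= weighted_Lp a)%E.
Proof. by apply: integral_ge0 => x _; rewrite lee_fin mulr_ge0 ?powR_ge0. Qed.

Lemma weighted_LpC a b : weighted_Lp (a \- b) = weighted_Lp (b \- a)%R.
Proof. by apply: eq_integral => x _; rewrite /= distrC. Qed.

Lemma weighted_Lp_split a b t : measurable_fun setT a -> measurable_fun setT b ->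
  0 < t < 1 ->
  (((1 - t) `^ (p - 1))%:E * weighted_Lp b <=
   weighted_Lp a + (((1 - t) / t) `^ (p - 1))%:E * weighted_Lp (b \- a)%R)%E.
Proof.
move=> ma mb t01; have mba : measurable_fun setT (b \- a) by exact: measurable_funB.
pose g (f : T -> R) x := `|f x| `^ p * w x.
have mg f : measurable_fun setT f -> measurable_fun setT (g f).
  by move=> mf; rewrite /g; measurability.
have g0 f x : 0 <= g f x by rewrite mulr_ge0 ?powR_ge0.
have gE f : weighted_Lp f = (\int[mu]_x (g f x)%:E)%E by [].
rewrite !gE -(integral_rZl _ (powR_ge0 _ _) (mg _ mb) (g0 b)).
rewrite -(integral_rZl _ (powR_ge0 _ _) (mg _ mba) (g0 _)).
rewrite -(integral_rD _ (mg _ ma) (g0 a)); last 2 first.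
- by have := mg _ mba; measurability.
- by move=> x; rewrite mulr_ge0 ?powR_ge0.
rewrite /g.
apply: le_integral_r.
- by move=> x; rewrite !mulr_ge0 ?powR_ge0.
- by measurability.
- by measurability.
- move=> x; rewrite !mulrA -mulrDl ler_wpM2r//.
  exact: (powR_norm_split (b x) (a x) (ltW p1) t01).
Qed.

Lemma weighted_Lp_perturb (X e : R) : 0 <= X -> 0 < e -> exists2 dl : R, 0 < dl &
  forall a b, measurable_fun setT a -> measurable_fun setT b ->
  (weighted_Lp a <= X%:E)%E -> (weighted_Lp (b \- a)%R <= dl%:E)%E ->
  (weighted_Lp b <= weighted_Lp a + e%:E)%E.
Proof.
move=> X0 e0; have p10 : 0 < p - 1 by rewrite subr_gt0.
(* In [weighted_Lp_split], [t] is chosen with [(1 - t)^(p-1) = 1 / (1 + eta)]. Then [eta] costs at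
   most [e / 2] on integrals up to [X], and the bound on the difference is chosen to cost another
   [e / 2]. *)
pose eta := e / (2 * (X + 1)).
have eta0 : 0 < eta by rewrite divr_gt0// mulr_gt0// ltr_wpDl.
have eta1 : 1 < 1 + eta by rewrite ltrDl.
pose t := 1 - (1 + eta) `^ (- (p - 1)^-1).
have t01 : 0 < t < 1.
  rewrite /t subr_gt0 gtrBl powR_gt0 ?(lt_trans _ eta1)// andbT.
  rewrite powRN invf_lt1 ?powR_gt0 ?(lt_trans _ eta1)//.
  have := gt0_ltr_powR (r := (p - 1)^-1); rewrite invr_gt0 => /(_ p10 1 (1 + eta)).
  by rewrite powR1; apply; rewrite ?nnegrE ?ler01// ltW// (lt_trans _ eta1).
have tE : (1 - t) `^ (p - 1) = (1 + eta)^-1.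
  rewrite /t opprB addrC subrK -powRrM mulNr mulVf ?gt_eqF// powR_inv1//.
  by rewrite ltW// (lt_trans _ eta1).
pose c := ((1 - t) / t) `^ (p - 1).
have c0 : 0 <= c by exact: powR_ge0.
have h1 : 0 < 1 + eta by rewrite (lt_trans _ eta1).
have dl0 : 0 < e / (2 * (1 + eta) * (c + 1)) by rewrite divr_gt0// mulr_gt0// ?mulr_gt0//
  ltr_wpDl.
exists (e / (2 * (1 + eta) * (c + 1))) => // a b ma mb aX.
set dl := e / _ in dl0 *; move=> bdl.
have S := weighted_Lp_split ma mb t01; rewrite tE -/c in S.
have fin f (Y : R) : (weighted_Lp f <= Y%:E)%E ->
  exists2 y : R, 0 <= y & weighted_Lp f = y%:E.
  have := weighted_Lp_ge0 f; case: (weighted_Lp f) => // y y0 _; by exists y.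
have [x x0 xE] := fin _ _ aX; have [z z0 zE] := fin _ _ bdl.
rewrite xE lee_fin in aX; rewrite zE lee_fin in bdl; rewrite xE zE in S *.
rewrite lee_pdivrMl// in S; apply: le_trans S _.
rewrite -(EFinM c z) -!EFinD -EFinM lee_fin.
have hz : (1 + eta) * (c * z) <= e / 2.
  have cdl : (1 + eta) * ((c + 1) * dl) = e / 2.
    by rewrite /dl; field; rewrite !gt_eqF// ltr_wpDl.
  rewrite -cdl ler_wpM2l ?(ltW h1)//; apply: ler_pM => //; lra.
have hx : eta * x <= e / 2.
  have etaX : eta * (X + 1) = e / 2 by rewrite /eta; field; rewrite gt_eqF// ltr_wpDl.
  by rewrite -etaX ler_wpM2l ?(ltW eta0)//; lra.
rewrite mulrDr mulrDl mul1r; lra.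
Qed.

Section limit.
Context (f : nat -> T -> R) (a : T -> R).
Context (mf : forall k, measurable_fun setT (f k)) (ma : measurable_fun setT a).
Context (fa : {ae mu, forall x, w x != 0 -> f k x @[k --> \oo] --> a x}).
Context (fC : forall e : R, 0 < e -> exists N, forall j k, (N <= j)%N -> (N <= k)%N ->
  (weighted_Lp (f j \- f k)%R <= e%:E)%E).

Let p0 : 0 < p. Proof. by rewrite (lt_trans _ p1). Qed.

(** Fatou in the second index of the Cauchy condition. *)
Lemma weighted_Lp_cvg (e : R) : 0 < e -> exists N, forall j, (N <= j)%N ->
  (weighted_Lp (f j \- a)%R <= e%:E)%E.
Proof.
move=> e0; have [N hN] := fC e0; exists N => j Nj.
apply: (@integral_le_of_ae_cvg _ _ R mu (fun k x => `|f j x - f (N + k)%N x| `^ p * w x)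
  (fun x => `|f j x - a x| `^ p * w x)).
- by move=> k; have mk := mf (N + k)%N; have mj := mf j; measurability.
- by move=> k x; rewrite mulr_ge0 ?powR_ge0.
- by have mj := mf j; measurability.
- by move=> x; rewrite mulr_ge0 ?powR_ge0.
- apply: filterS fa => x fx; have [->|/fx {}fx] := eqVneq (w x) 0.
    by rewrite mulr0; under eq_fun do rewrite mulr0; exact: cvg_cst.
  apply: cvgMl; apply: cvg_norm_powR => //; apply: cvgB; first exact: cvg_cst.
  under eq_fun do rewrite addnC.
  by move: fx; rewrite -(cvg_shiftn N).
- by move=> k; apply: hN => //; exact: leq_addr.
Qed.

Lemma weighted_Lp_limit_lty : (forall k, (weighted_Lp (f k) < +oo)%E) ->
  (weighted_Lp a < +oo)%E.
Proof.
move=> ff; pose X k := fine (weighted_Lp (f k)).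
have fX k : weighted_Lp (f k) = (X k)%:E.
  by rewrite fineK// ge0_fin_numE ?weighted_Lp_ge0.
have [N hN] := weighted_Lp_cvg ltr01.
have N1 := hN N (leqnn N).
have t2 : 0 < (2^-1 : R) < 1 by lra.
have := weighted_Lp_split (mf N) ma t2.
rewrite weighted_LpC fX => S.
have c0 : 0 < (1 - 2^-1 : R) `^ (p - 1) by apply: powR_gt0; lra.
have : (((1 - 2^-1) `^ (p - 1))%:E * weighted_Lp a < +oo)%E.
  apply: (le_lt_trans S); rewrite lte_add_pinfty ?ltry//.
  by apply: lte_mul_pinfty => //; rewrite ?lee_fin ?powR_ge0// (le_lt_trans N1)// ltry.
have := weighted_Lp_ge0 a; case: (weighted_Lp a) => // [r _ _|_]; first exact: ltry.
by rewrite gt0_muley.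
Qed.

Lemma weighted_Lp_approx (e : R) : (weighted_Lp a < +oo)%E -> 0 < e ->
  exists N, forall j, (N <= j)%N -> (weighted_Lp (f j) <= weighted_Lp a + e%:E)%E /\
    (weighted_Lp a <= weighted_Lp (f j) + e%:E)%E.
Proof.
move=> aoo e0; pose X := fine (weighted_Lp a).
have X0 : 0 <= X by rewrite fine_ge0 ?weighted_Lp_ge0.
have aX : weighted_Lp a = X%:E by rewrite fineK// ge0_fin_numE ?weighted_Lp_ge0.
(* The second comparison starts from [f j], which the first one bounds by [X + e]. *)
have Xe : 0 <= X + e by rewrite addr_ge0// ltW.
have [d1 d10 h1] := weighted_Lp_perturb X0 e0.
have [d2 d20 h2] := weighted_Lp_perturb Xe e0.
have [N1 hN1] := weighted_Lp_cvg d10.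
have [N2 hN2] := weighted_Lp_cvg d20.
exists (maxn N1 N2) => j; rewrite geq_max => /andP[j1 j2].
have le1 : (weighted_Lp (f j) <= weighted_Lp a + e%:E)%E.
  by apply: (h1 _ _ ma (mf j)); [rewrite aX lexx|exact: hN1].
split; first exact: le1.
apply: (h2 _ _ (mf j) ma); first by rewrite EFinD -aX; exact: le1.
by rewrite weighted_LpC; exact: hN2.
Qed.

End limit.
End weighted_Lp.

Section summable.
Context d (T : measurableType d) (R : realType) (mu : {measure set T -> \bar R}).
Context (f : nat -> T -> R) (mf : forall k, measurable_fun setT (f k)).
Context (f0 : forall k x, 0 <= f k x).

(** The integrals have sum at most 1, so the series of the functions is finite almost everywhere and
    its terms tend to 0 there. *)
Lemma ae_cvg0_of_summable :
  (forall k, (\int[mu]_x (f k x)%:E <= (1 / (2 ^ k.+1)%:R)%:E)%E) ->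
  {ae mu, forall x, f k x @[k --> \oo] --> (0 : R)}.
Proof.
move=> fk; pose S x := (\sum_(k <oo) (f k x)%:E)%E.
have f0E k x : (0 <= (f k x)%:E)%E by rewrite lee_fin.
have mfE k : measurable_fun setT (fun x => (f k x)%:E) by exact/measurable_EFinP.
have S0 x : (0 <= S x)%E by exact: nneseries_ge0.
have mS : measurable_fun setT S.
  by apply: (@ge0_emeasurable_sum _ _ _ setT (fun k x => (f k x)%:E) xpredT).
have iS : mu.-integrable setT S.
  apply/integrableP; split=> //.
  rewrite (eq_integral S); last by move=> x _; rewrite gee0_abs.
  rewrite integral_nneseries//; apply: (@le_lt_trans _ _ 1%:E); last exact: ltry.
  apply: le_trans (epsilon_trick0 xpredT (@ler01 R)).
  apply: lee_nneseries => [k _ _|k _]; last exact: fk.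
  exact: integral_ge0.
have := integrable_ae measurableT iS; apply: filterS => x /(_ I) Sx.
apply: cvg_series_cvg_0; apply: nondecreasing_is_cvgn.
  exact: nondecreasing_series.
exists (fine (S x)) => _ [k _ <-]; rewrite -lee_fin fineK// /series/= -sumEFin.
exact: nneseries_lim_ge.
Qed.

End summable.

Section subsequence_extraction.
Context d (T : measurableType d) (R : realType) (mu : {measure set T -> \bar R}).
Context (f : nat -> T -> R) (mf : forall k, measurable_fun setT (f k)).
Context (f0 : forall k x, 0 <= f k x).

(** The property [k <= j k] is what carries Cauchy bounds over to the extracted sequence. *)
Lemma ae_cvg0_subsequence :
  (forall e : R, 0 < e -> exists N, forall k, (N <= k)%N ->
    (\int[mu]_x (f k x)%:E <= e%:E)%E) ->
  exists2 j : nat -> nat, (forall k, (k <= j k)%N) &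
    {ae mu, forall x, f (j k) x @[k --> \oo] --> (0 : R)}.
Proof.
move=> fc; have jE k : exists j, (k <= j)%N /\
    (\int[mu]_x (f j x)%:E <= (1 / (2 ^ k.+1)%:R)%:E)%E.
  have e0 : 0 < 1 / (2 ^ k.+1)%:R :> R by rewrite divr_gt0// ltr0n expn_gt0.
  have [N hN] := fc _ e0.
  exists (maxn k N); split; first exact: leq_maxl.
  by apply: hN; exact: leq_maxr.
have [j hj] := choice jE; exists j => [k|]; first by have [] := hj k.
apply: ae_cvg0_of_summable => [k|k x|k].
- exact: mf.
- exact: f0.
- by have [] := hj k.
Qed.

End subsequence_extraction.

Lemma powR_divK (R : realType) (a p q : R) : 0 <= a -> 0 < p -> 0 < q ->
  (a `^ (p / q)) `^ (q / p) = a.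
Proof.
move=> a0 p0 q0; rewrite -powRrM (_ : p / q * (q / p) = 1) ?powRr1//.
by field; rewrite !gt_eqF.
Qed.

Section hardy_sobolev_limit.
Context (R : realType) (m : nat) (p q s sg : R).
Context (p2 : 2 <= p) (q0 : 0 < q) (s0 : 0 < s) (sg0 : 0 < sg).
Local Notation V := 'rV[R]_m.+1.
Local Notation mu := (@lebesgue_rV R m.+1).
Local Notation b := (m.+1%:R * (q^-1 - p^-1) + s).
Local Notation hc := (hardy_const m.+1 s p).
Local Notation W := (weighted_integral q b).
Implicit Types (x y : V) (u v : V -> R) (z : V * V).
Context (nice : forall v, tame v ->
  (sg%:E * W v `^ (p / q) + hc%:E * hardy_integral s p v <= gagliardo s p v)%E).

Let p0 : 0 < p. Proof. by rewrite (lt_le_trans _ p2). Qed.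
Let p1 : 1 < p. Proof. by rewrite (lt_le_trans _ p2)// ltr1n. Qed.

Lemma hardy_const_ge0 : 0 <= hc.
Proof.
rewrite hardy_constE; apply: mulr_ge0.
  by apply: mulr_ge0 => //; apply/ltW/kernel_const_gt0.
apply: fine_ge0; apply: integral_ge0 => r _.
by rewrite lee_fin mulr_ge0 ?hardy_density_ge0.
Qed.

Definition pair_diff u z : R := u z.1 - u z.2.
Definition pair_weight z : R := (both_above z)%:R * kern p s z.1 z.2.
(** The constant is part of the weight: for [s p = 1] it is 0, and the weighted integral vanishes
    even where the Hardy integral of the limit is infinite, in accordance with [0 * oo = 0]. *)
Definition hardy_weight x : R := hc * ((0 < ht x)%R%:R * ht x `^ (- (s * p))).

Lemma pair_weight_ge0 z : 0 <= pair_weight z.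
Proof. by rewrite mulr_ge0 ?kern_ge0. Qed.

Lemma hardy_weight_ge0 x : 0 <= hardy_weight x.
Proof. by apply: mulr_ge0; [exact: hardy_const_ge0|rewrite mulr_ge0 ?powR_ge0]. Qed.

Lemma measurable_pair_weight : measurable_fun setT pair_weight.
Proof. by have mb := measurable_both_above (R := R) (m := m); rewrite /pair_weight /kern;
  measurability. Qed.

Lemma measurable_hardy_weight : measurable_fun setT hardy_weight.
Proof. by rewrite /hardy_weight; measurability. Qed.

Lemma gagliardo_Lp u :
  gagliardo s p u = weighted_Lp (mu \x mu)%E p pair_weight (pair_diff u).
Proof.
rewrite gagliardoE; apply: eq_integral => z _.
by rewrite /energy_density /pair_weight /pair_diff mulrCA.
Qed.

Lemma hardy_Lp u : measurable_fun setT u ->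
  (hc%:E * hardy_integral s p u)%E = weighted_Lp mu p hardy_weight u.
Proof.
move=> mu_; rewrite hardy_integralE -(integral_rZl _ hardy_const_ge0
  (measurable_hardy_integrand p s mu_) (hardy_integrand_ge0 p s u)).
apply: eq_integral => x _; congr (_%:E).
rewrite /hardy_integrand /hardy_weight; ring.
Qed.

Section fixed.
Context (u : V -> R) (mu_ : measurable_fun setT u).
Context (w : nat -> V -> R) (tw : forall k, tame (w k)).
Context (wC : forall e : R, 0 < e -> exists N, forall j k, (N <= j)%N -> (N <= k)%N ->
  (gagliardo s p (w j \- w k)%R <= e%:E)%E).
Context (wu : {ae mu, forall x, 0 < ht x -> w k x @[k --> \oo] --> u x}).

Let mw k : measurable_fun setT (w k). Proof. by case: (tw k). Qed.
Let mpd v : measurable_fun setT v -> measurable_fun setT (pair_diff v).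
Proof. by move=> mv; rewrite /pair_diff; measurability. Qed.

(** Dropping the [L^q] term gives the plain Hardy inequality; applied to differences [w j - w k], it
    transfers the Cauchy property from the energy to the Hardy term. *)
Let hardy_le v : tame v -> (hc%:E * hardy_integral s p v <= gagliardo s p v)%E.
Proof.
move=> tv; apply: le_trans (nice tv); rewrite leeDr//.
by apply: mule_ge0; [rewrite lee_fin; exact: ltW|exact: poweR_ge0].
Qed.

Let Hwu : {ae mu, forall x, hardy_weight x != 0 -> w k x @[k --> \oo] --> u x}.
Proof.
apply: filterS wu => x wx; rewrite /hardy_weight.
by case: ltP => [x0 _|_]; [exact: wx|rewrite mul0r mulr0 eqxx].
Qed.

Let Gwu : {ae (mu \x mu)%E, forall z, pair_weight z != 0 ->
  pair_diff (w k) z @[k --> \oo] --> pair_diff u z}.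
Proof.
have ae1 := product_ae1 mu wu; have ae2 := product_ae2 mu wu.
apply: filterS2 ae1 ae2 => z h1 h2; rewrite /pair_weight /both_above.
case: (ltP 0 (ht z.1)) => [z1|_]; last by rewrite mul0r eqxx.
case: (ltP 0 (ht z.2)) => [z2 _|_]; last by rewrite mul0r eqxx.
by apply: cvgB; [exact: h1|exact: h2].
Qed.

Let GC (e : R) : 0 < e -> exists N, forall j k, (N <= j)%N -> (N <= k)%N ->
  (weighted_Lp (mu \x mu)%E p pair_weight (pair_diff (w j) \- pair_diff (w k))%R <= e%:E)%E.
Proof.
move=> e0; have [N hN] := wC e0; exists N => j k Nj Nk.
apply: le_trans (hN j k Nj Nk); rewrite gagliardo_Lp.
rewrite (_ : pair_diff (w j) \- pair_diff (w k) = pair_diff (w j \- w k)) ?lexx//.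
by apply/funext => z; rewrite /pair_diff/=; ring.
Qed.

Let HC (e : R) : 0 < e -> exists N, forall j k, (N <= j)%N -> (N <= k)%N ->
  (weighted_Lp mu p hardy_weight (w j \- w k)%R <= e%:E)%E.
Proof.
move=> e0; have [N hN] := wC e0; exists N => j k Nj Nk.
apply: le_trans (hN j k Nj Nk); rewrite -hardy_Lp; last exact: measurable_funB.
by apply: hardy_le; exact: tame_sub.
Qed.

Let Hw k : (weighted_Lp mu p hardy_weight (w k) < +oo)%E.
Proof.
rewrite -hardy_Lp// hardy_integralE; apply: lte_mul_pinfty => //.
  by rewrite lee_fin hardy_const_ge0.
exact: (tame_integral_lty _ p0 (tw k)).
Qed.

Let Hu : (weighted_Lp mu p hardy_weight u < +oo)%E.
Proof.
exact: (weighted_Lp_limit_lty p1 measurable_hardy_weight hardy_weight_ge0 mw mu_ Hwu HC Hw).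
Qed.

Let W_le (N : nat) (c : R) : (forall j, (N <= j)%N -> (W (w j) <= c%:E)%E) ->
  (W u <= c%:E)%E.
Proof.
move=> h; rewrite weighted_integralE.
apply: (@integral_le_of_ae_cvg _ _ R mu (fun k x => (0 < ht x)%R%:R *
    (`|w (N + k)%N x| `^ q * ht x `^ (- (b * q))))
   (fun x => (0 < ht x)%R%:R * (`|u x| `^ q * ht x `^ (- (b * q))))).
- by move=> k; have mk := mw (N + k)%N; measurability.
- by move=> k x; rewrite !mulr_ge0 ?powR_ge0.
- by measurability.
- by move=> x; rewrite !mulr_ge0 ?powR_ge0.
- apply: filterS wu => x; case: (ltP 0 (ht x)) => [_ /(_ isT) wx|_ _]; last first.
    by rewrite mul0r; under eq_fun do rewrite mul0r; exact: cvg_cst.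
  apply: cvgMr; apply: cvgMl; apply: cvg_norm_powR => //.
  under eq_fun do rewrite addnC.
  by move: wx; rewrite -(cvg_shiftn N).
- by move=> k; rewrite -weighted_integralE; apply: h; exact: leq_addr.
Qed.

Lemma hardy_sobolev_limit :
  (sg%:E * W u `^ (p / q) <= gagliardo s p u - hc%:E * hardy_integral s p u)%E.
Proof.
have G0 : (0 <= gagliardo s p u)%E.
  by rewrite gagliardo_Lp; apply: weighted_Lp_ge0; exact: pair_weight_ge0.
have H0 := weighted_Lp_ge0 mu p hardy_weight_ge0.
rewrite hardy_Lp//; set H := weighted_Lp mu p hardy_weight u.
have Hfin : H \is a fin_num by rewrite ge0_fin_numE// H0.
have [G|] := boolP (gagliardo s p u \is a fin_num); last first.
  rewrite ge0_fin_numE// -leNgt leye_eq => /eqP ->.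
  by rewrite addye ?leey// -(fineK Hfin).
have Goo : (gagliardo s p u < +oo)%E by rewrite -ge0_fin_numE.
pose g := fine (gagliardo s p u); pose h := fine H.
have gE : gagliardo s p u = g%:E by rewrite fineK.
have hE : H = h%:E by rewrite fineK.
apply/lee_addgt0Pr => e e0.
have e2 : 0 < e / 2 by rewrite divr_gt0.
have GLoo : (weighted_Lp (mu \x mu)%E p pair_weight (pair_diff u) < +oo)%E.
  by rewrite -gagliardo_Lp.
have [N1 h1] := weighted_Lp_approx p1 measurable_pair_weight pair_weight_ge0
  (fun k => mpd (mw k)) (mpd mu_) Gwu GC GLoo e2.
have [N2 h2] := weighted_Lp_approx p1 measurable_hardy_weight hardy_weight_ge0
  mw mu_ Hwu HC Hu e2.
(* Along the sequence the energy is at most [g + e/2] and the Hardy term at least [h - e/2]. *)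
pose kap := g - h + e.
have W0 v : (0 <= W v)%E.
  by apply: integral_ge0 => x _; rewrite lee_fin mulr_ge0 ?powR_ge0.
have Wj j : W (w j) = (fine (W (w j)))%:E.
  rewrite fineK// ge0_fin_numE ?W0// weighted_integralE.
  exact: (tame_integral_lty _ q0 (tw j)).
have key j : (maxn N1 N2 <= j)%N -> sg * fine (W (w j)) `^ (p / q) <= kap.
  rewrite geq_max => /andP[j1 j2]; have nj := nice (tw j).
  have [_ Hj] := h2 j j2; have [Gj _] := h1 j j1.
  rewrite hardy_Lp// gagliardo_Lp Wj poweR_EFin in nj.
  have {Gj}nj := le_trans nj Gj; rewrite -gagliardo_Lp gE in nj.
  rewrite -/H hE in Hj.
  have yE : weighted_Lp mu p hardy_weight (w j) = (fine (weighted_Lp mu p hardy_weight (w j)))%:E.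
    rewrite fineK; first reflexivity.
    by rewrite ge0_fin_numE; [exact: Hw|exact: H0].
  rewrite yE in nj Hj; move: nj Hj; rewrite -EFinM -!EFinD !lee_fin => nj Hj.
  rewrite /kap; lra.
have kap0 : 0 <= kap.
  apply: le_trans (key _ (leqnn _)); apply: mulr_ge0; [exact: ltW|exact: powR_ge0].
have pq0 : 0 < p / q by rewrite divr_gt0.
have c0 : 0 <= kap / sg by rewrite divr_ge0// ltW.
(* Fatou concerns the integral itself, so the bound on its power [p/q] is inverted before the limit
   and restored after it. *)
have Wu : (W u <= ((kap / sg) `^ (q / p))%:E)%E.
  apply: (W_le (N := maxn N1 N2)) => j Nj; rewrite Wj lee_fin.
  have wj0 : 0 <= fine (W (w j)) by exact: fine_ge0.
  rewrite -[leLHS](powR_divK wj0 p0 q0).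
  apply: ge0_ler_powR; rewrite ?nnegrE ?powR_ge0//; first by rewrite divr_ge0// ltW.
  by rewrite ler_pdivlMr// mulrC; exact: key.
have WuE : W u = (fine (W u))%:E.
  by rewrite fineK// ge0_fin_numE// (le_lt_trans Wu)// ltry.
have wu0 : 0 <= fine (W u) by exact: fine_ge0.
rewrite gE hE WuE poweR_EFin -EFinM -EFinB -EFinD lee_fin -/kap.
rewrite mulrC -ler_pdivlMr//; rewrite WuE lee_fin in Wu.
rewrite -[leRHS](powR_divK c0 q0 p0).
by apply: ge0_ler_powR; rewrite ?nnegrE ?powR_ge0// ltW.
Qed.

End fixed.
End hardy_sobolev_limit.

Lemma poweR_root_le (R : realType) (X : \bar R) (e r : R) : 0 <= e -> 0 < r ->
  (0 <= X)%E -> (X `^ r^-1 <= (e `^ r^-1)%:E)%E -> (X <= e%:E)%E.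
Proof.
move=> e0 r0; case: X => [x||//]; last by rewrite poweRyr ?leye_eq// invr_eq0 gt_eqF.
rewrite poweR_EFin !lee_fin => x0 xe.
have rt y : 0 <= y -> (y `^ r^-1) `^ r = y.
  by move=> y0; rewrite -powRrM mulVf ?powRr1// gt_eqF.
by rewrite -(rt _ x0) -(rt _ e0) ge0_ler_powR ?nnegrE ?powR_ge0// ltW.
Qed.

(** * Approximating sequences for the Sobolev space *)

Section sobolev_limit.
Context (R : realType) (m : nat) (p s r : R) (p0 : 0 < p) (r0 : 0 < r).
Local Notation V := 'rV[R]_m.+1.
Local Notation mu := (@lebesgue_rV R m.+1).
Implicit Types (x y : V) (u v : V -> R).

Lemma half_spaceE x : (x \in (half_space : set V)) = (0 < ht x).
Proof. by apply/idP/idP => [/set_mem|?]//; exact/mem_set. Qed.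

Lemma measurable_half_space : measurable (half_space : set V).
Proof.
rewrite (_ : half_space = (fun x : V => 0 < ht x) @^-1` [set true]).
  rewrite -[X in measurable X]setTI.
  have mb : measurable_fun setT (fun x : V => 0 < ht x) by measurability.
  exact: mb.
by apply/seteqP; split => x.
Qed.

(** Only the restriction of [u] to the half-space is assumed measurable; extending it by 0 gives a
    function measurable on the whole space, and none of the integrals changes. *)
Lemma restrict_half u x : 0 < ht x -> (u \_ half_space) x = u x.
Proof. by move=> x0; rewrite patchE half_spaceE x0. Qed.

Lemma gagliardo_restrict u : gagliardo s p (u \_ half_space) = gagliardo s p u.
Proof.
by apply: eq_integral => z /set_mem[z1 z2]; rewrite !restrict_half.
Qed.

Lemma hardy_restrict u : hardy_integral s p (u \_ half_space) = hardy_integral s p u.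
Proof. by apply: eq_integral => x /set_mem x0; rewrite restrict_half. Qed.

Lemma weighted_restrict q b u :
  weighted_integral q b (u \_ half_space) = weighted_integral q b u.
Proof. by apply: eq_integral => x /set_mem x0; rewrite restrict_half. Qed.

Lemma Lnorm_halfE u v : Lnorm_half r (v \- u) =
  ((\int[mu]_x ((0 < ht x)%R%:R * `|v x - (u \_ half_space) x| `^ r)%:E) `^ r^-1)%E.
Proof.
rewrite /Lnorm_half unlock; congr poweR; apply: eq_integral => x _ /=.
case: (ltP 0 (ht x)) => [x0|x0].
  by rewrite !restrict_half// mul1r.
rewrite patchE half_spaceE ltNge x0/= mul0r (_ : point = 0 :> R)// normr0 powR0//.
by rewrite gt_eqF.
Qed.

Lemma sobolev0_approx u : sobolev0 s p u -> r = m.+1%:R * p / (m.+1%:R - s * p) ->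
  measurable_fun setT (u \_ half_space) /\ exists w : nat -> V -> R,
  [/\ forall k, tame (w k),
      forall e : R, 0 < e -> exists N, forall j k, (N <= j)%N -> (N <= k)%N ->
        (gagliardo s p (w j \- w k)%R <= e%:E)%E &
      {ae mu, forall x, 0 < ht x -> w k x @[k --> \oo] --> (u \_ half_space) x}].
Proof.
move=> [mu_ [v [tv vC vu]]] rE; rewrite -rE in vu.
have mu' : measurable_fun setT (u \_ half_space).
  by apply/(measurable_restrictT u measurable_half_space).
split; first exact: mu'.
have tame_v k : tame (v k) by exact: test_function_tame.
have mv k : measurable_fun setT (v k) by case: (tame_v k).
have gC (e : R) : 0 < e -> exists N, forall j k, (N <= j)%N -> (N <= k)%N ->
    (gagliardo s p (v j \- v k)%R <= e%:E)%E.
  move=> e0; have [N hN] := vC _ (powR_gt0 p^-1 e0); exists N => j k Nj Nk.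
  apply: (poweR_root_le (ltW e0) p0); last exact/ltW/hN.
  by apply: integral_ge0 => z _; rewrite lee_fin divr_ge0 ?powR_ge0.
pose f k x := (0 < ht x)%R%:R * `|v k x - (u \_ half_space) x| `^ r.
have mf k : measurable_fun setT (f k).
  by have mvk := mv k; rewrite /f; measurability.
have f0 k x : 0 <= f k x by rewrite mulr_ge0 ?powR_ge0.
have fc (e : R) : 0 < e -> exists N, forall k, (N <= k)%N ->
    (\int[mu]_x (f k x)%:E <= e%:E)%E.
  move=> e0; have er : (0 < (e `^ r^-1)%:E)%E by rewrite lte_fin powR_gt0.
  have [N _ hN] := vu _ (open_ereal_lt' er); exists N => k Nk.
  apply: (poweR_root_le (ltW e0) r0).
    by apply: integral_ge0 => x _; rewrite lee_fin.
  by rewrite /f -Lnorm_halfE; exact/ltW/hN.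
have [j jk hj] := ae_cvg0_subsequence mf f0 fc.
exists (fun k => v (j k)); split=> [k|e e0|].
- exact: tame_v.
- have [N hN] := gC e e0; exists N => a b Na Nb.
  by apply: hN; [exact: leq_trans Na (jk a)|exact: leq_trans Nb (jk b)].
(* Taking the root of order [r] passes from convergence of [|w k x - u x|^r] to that of [w k x]. *)
- apply: filterS hj => x fx x0.
  have ri : 0 < r^-1 by rewrite invr_gt0.
  have := cvg_norm_powR ri fx; rewrite normr0 powR0 ?gt_eqF// /f x0.
  under eq_fun do rewrite mul1r ger0_norm ?powR_ge0// -powRrM divff ?gt_eqF// powRr1//.
  move=> h; apply/subr_cvg0; exact/norm_cvg0P.
Qed.

End sobolev_limit.

Theorem theorem4p2 (R : realType) (n : nat) (p q s : R)
    (hn : (2 <= n)%N) (hp : 2 <= p) (hq : 2 <= q) (hs : 0 < s < 1)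
    (hsp : s * p < n%:R) (hpq : p < q)
    (hqle : q <= n%:R * p / (n%:R - s * p)) :
  let b := n%:R * (q^-1 - p^-1) + s in
  exists2 sigma : R, 0 < sigma &
    forall u : 'rV[R]_n -> R, sobolev0 s p u ->
      (gagliardo s p u - (hardy_const n s p)%:E * hardy_integral s p u
       >= sigma%:E * weighted_integral q b u `^ (p / q))%E.
Proof.
case: n hn hsp hqle => // m hm hsp hqle b.
have m0 : (0 < m)%N by [].
have /andP[s0 _] := hs.
have p0 : 0 < p by rewrite (lt_le_trans _ hp).
have q0 : 0 < q by exact: lt_trans hpq.
have nsp0 : 0 < m.+1%:R - s * p by rewrite subr_gt0.
(* The bound of [q] by the critical exponent, in the form used for the cubes of [high_bound]. *)
have nsp : m.+1%:R * (1 - p / q) <= s * p.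
  move: hqle; rewrite ler_pdivlMr// => h.
  have -> : m.+1%:R * (1 - p / q) = (m.+1%:R * q - m.+1%:R * p) / q.
    by field; rewrite gt_eqF.
  by rewrite ler_pdivrMr//; lra.
have r0 : 0 < m.+1%:R * p / (m.+1%:R - s * p) by rewrite divr_gt0// mulr_gt0.
have [sg sg0 nice] := hardy_sobolev_finite m0 hp hpq s0 nsp.
exists sg => // u hu.
have [mu' [w [tw wC wu]]] := sobolev0_approx p0 r0 hu erefl.
rewrite -(gagliardo_restrict p s u) -(hardy_restrict p s u) -(weighted_restrict q b u).
apply: (hardy_sobolev_limit hp q0 s0 sg0 _ mu' tw wC wu) => v tv.
apply: nice.
- by case: tv.
- by rewrite hardy_integralE; exact: (tame_integral_lty _ p0 tv).
- by rewrite weighted_integralE; exact: (tame_integral_lty _ q0 tv).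
Qed.
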